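(* Let $0<\alpha\le1$ and $\lambda>1$. There is a generic set $\mathcal{G}_2\subset\mathcal{F}(\alpha+)$ such that for every $f\in\mathcal{G}_2$ there is a unique $f$-invariant Lyapunov maximizing measure and it is supported on a periodic orbit.
   Context: $\mathcal{F}_\lambda(\alpha)$ is the class of $C^{1+\alpha}$ endomorphisms $f:S^1\to S^1$ of the circle ($C^1$ maps whose derivative is $\alpha$-Hölder) which are coverings of degree 2, orientation preserving, and expanding with $f'(x)>\lambda$ for all $x\in S^1$. It is given the $C^{1+\alpha}$-topology, induced by the norm $\|f\|_{1+\alpha}=\|f\|_{C^1}+\mathrm{Hold}_\alpha(f')$, where $\mathrm{Hold}_\alpha(g)=\sup_{0<d(x,y)\le1}|g(x)-g(y)|/d(x,y)^\alpha$. $\mathcal{F}(\alpha+)$ is the closure of $\bigcup_{\alpha<\beta\le 1}\mathcal{F}_\lambda(\beta)$ in $\mathcal{F}_\lambda(\alpha)$ with respect to the $C^{1+\alpha}$-topology, with the $C^{1+\alpha}$-topology. An $f$-invariant Borel probability is a Lyapunov maximizing measure if it maximizes $\int\log f'\,d\nu$ among all $f$-invariant Borel probabilities $\nu$. A set is generic if it contains a countable intersection of open dense subsets. *)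

(* Defs.v *)
From HB Require Import structures.
From mathcomp Require Import all_boot all_order all_algebra generic_quotient.
From mathcomp Require Import all_classical all_reals all_analysis.
From mathcomp Require Import lra.

Set Implicit Arguments.
Unset Strict Implicit.
Unset Printing Implicit Defensive.

Import Order.TTheory GRing.Theory Num.Theory.
Import numFieldNormedType.Exports.

Local Open Scope classical_set_scope.
Local Open Scope ring_scope.
Local Open Scope quotient_scope.

Section topological_notions.
Context {X Y : topologicalType}.

(* An [n]-sheeted covering; as [p] is continuous, each restriction
   [U i -> V] below is a homeomorphism. *)
Definition covering_of_degree (n : nat) (p : X -> Y) : Prop :=
  continuous p /\
  forall y : Y, exists2 V : set Y, open_nbhs y V &
    exists U : 'I_n -> set X,
      [/\ forall i, open (U i),
          trivIset setT U,
          p @^-1` V = \bigcup_i U i &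
          forall i, set_bij (U i) V p /\
            forall W, open W -> W `<=` U i -> open (p @` W)].

Definition generic (G : set X) : Prop :=
  exists2 U : (set X)^nat, (forall n, open (U n) /\ dense (U n)) &
    \bigcap_n U n `<=` G.

End topological_notions.

Section circle.
Context (R : realType).

Definition int_congr (s t : R) : bool := s - t \is a Num.int.

Lemma int_congr_equiv : equiv_class_of int_congr.
Proof.
rewrite /int_congr; split=> [s|s t|t s u].
- by rewrite subrr rpred0.
- by rewrite -opprB rpredN.
- move=> st tu; rewrite -(subrKA t); exact: rpredD.
Qed.

Definition int_congr_rel : equiv_rel R := EquivRelPack int_congr_equiv.

Definition circle : Type := quotient_topology {eq_quot int_congr_rel}.

HB.instance Definition _ := Quotient.on circle.
HB.instance Definition _ := Topological.on circle.
HB.instance Definition _ := Pointed.on circle.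

End circle.

HB.instance Definition _ (R : realType) :=
  Measurable.copy (circle R) (g_sigma_algebraType (@open (circle R))).

Section circle_maps.
Context {R : realType}.
Local Notation S1 := (circle R).
Implicit Types (f g : S1 -> S1) (x y z : S1) (alpha beta lambda : R).

(* The quotient metric of R/Z, a circle of length 1. *)
Definition circle_dist x y : R :=
  inf [set r | exists s t : R, [/\ \pi_S1 s = x, \pi_S1 t = y & r = `|s - t|]].

Definition is_lift f (F : R -> R) : Prop :=
  continuous F /\ forall t, \pi_S1 (F t) = f (\pi_S1 t).

(* Two continuous lifts of the same map differ by an integer constant, and
   [t |-> F (t + 1) - F t] is constant, so that [deriv f] depends neither on
   the choice of the lift nor on that of the representative of [x]. *)
Definition lift f : R -> R := xget (@id R : R -> R) [set F | is_lift f F].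

Definition deriv f x : R := derive1 (lift f) (repr x).

Definition C1_map f : Prop :=
  exists F, [/\ is_lift f F, forall t, derivable F t 1 & continuous (derive1 F)].

Definition Hold alpha (u : S1 -> R) : \bar R :=
  ereal_sup [set (`|u p.1 - u p.2| / circle_dist p.1 p.2 `^ alpha)%:E |
             p in [set p | 0 < circle_dist p.1 p.2 <= 1]].

Definition C1Holder alpha f : Prop :=
  C1_map f /\ (Hold alpha (deriv f) < +oo)%E.

Definition orientation_preserving f : Prop :=
  exists2 F, is_lift f F & {homo F : s t / s < t}.

Definition expanding_class lambda alpha f : Prop :=
  [/\ C1Holder alpha f, covering_of_degree 2 f, orientation_preserving f &
      forall x, lambda < deriv f x].

(* The distance of the norm [||.||_(1+alpha)]; the sup norm of [f - g] is
   replaced by the sup distance, since the maps take values in the circle. *)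
Definition C1Holder_dist alpha f g : \bar R :=
  (ereal_sup [set (circle_dist (f x) (g x))%:E | x in setT] +
   ereal_sup [set `|deriv f x - deriv g x|%:E | x in setT] +
   Hold alpha (fun x => deriv f x - deriv g x)%R)%E.

End circle_maps.

Section distance_theory.
Context {R : realType}.
Local Notation S1 := (circle R).
Implicit Types (f g h : S1 -> S1) (x y z : S1) (alpha : R).

Let dset x y :=
  [set r : R | exists s t, [/\ \pi_S1 s = x, \pi_S1 t = y & r = `|s - t|]].

Let dset_lb x y : has_inf (dset x y).
Proof.
split; first by exists `|repr x - repr y|, (repr x), (repr y); rewrite !reprK.
by exists 0 => _ [s [t [_ _ ->]]].
Qed.

Lemma circle_dist_le (s t : R) :
  circle_dist (\pi_S1 s) (\pi_S1 t) <= `|s - t|.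
Proof.
by apply: ge_inf; [have [] := dset_lb (\pi_S1 s) (\pi_S1 t) | exists s, t].
Qed.

Lemma circle_dist_ge0 x y : 0 <= circle_dist x y.
Proof.
by apply: lb_le_inf; [have [] := dset_lb x y | move=> _ [s [t [_ _ ->]]]].
Qed.

Lemma circle_distxx x : circle_dist x x = 0.
Proof.
apply/eqP; rewrite eq_le circle_dist_ge0 andbT.
by have := circle_dist_le (repr x) (repr x); rewrite subrr normr0 reprK.
Qed.

Lemma circle_distC x y : circle_dist x y = circle_dist y x.
Proof.
congr inf; apply/seteqP; split=> _ [s [t [sx ty ->]]];
  by exists t, s; rewrite distrC.
Qed.

Lemma circle_piP (s t : R) : \pi_S1 s = \pi_S1 t <-> s - t \is a Num.int.
Proof.
split=> [/eqmodP//|st]; exact/eqmodP.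
Qed.

Lemma circle_dist_triangle y x z :
  circle_dist x z <= circle_dist x y + circle_dist y z.
Proof.
rewrite -lerBlDr; apply: lb_le_inf; first by have [] := dset_lb x y.
move=> _ [s [t [sx ty ->]]]; rewrite lerBlDr -lerBlDl.
apply: lb_le_inf; first by have [] := dset_lb y z.
move=> _ [t' [u [t'y uz ->]]]; rewrite lerBlDl.
have tt' : t - t' \is a Num.int by apply/circle_piP; rewrite ty t'y.
have <- : \pi_S1 (u + (t - t')) = z.
  by rewrite -uz; apply/circle_piP; rewrite addrAC subrr add0r.
rewrite -sx; apply: (le_trans (circle_dist_le _ _)).
have -> : s - (u + (t - t')) = (s - t) + (t' - u) by lra.
exact: ler_normD.
Qed.

Lemma Hold_triangle alpha (u v w : S1 -> R) :
  (Hold alpha (fun x => u x - w x)%R <=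
   Hold alpha (fun x => u x - v x)%R + Hold alpha (fun x => v x - w x)%R)%E.
Proof.
apply: ge_ereal_sup => _ [p pd <-].
set c := circle_dist _ _ `^ _.
have c0 : 0 <= c^-1 by rewrite invr_ge0 powR_ge0.
apply: (@le_trans _ _ ((`|u p.1 - v p.1 - (u p.2 - v p.2)| / c)%:E +
                       (`|v p.1 - w p.1 - (v p.2 - w p.2)| / c)%:E)%E).
  rewrite -EFinD lee_fin -mulrDl ler_wpM2r//.
  have -> : u p.1 - w p.1 - (u p.2 - w p.2) =
    (u p.1 - v p.1 - (u p.2 - v p.2)) + (v p.1 - w p.1 - (v p.2 - w p.2)).
    by lra.
  exact: ler_normD.
by apply: leeD; apply: ereal_sup_ubound; exists p.
Qed.

Lemma C1Holder_distxx alpha f : (C1Holder_dist alpha f f <= 0)%E.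
Proof.
rewrite /C1Holder_dist; do 2?apply: adde_le0; apply: ge_ereal_sup => _ [p _ <-].
- by rewrite circle_distxx.
- by rewrite subrr normr0.
- by rewrite !subrr normr0 mul0r.
Qed.

Lemma C1Holder_distC alpha f g :
  C1Holder_dist alpha f g = C1Holder_dist alpha g f.
Proof.
rewrite /C1Holder_dist; congr (_ + _ + _)%E; congr ereal_sup; apply: eq_imagel.
- by move=> x _; rewrite circle_distC.
- by move=> x _; rewrite distrC.
- move=> p _; congr ((_ / _)%:E); rewrite -normrN; congr `|_|; lra.
Qed.

Lemma C1Holder_dist_triangle alpha g f h :
  (C1Holder_dist alpha f h <=
   C1Holder_dist alpha f g + C1Holder_dist alpha g h)%E.
Proof.
rewrite /C1Holder_dist addeACA; apply: leeD; last exact: Hold_triangle.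
rewrite addeACA; apply: leeD; apply: ge_ereal_sup => _ [x _ <-].
- apply: (@le_trans _ _ ((circle_dist (f x) (g x))%:E +
                         (circle_dist (g x) (h x))%:E)%E).
    by rewrite -EFinD lee_fin circle_dist_triangle.
  by apply: leeD; apply: ereal_sup_ubound; exists x.
- apply: (@le_trans _ _ (`|deriv f x - deriv g x|%:E +
                         `|deriv g x - deriv h x|%:E)%E).
    by rewrite -EFinD lee_fin ler_distD.
  by apply: leeD; apply: ereal_sup_ubound; exists x.
Qed.

End distance_theory.

Definition C1Holder_map (R : realType) (alpha : R) : Type :=
  {f : circle R -> circle R | C1Holder alpha f}.

HB.instance Definition _ (R : realType) (alpha : R) :=
  gen_eqMixin (C1Holder_map alpha).
HB.instance Definition _ (R : realType) (alpha : R) :=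
  gen_choiceMixin (C1Holder_map alpha).

Section C1Holder_topology.
Context {R : realType} {alpha : R}.
Local Notation M := (C1Holder_map alpha).

Definition C1Holder_ball (f : M) (e : R) : set M :=
  [set g : M | (C1Holder_dist alpha (sval f) (sval g) < e%:E)%E].

Let ball_center (f : M) (e : R) : 0 < e -> C1Holder_ball f e f.
Proof.
by move=> e0; apply: (le_lt_trans (C1Holder_distxx _ _)); rewrite lte_fin.
Qed.

Let ball_sym (f g : M) (e : R) : C1Holder_ball f e g -> C1Holder_ball g e f.
Proof. by rewrite /C1Holder_ball /= C1Holder_distC. Qed.

Let ball_triangle (f g h : M) (e1 e2 : R) :
  C1Holder_ball f e1 g -> C1Holder_ball g e2 h -> C1Holder_ball f (e1 + e2) h.
Proof.
move=> fg gh; apply: (le_lt_trans (C1Holder_dist_triangle _ (sval g) _ _)).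
by rewrite EFinD; apply: lteD.
Qed.

Let ent : set_system (M * M) := entourage_ C1Holder_ball.

HB.instance Definition _ := hasNbhs.Build M (nbhs_ ent).
HB.instance Definition _ := Nbhs_isPseudoMetric.Build R M
  erefl ball_center ball_sym ball_triangle erefl.

End C1Holder_topology.

Section spaces.
Context {R : realType}.
Implicit Types (lambda alpha beta : R).

Definition F_space lambda alpha : set (C1Holder_map alpha) :=
  [set f | expanding_class lambda alpha (sval f)].
Arguments F_space : clear implicits.

(* The closure is taken in the subspace [F_space lambda alpha], not in
   [C1Holder_map alpha]. *)
Definition F_plus lambda alpha : set (F_space lambda alpha) :=
  closure [set f : F_space lambda alpha |
    exists2 beta, alpha < beta <= 1 &
      expanding_class lambda beta (sval (set_val f))].

End spaces.

Arguments F_space {R} lambda alpha _.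
Arguments F_plus {R} lambda alpha _.

Section lyapunov.
Context {R : realType}.
Local Notation S1 := (circle R).
Implicit Types (f : S1 -> S1) (nu : probability S1 R).

Definition invariant_measure f nu : Prop :=
  forall A : set S1, measurable A -> nu (f @^-1` A) = nu A.

Definition lyapunov_maximizing f nu : Prop :=
  invariant_measure f nu /\
  forall mu : probability S1 R, invariant_measure f mu ->
    (\int[mu]_x (ln (deriv f x))%:E <= \int[nu]_x (ln (deriv f x))%:E)%E.

(* Periodic orbits are finite, hence closed, so that full measure means that
   the topological support lies in the orbit. *)
Definition supported_on_periodic_orbit f nu : Prop :=
  exists x n, [/\ (0 < n)%N, iter n f x = x &
    nu [set iter k f x | k in setT] = 1%E].

End lyapunov.

(* Main.v *)
Require Import Defs.
From HB Require Import structures.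
From mathcomp Require Import all_boot all_order all_algebra generic_quotient.
From mathcomp Require Import all_classical all_reals all_analysis.
From mathcomp Require Import measurable_realfun.
From mathcomp Require Import lra ring zify.
Set Implicit Arguments.
Unset Strict Implicit.
Unset Printing Implicit Defensive.

Import Order.TTheory GRing.Theory Num.Theory.
Import numFieldNormedType.Exports.
Local Open Scope classical_set_scope.
Local Open Scope ring_scope.

(** A small perturbation can reward one well chosen periodic orbit by more than
the rest of the dynamics can make up for.  Call a map locked when every map
C^(1+alpha)-close to it has a unique Lyapunov maximizing measure, carried by a
periodic orbit.  The interior of the set of maps with such a measure is open and
contains the locked maps, so it suffices that these are dense; as F(alpha+) is
the closure of the maps of class C^(1+beta) with beta > alpha, it suffices to
approximate such a map f, in the C^(1+alpha)-distance, by locked ones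
([dense_locked]).

Lift f to F : R -> R with F (t + 1) = F t + 2, put A = ln F' and let m be the
supremum of the averages of A on periodic orbits.  There is a beta-Hölder 1-periodic
function V (a sub-action, in the sense of Mañé's lemma) such that the reduced
function r = A - m + V - V o F is nonpositive ([reduced_le0]), and some orbit
stays in the zero set of r ([zero_orbit]).  Closing up a closest return of that
orbit yields periodic orbits O, at arbitrarily small scales rho, whose points
are (4 L + 30) rho apart, with L a bound of F', while the sum of r along O is at
least - K rho^beta ([good_orbit]).

Compose f with a diffeomorphism id + k of the circle where k vanishes on O, k' is
the constant k0 = e rho^alpha within rho of O, and k' <= 0 at distance at least
2 rho from O.  The alpha-Hölder constant of k' is of order e, so the new map is
close to f.  It gains gam = ln (1 + k0) at every step along O and nothing at a
step that lands away from O.  Because beta > alpha, all errors of order rho^beta,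
in particular the defect of O from being maximizing, are negligible against gam.

Let g be a map close enough to the perturbed one.  A periodic orbit of g shadows
O.  Relative to the average of ln g' on it, and after adding a bounded potential
modelled on V ([potential]), no step of a g-orbit gains anything and each step
that starts farther than 3 rho from the shadowing orbit loses at least gam / 8
([potential_step]).  Integrating, a maximizing measure only charges points whose
whole orbit stays near the shadowing orbit; by expansivity these are the points
of that orbit, which carries only one invariant probability ([circle_locked]). *)

(** * Hölder and bi-Lipschitz functions of a real variable *)

Section real_tools.
Context {R : realType}.
Implicit Types (s t C b c K : R) (u F : R -> R) (n q : int).

Definition holder C b u := forall s t, `|u s - u t| <= C * `|s - t| `^ b.

Definition bilip (c K : R) u :=
  forall s t, s <= t -> c * (t - s) <= u t - u s <= K * (t - s).

Definition expanding_lift (lam L : R) F :=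
  bilip lam L F /\ forall t, F (t + 1) = F t + 2.

Lemma shiftz u (c : R) : (forall t, u (t + 1) = u t + c) ->
  forall n t, u (t + n%:~R) = u t + c * n%:~R.
Proof.
move=> h n t.
have pos (m : nat) s : u (s + m%:R) = u s + c * m%:R.
  elim: m s => [|m IH] s; first by rewrite !addr0 mulr0 addr0.
  by rewrite -natr1 addrA h IH mulrDr mulr1 addrA.
case: n => m; first exact: pos.
rewrite NegzE mulrNz.
have := pos m.+1 (t - m.+1%:R); rewrite subrK => ->.
by rewrite mulrN addrK.
Qed.

Lemma shiftz0 u : (forall t, u (t + 1) = u t) ->
  forall n t, u (t + n%:~R) = u t.
Proof.
move=> h n t; rewrite (@shiftz u 0); first by rewrite mul0r addr0.
by move=> s; rewrite h addr0.
Qed.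

Lemma round_int t : exists n, `|t - n%:~R| <= 2^-1.
Proof.
exists (Num.floor (t + 2^-1)); have := floor_itv (t + 2^-1).
rewrite intrD => /andP[h1 h2]; rewrite ler_norml; lra.
Qed.

Lemma intr_lt1 n : `|n%:~R : R| < 1 -> n = 0.
Proof.
rewrite -intr_norm -[1]/(1%:~R) ltr_int => h; apply/eqP.
by rewrite -normr_eq0; lia.
Qed.

Lemma intr_ge1 n : n != 0 -> 1 <= `|n%:~R : R|.
Proof. by move=> n0; rewrite leNgt; apply/negP => /intr_lt1/eqP; rewrite (negbTE n0). Qed.

Lemma powR_le s t b : 0 <= b -> 0 <= s -> s <= t -> s `^ b <= t `^ b.
Proof.
move=> b0 s0 st; apply: ge0_ler_powR => //; rewrite nnegrE//.
exact: le_trans st.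
Qed.

Lemma powR_gt1 s b : 0 < b -> 1 < s -> 1 < s `^ b.
Proof.
move=> b0 s1; rewrite -[X in X < _](_ : 1 `^ b = 1); last by rewrite powR1.
by apply: gt0_ltr_powR => //; rewrite nnegrE; lra.
Qed.

Lemma holder_continuous C b u : 0 < b -> holder C b u -> continuous u.
Proof.
move=> b0 hu t; apply/cvgrPdist_le => e e0.
have C0 : 0 <= C.
  have := hu 1 0; rewrite subr0 normr1 powR1 mulr1; exact: le_trans.
have C1 : 0 < C + 1 by lra.
pose d := (e / (C + 1)) `^ b^-1.
have d0 : 0 < d by rewrite powR_gt0// divr_gt0.
near=> s.
have st : `|t - s| <= d by near: s; apply: cvgr_dist_le.
apply: (le_trans (hu t s)).
apply: (@le_trans _ _ (C * (d `^ b))).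
  by rewrite ler_wpM2l// powR_le// ltW.
rewrite /d -powRrM mulVf ?gt_eqF// powRr1; last by rewrite ltW// divr_gt0.
rewrite mulrCA ger_pMr// ler_pdivrMr; lra.
Unshelve. all: by end_near.
Qed.

Lemma bilip_abs c K u : 0 <= c -> bilip c K u ->
  forall s t, c * `|s - t| <= `|u s - u t| <= K * `|s - t|.
Proof.
move=> c0 h s t; wlog st : s t / s <= t.
  move=> w; have [/w//|/ltW/w] := leP s t.
  by rewrite distrC (distrC (u t)).
have /andP[h1 h2] := h _ _ st.
have h0 : 0 <= c * (t - s) by rewrite mulr_ge0// subr_ge0.
rewrite distrC (distrC (u s)) (ger0_norm (_ : 0 <= t - s)) ?subr_ge0//.
by rewrite ger0_norm ?h1 ?h2//; exact: le_trans h1.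
Qed.

Lemma bilip_continuous c K u : 0 <= c -> bilip c K u -> continuous u.
Proof.
move=> c0 h; apply: (@holder_continuous K 1) => // s t.
by rewrite powRr1//; have /andP[] := bilip_abs c0 h s t.
Qed.

Lemma bilip_surj c K u : 0 < c -> bilip c K u -> forall t, exists s, u s = t.
Proof.
move=> c0 h t.
pose a := `|t - u 0| / c.
have a0 : 0 <= a by rewrite divr_ge0// ltW.
have ca : c * a = `|t - u 0| by rewrite mulrC divfK// gt_eqF.
have /andP[h1 _] := h _ _ a0; have na0 : - a <= 0 by lra.
have /andP[h2 _] := h _ _ na0.
rewrite !subr0 ca in h1; rewrite sub0r opprK ca in h2.
have n1 := ler_norm (t - u 0); have n2 := ler_norm (- (t - u 0)).
rewrite normrN in n2.
have [|||s _ us] := @IVT R u (- a) a t; [by lra| | |by exists s].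
  by apply: continuous_subspaceT => ?; apply: (bilip_continuous (ltW c0) h).
have ge : u (- a) <= t <= u a by lra.
by rewrite min_l ?max_r//; lra.
Qed.

Lemma bilip_iter c K u k : 0 <= c -> 0 <= K -> bilip c K u ->
  bilip (c ^+ k) (K ^+ k) (iter k u).
Proof.
move=> c0 K0 h; elim: k => [|k IH] s t st /=.
  by rewrite !expr0 !mul1r lexx.
have /andP[h1 h2] := IH _ _ st.
have st' : iter k u s <= iter k u t.
  by rewrite -subr_ge0; apply: le_trans h1; rewrite mulr_ge0 ?exprn_ge0 ?subr_ge0.
have /andP[h3 h4] := h _ _ st'.
rewrite !exprS -!mulrA; apply/andP; split.
  by apply: le_trans h3; rewrite ler_wpM2l.
by apply: (le_trans h4); rewrite ler_wpM2l.
Qed.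

End real_tools.

(** * Birkhoff sums, closing and distortion for expanding lifts *)

Ltac lra_with h := move: (h) => ?; lra.

Section birkhoff_sums.
Context {R : realType}.
Implicit Types (u F : R -> R).

Definition birkhoff F u n t := \sum_(i < n) u (iter i F t).

Lemma birkhoffS F u n t : birkhoff F u n.+1 t = u t + birkhoff F u n (F t).
Proof.
by rewrite /birkhoff big_ord_recl; congr (_ + _); apply: eq_bigr => i _;
  rewrite -iterSr.
Qed.

Lemma birkhoffSr F u n t : birkhoff F u n.+1 t = birkhoff F u n t + u (iter n F t).
Proof. by rewrite /birkhoff big_ord_recr. Qed.

Lemma birkhoffD F u n k t :
  birkhoff F u (n + k) t = birkhoff F u n t + birkhoff F u k (iter n F t).
Proof.
elim: n t => [|n IH] t; first by rewrite /birkhoff big_ord0 add0r.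
by rewrite addSn !birkhoffS IH addrA -iterSr.
Qed.

(** The coboundary telescopes. *)
Lemma birkhoff_coboundary F u v m n t :
  birkhoff F (fun s => u s - m + v s - v (F s)) n t =
  birkhoff F u n t - m *+ n + v t - v (iter n F t).
Proof.
elim: n => [|n IH]; first by rewrite /birkhoff !big_ord0 mulr0n/=; lra.
by rewrite !birkhoffSr IH mulrSr /=; lra.
Qed.

End birkhoff_sums.

Section exponential_growth.
Context {R : realType}.

Lemma bernoulli (lam : R) (k : nat) : 1 <= lam -> 1 + k%:R * (lam - 1) <= lam ^+ k.
Proof.
move=> lam1; elim: k => [|k IH]; first by rewrite mul0r addr0.
rewrite exprS -natr1.
have h1 : 0 <= k%:R * (lam - 1) ^+ 2 by rewrite mulr_ge0// sqr_ge0.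
have h2 : lam * (1 + k%:R * (lam - 1)) <= lam * lam ^+ k by rewrite ler_wpM2l//; lra.
by move: h1 h2; rewrite expr2; move: (k%:R : R) (lam * lam ^+ k) => y Y; nra.
Qed.

(** Expansivity: an expanded distance that stays bounded is zero. *)
Lemma expand_bounded (lam d B : R) : 1 < lam ->
  (forall k, lam ^+ k * d <= B) -> d <= 0.
Proof.
move=> lam1 H; rewrite leNgt; apply/negP => d0.
have c0 : 0 < (lam - 1) * d by rewrite mulr_gt0//; lra.
pose k := (Num.trunc (B / ((lam - 1) * d))).+1.
have hk : B < k%:R * ((lam - 1) * d).
  by rewrite -ltr_pdivrMr//; exact: truncnS_gt.
have := H k; have := bernoulli k (ltW lam1) => h.
have h2 : (1 + k%:R * (lam - 1)) * d <= lam ^+ k * d by rewrite ler_wpM2r// ltW.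
by rewrite mulrDl mul1r -mulrA in h2; lra.
Qed.

End exponential_growth.

Section expanding_dynamics.
Context {R : realType} (lam L : R) (F : R -> R).
Hypotheses (lam1 : 1 < lam) (hF : expanding_lift lam L F).
Implicit Types (u : R -> R) (s t : R) (q : int).

Let lam0 : 0 <= lam. Proof. exact: le_trans (ltW lam1). Qed.

Lemma expanding_lift_le : lam <= L.
Proof.
have /andP[h1 h2] := hF.1 0 1 ler01.
by rewrite subr0 !mulr1 in h1 h2; exact: le_trans h2.
Qed.

Let L0 : 0 <= L. Proof. exact: le_trans expanding_lift_le. Qed.

Lemma iter_bilip k : bilip (lam ^+ k) (L ^+ k) (iter k F).
Proof. apply: bilip_iter => //; exact: hF.1. Qed.

Lemma iter_continuous k : continuous (iter k F).
Proof. by apply: bilip_continuous (iter_bilip k); rewrite exprn_ge0. Qed.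

Lemma iter_surj k t : exists s, iter k F s = t.
Proof. by apply: bilip_surj (iter_bilip k) t; rewrite exprn_gt0//; lra_with lam1. Qed.

Lemma iter_shift k q t :
  iter k F (t + q%:~R) = iter k F t + (q * 2 ^+ k)%:~R.
Proof.
elim: k => [|k IH]/=; first by rewrite expr0 mulr1.
rewrite IH (shiftz hF.2) exprS mulrCA (intrM _ 2).
by [].
Qed.

Lemma lam_exp_ge k : (0 < k)%N -> lam <= lam ^+ k.
Proof.
by case: k => // k _; rewrite exprS ler_peMr// exprn_ege1// ltW.
Qed.

Lemma iter_dist k s t : lam ^+ k * `|s - t| <= `|iter k F s - iter k F t| <= L ^+ k * `|s - t|.
Proof. by apply: bilip_abs (iter_bilip k) s t; rewrite exprn_ge0. Qed.

Lemma iter_dist_sub k n s t : (k <= n)%N ->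
  lam ^+ (n - k) * `|iter k F s - iter k F t| <= `|iter n F s - iter n F t|.
Proof.
move=> kn; rewrite -{2 3}(subnK kn) !iterD.
by have /andP[] := iter_dist (n - k) (iter k F s) (iter k F t).
Qed.

(** Since [F] expands, [iter p F x - x] is bi-Lipschitz, hence onto, and takes the
value [q].  As [x] closes up exactly, [iter p F x - iter p F z] is [x - z] up to the closing
defect of [z]; being also at least [lam] times as large, it forces [x] to be close to [z]. *)
Lemma closing p z q : (0 < p)%N -> exists x,
  [/\ iter p F x = x + q%:~R,
      `|x - z| <= `|iter p F z - z - q%:~R| / (lam - 1) &
      `|iter p F x - iter p F z| <=
        `|iter p F z - z - q%:~R| * (lam / (lam - 1))].
Proof.
move=> p0; set e := `|_|.
have lp := lam_exp_ge p0; have l1 := lam1.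
have [x hx] : exists x, iter p F x - x = q%:~R.
  apply: (@bilip_surj _ (lam - 1) (L ^+ p - 1) (fun x => iter p F x - x)).
    lra.
  move=> s t st; have /andP[h1 h2] := iter_bilip p st.
  have : lam * (t - s) <= lam ^+ p * (t - s) by rewrite ler_wpM2r ?subr_ge0.
  move=> h3; rewrite !mulrBl !mul1r; apply/andP; split; lra.
have ex : iter p F x - iter p F z = (x - z) - (iter p F z - z - q%:~R).
  by rewrite -hx; lra.
have xz : `|x - z| <= e / (lam - 1).
  rewrite ler_pdivlMr; last lra.
  have /andP[h1 _] := iter_dist p x z.
  have h2 : `|iter p F x - iter p F z| <= `|x - z| + e.
    by rewrite ex; exact: ler_normB.
  have : lam * `|x - z| <= lam ^+ p * `|x - z| by rewrite ler_wpM2r.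
  by rewrite mulrBr mulr1 mulrC; lra.
exists x; split=> //; first lra.
rewrite ex; apply: (le_trans (ler_normB _ _)); rewrite -/e.
have -> : lam / (lam - 1) = (lam - 1)^-1 + 1.
  by field; rewrite gt_eqF//; lra.
by rewrite mulrDr mulr1 lerD2r.
Qed.

Section holder_observable.
Context (A : R -> R) (C b : R).
Hypotheses (b0 : 0 < b) (hA : holder C b A).

(** The sum of the geometric series of general term [C (lam^b)^(-i)], [i >= 1]. *)
Definition distortion := C / (lam `^ b - 1).

Let lamb : 1 < lam `^ b. Proof. exact: powR_gt1. Qed.

Lemma holder_ge0 : 0 <= C.
Proof. have := hA 1 0; rewrite subr0 normr1 powR1 mulr1; exact: le_trans. Qed.

Lemma distortion_ge0 : 0 <= distortion.
Proof. by rewrite divr_ge0 ?holder_ge0//; lra_with lamb. Qed.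

(** The contraction of backward orbits bounds the sum by a geometric series.  The
term [distortion * |s - t|^b] on the left makes the induction close: one
expansion step pays for [C * |s - t|^b]. *)
Lemma birkhoff_distortion n s t :
  \sum_(i < n) `|A (iter i F s) - A (iter i F t)| + distortion * `|s - t| `^ b
  <= distortion * `|iter n F s - iter n F t| `^ b.
Proof.
elim: n s t => [|n IH] s t; first by rewrite big_ord0 add0r.
rewrite big_ord_recl /= -/(iter n F) -iterS.
have -> : \sum_(i < n) `|A (iter (lift ord0 i) F s) - A (iter (lift ord0 i) F t)|
  = \sum_(i < n) `|A (iter i F (F s)) - A (iter i F (F t))|.
  by apply: eq_bigr => i _; rewrite -!iterSr.
have := IH (F s) (F t); rewrite -!iterSr; apply: le_trans.
rewrite addrAC [leRHS]addrC lerD2r.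
apply: (@le_trans _ _ (C * `|s - t| `^ b + distortion * `|s - t| `^ b)).
  by rewrite lerD2r.
have -> : C * `|s - t| `^ b + distortion * `|s - t| `^ b =
          distortion * (lam * `|s - t|) `^ b.
  rewrite powRM// mulrA -mulrDl; congr (_ * _).
  by rewrite /distortion; field; rewrite gt_eqF//; lra_with lamb.
apply: ler_wpM2l; first exact: distortion_ge0.
apply: powR_le; [exact: ltW | exact: mulr_ge0 |].
by have /andP[] := bilip_abs lam0 hF.1 s t.
Qed.

End holder_observable.
End expanding_dynamics.

(** * Sub-actions and an orbit in the zero set of the reduced function *)

Section subaction.
Context {R : realType} (lam L : R) (F : R -> R).
Hypotheses (lam1 : 1 < lam) (hF : expanding_lift lam L F).
Context (A : R -> R) (C b : R).
Hypotheses (b0 : 0 < b) (hA : holder C b A) (A1 : forall t, A (t + 1) = A t).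
Implicit Types (u : R -> R) (s t m : R) (q : int).

Let C0 : 0 <= C := holder_ge0 hA.

Local Notation S := (birkhoff F A).
Local Notation D := (distortion lam C b).

Let D0 : 0 <= D := distortion_ge0 lam1 b0 hA.

Lemma periodic_holder_bound t : `|A t - A 0| <= C.
Proof.
have [n hn] := round_int t.
rewrite -(shiftz0 A1 (- n) t) mulrNz; apply: (le_trans (hA _ _)).
rewrite subr0 -[leRHS]mulr1 ler_wpM2l//.
rewrite -[leRHS](_ : 1 `^ b = 1); last by rewrite powR1.
by apply: powR_le; rewrite ?(ltW b0)//; apply: (le_trans hn); lra.
Qed.

Lemma birkhoff_le n s t :
  S n s <= S n t + D * `|iter n F s - iter n F t| `^ b.
Proof.
have h := birkhoff_distortion lam1 hF b0 hA n s t.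
have h2 : 0 <= D * `|s - t| `^ b by rewrite mulr_ge0// powR_ge0.
rewrite -lerBlDl; apply: le_trans (_ : \sum_(i < n) `|A (iter i F s) - A (iter i F t)| <= _).
  rewrite -sumrB; apply: ler_sum => i _; exact: ler_norm.
lra.
Qed.

(** On lifts, a periodic point of the circle map is a solution of
[iter p F y = y + q] for some integer [q]. *)
Definition periodic_averages := [set r : R | exists p y q,
  [/\ (0 < p)%N, iter p F y = y + q%:~R & r = S p y / p%:R]].

Definition max_average : R := sup periodic_averages.
Local Notation m := max_average.

Lemma has_sup_periodic_averages : has_sup periodic_averages.
Proof.
split.
  have [x [hx _ _]] := closing lam1 hF 0 0 (ltnSn 0).
  by exists (S 1 x / 1%:R), 1%N, x, 0.
exists (A 0 + C) => _ [p [y [q [p0 _ ->]]]].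
rewrite ler_pdivrMr ?ltr0n//.
rewrite mulr_natr -[X in _ *+ X]card_ord -sumr_const; apply: ler_sum => i _.
have := periodic_holder_bound (iter i F y); rewrite ler_norml; lra.
Qed.

Lemma birkhoff_periodic_le p y q : iter p F y = y + q%:~R -> S p y <= m *+ p.
Proof.
case: p => [|p] hy; first by rewrite /birkhoff big_ord0.
rewrite -mulr_natr -ler_pdivrMr//.
apply: ub_le_sup; first by case: has_sup_periodic_averages.
by exists p.+1, y, q.
Qed.

(** Every orbit segment has closing defect at most [1 / 2], so it is followed by a
periodic orbit, whose average is at most [max_average]. *)
Lemma birkhoff_upper : exists B, forall n y, S n y <= m *+ n + B.
Proof.
exists (D * (2^-1 * (lam / (lam - 1))) `^ b) => n y.
have B0 : 0 <= D * (2^-1 * (lam / (lam - 1))) `^ b by rewrite mulr_ge0 ?powR_ge0.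
case: n => [|n]; first by rewrite /birkhoff big_ord0 mulr0n add0r.
have [q hq] := round_int (iter n.+1 F y - y).
have [x [hx _ dx]] := closing lam1 hF y q (ltn0Sn n).
have := birkhoff_le n.+1 y x; have := birkhoff_periodic_le hx.
suff : D * `|iter n.+1 F y - iter n.+1 F x| `^ b <= D * (2^-1 * (lam / (lam - 1))) `^ b by lra.
apply: ler_wpM2l => //; apply: powR_le; rewrite ?(ltW b0)// distrC.
apply: (le_trans dx); apply: ler_wpM2r => //.
by rewrite divr_ge0//; lra_with lam1.
Qed.

(** The integer [q] lets [y] range over the lifts of all [n]-th preimages of [t] on
the circle, which makes [subaction] 1-periodic. *)
Definition past_sums t := [set r : R | exists n y q,
  iter n F y = t + q%:~R /\ r = S n y - m *+ n].

Definition subaction t : R := sup (past_sums t).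
Local Notation V := subaction.

Lemma has_sup_past t : has_sup (past_sums t).
Proof.
split; first by exists (S 0 t - m *+ 0), 0%N, t, 0; rewrite addr0.
have [B hB] := birkhoff_upper; exists B => _ [n [y [q [_ ->]]]].
by have := hB n y; lra.
Qed.

Lemma past_le t r : past_sums t r -> r <= V t.
Proof. by move=> h; apply: ub_le_sup h; case: (has_sup_past t). Qed.

Lemma subaction_le t r : (forall x, past_sums t x -> x <= r) -> V t <= r.
Proof. by move=> h; apply: ge_sup => //; case: (has_sup_past t). Qed.

Lemma subaction_periodic t : V (t + 1) = V t.
Proof.
apply/eqP; rewrite eq_le; apply/andP; split;
  apply: subaction_le => _ [n [y [q [hy ->]]]]; apply: past_le;
  exists n, y.
- by exists (q + 1); split=> //; rewrite hy intrD; lra.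
- by exists (q - 1); split=> //; rewrite hy intrB; lra.
Qed.

(** A preimage of [s] is followed by a preimage of [t] along the same inverse branch;
the two Birkhoff sums differ by the distortion. *)
Lemma subaction_holder : holder D b V.
Proof.
have half s t : V s <= V t + D * `|s - t| `^ b.
  apply: subaction_le => _ [n [y [q [hy ->]]]].
  have [y' hy'] := iter_surj lam1 hF n (t + q%:~R).
  have h1 : S n y' - m *+ n <= V t by apply: past_le; exists n, y', q.
  have := birkhoff_le n y y'; rewrite hy hy'.
  have -> : s + q%:~R - (t + q%:~R) = s - t by lra.
  lra.
move=> s t; have h1 := half s t; have h2 := half t s.
by rewrite distrC in h2; rewrite ler_norml; lra.
Qed.

(** Cohomologous to [A - m], and nonpositive because [subaction] is a supremum over pasts. *)
Definition reduced t := A t - m + V t - V (F t).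

Lemma reduced_le0 t : reduced t <= 0.
Proof.
rewrite /reduced -[X in X - _]addrC addrA.
suff : V t <= V (F t) - (A t - m) by lra.
apply: subaction_le => _ [n [y [q [hy ->]]]].
suff : S n y - m *+ n + (A t - m) <= V (F t) by lra.
apply: past_le; exists n.+1, y, (2 * q); split.
  by rewrite /= hy (shiftz hF.2) (intrM _ 2).
by rewrite birkhoffSr hy (shiftz0 A1) mulrS; lra.
Qed.

Lemma reduced_periodic t : reduced (t + 1) = reduced t.
Proof.
rewrite /reduced A1 subaction_periodic hF.2 -[2]/(2%:~R).
by rewrite (shiftz0 subaction_periodic).
Qed.

Lemma reduced_holder : holder (C + D + D * L `^ b) b reduced.
Proof.
move=> s t.
have -> : reduced s - reduced t =
  (A s - A t) + (V s - V t) - (V (F s) - V (F t)) by rewrite /reduced; lra.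
apply: (le_trans (ler_normB _ _)); rewrite mulrDl; apply: lerD.
  by apply: (le_trans (ler_normD _ _)); rewrite mulrDl; apply: lerD;
    [exact: hA | exact: subaction_holder].
apply: (le_trans (subaction_holder _ _)); rewrite -mulrA ler_wpM2l//.
have L0 : 0 <= L.
  by apply: le_trans (expanding_lift_le hF); lra_with lam1.
rewrite -powRM//; apply: powR_le; rewrite ?(ltW b0)//.
have lam0 : 0 <= lam by lra_with lam1.
by have /andP[] := bilip_abs lam0 hF.1 s t.
Qed.

Lemma reduced_continuous : continuous reduced.
Proof. exact: holder_continuous b0 reduced_holder. Qed.

Lemma birkhoff_reduced n t :
  birkhoff F reduced n t = S n t - m *+ n + V t - V (iter n F t).
Proof. exact: birkhoff_coboundary. Qed.

Lemma birkhoff_reduced_le0 n t : birkhoff F reduced n t <= 0.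
Proof. by apply: sumr_le0 => i _; exact: reduced_le0. Qed.

Lemma birkhoff_reduced_continuous n : continuous (birkhoff F reduced n).
Proof.
elim: n => [|n IH] t.
  have -> : birkhoff F reduced 0 = cst 0.
    by apply/funext => s; rewrite /birkhoff big_ord0.
  exact: cvg_cst.
have -> : birkhoff F reduced n.+1 = birkhoff F reduced n \+ (reduced \o iter n F).
  by apply/funext => s; rewrite birkhoffSr.
apply: cvgD; first exact: IH.
apply: continuous_comp; first exact: (iter_continuous lam1 hF).
exact: reduced_continuous.
Qed.

Lemma birkhoff_reduced_shift n q t :
  birkhoff F reduced n (t + q%:~R) = birkhoff F reduced n t.
Proof.
apply: eq_bigr => i _.
by rewrite (iter_shift hF) (shiftz0 reduced_periodic).
Qed.

Lemma birkhoff_iter_periodic k p y q : iter p F y = y + q%:~R ->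
  birkhoff F reduced p (iter k F y) = birkhoff F reduced p y.
Proof.
move=> hy; elim: k => //= k IH; rewrite -IH.
have hk : iter p F (iter k F y) = iter k F y + (q * 2 ^+ k)%:~R.
  by rewrite -iterD addnC iterD hy (iter_shift hF).
move: (iter k F y) hk => x hx.
apply: (@addrI _ (reduced x)); rewrite -birkhoffS birkhoffSr hx.
by rewrite (shiftz0 reduced_periodic) addrC.
Qed.

(** If all the sums of length [n] were at most some [e < 0], every periodic average
would be at most [max_average + e / n]: sum the sums of length [n] along a
periodic orbit in the two possible orders. *)
Lemma birkhoff_reduced_max n : exists2 z, 0 <= z <= 1 & 0 <= birkhoff F reduced n z.
Proof.
have [|z z01 hz] := @EVT_max R (birkhoff F reduced n) 0 1 ler01.
  by apply: continuous_subspaceT; exact: birkhoff_reduced_continuous.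
have z01' : 0 <= z <= 1 by move: z01; rewrite in_itv.
exists z => //; rewrite leNgt; apply/negP => neg.
have n0 : (0 < n)%N.
  by case: n neg {hz} => //; rewrite /birkhoff big_ord0 ltxx.
set e := birkhoff F reduced n z in neg hz.
have all_le t : birkhoff F reduced n t <= e.
  rewrite -(birkhoff_reduced_shift n (- Num.floor t)) hz// in_itv/= mulrNz.
  by have := floor_itv t; rewrite intrD; lra.
suff : m <= m + e / n%:R.
  by rewrite lerDl pmulr_lge0 ?invr_gt0 ?ltr0n// leNgt neg.
apply: ge_sup; first by case: has_sup_periodic_averages.
move=> _ [p [y [q [p0 hy ->]]]].
rewrite ler_pdivrMr ?ltr0n//.
have h1 : \sum_(j < p) birkhoff F reduced n (iter j F y) <= e *+ p.
  by rewrite -[X in _ *+ X]card_ord -sumr_const; apply: ler_sum => i _.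
have h2 : \sum_(j < p) birkhoff F reduced n (iter j F y) =
          (S p y - m *+ p) *+ n.
  rewrite /birkhoff exchange_big/= -[X in _ *+ X]card_ord -sumr_const.
  apply: eq_bigr => i _.
  transitivity (birkhoff F reduced p (iter i F y)).
    by apply: eq_bigr => j _; rewrite -!iterD addnC.
  rewrite (birkhoff_iter_periodic _ hy) birkhoff_reduced hy.
  by rewrite (shiftz0 subaction_periodic) addrK.
rewrite h2 -(mulr_natr (_ - _)) -(mulr_natr e) -(mulr_natr m) in h1.
have n0' : 0 < n%:R :> R by rewrite ltr0n.
have -> : (m + e / n%:R) * p%:R = m * p%:R + (e * p%:R) / n%:R by ring.
by rewrite -lerBlDl ler_pdivlMr.
Qed.

(** The points of [birkhoff_reduced_max] have sums [>= 0] of every length up to [n],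
since the terms are nonpositive.  A cluster point of these points as [n] grows has sums
[>= 0] of all lengths, so all the terms along its orbit vanish. *)
Lemma zero_orbit : exists z, forall k, reduced (iter k F z) = 0.
Proof.
pose H n : set R := [set z | 0 <= birkhoff F reduced n z].
have [z_ z01 zH] : exists2 z_ : nat -> R, (forall n, `[0, 1]%classic (z_ n)) & forall n, H n (z_ n).
  have /choice[z_ hz] : forall n, exists z, (0 <= z <= 1) /\ H n z.
    by move=> n; have [z z1 z2] := birkhoff_reduced_max n; exists z.
  exists z_ => n; last by case: (hz n).
  by rewrite /= in_itv/=; case: (hz n).
have [z [_ cz]] : `[0, 1]%classic `&` cluster (z_ @ \oo) !=set0.
  apply: (@segment_compact R 0 1).
  by exists 0%N => // n _; exact: z01.
have Hz n : 0 <= birkhoff F reduced n z.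
  rewrite leNgt; apply/negP => neg.
  have := cz (H n) [set s | birkhoff F reduced n s < 0].
  case.
  - exists n => // k /= nk.
    have hk : 0 <= birkhoff F reduced k (z_ k) := zH k.
    suff h : birkhoff F reduced k (z_ k) <= birkhoff F reduced n (z_ k).
      exact: le_trans hk h.
    rewrite -{1}(subnKC nk) birkhoffD.
    by have := birkhoff_reduced_le0 (k - n) (iter n F (z_ k)); lra.
  - by have := @birkhoff_reduced_continuous n z; move=> /cvgr_lt /(_ _ neg).
  - by move=> s [/= h1 h2]; move: (lt_le_trans h2 h1); rewrite ltxx.
exists z => k; apply/eqP; rewrite eq_le reduced_le0/=.
have := Hz k.+1; rewrite birkhoffSr.
by have := birkhoff_reduced_le0 k z; lra.
Qed.

End subaction.

(** * Closest returns and well separated periodic orbits *)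

Section closest_returns.
Context {R : realType}.
Implicit Types (t r : R) (n q : int).

(** The distance from [t] to the nearest integer, so the circle distance of [s] and [t] is
[int_dist (s - t)]. *)
Definition int_dist t : R := `|t - (Num.floor (t + 2^-1))%:~R|.

Lemma int_dist_le n t : int_dist t <= `|t - n%:~R|.
Proof.
rewrite /int_dist; set k := Num.floor _.
have hk : `|t - k%:~R| <= 2^-1.
  have := floor_itv (t + 2^-1); rewrite -/k intrD => /andP[h1 h2].
  by rewrite ler_norml; lra.
have [->//|/eqP kn] := eqVneq n k.
have /intr_ge1 h : (k - n != 0) by lia.
have := h R; rewrite intrB.
have -> : k%:~R - n%:~R = (t - n%:~R) - (t - k%:~R) by lra.
move=> h1; have := ler_normB (t - n%:~R) (t - k%:~R); lra.
Qed.

Lemma pigeonhole_circle (z : nat -> R) N : (0 < N)%N ->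
  exists i j : 'I_N.+1, i != j /\ int_dist (z i - z j) <= N%:R^-1.
Proof.
move=> N0; have N0' : 0 < N%:R :> R by rewrite ltr0n.
pose fr t := t - (Num.floor t)%:~R.
have fr01 t : 0 <= fr t < 1.
  by have := floor_itv t; rewrite intrD /fr; lra.
pose bin t := Num.trunc (N%:R * fr t).
have binE t : (bin t)%:R <= N%:R * fr t < (bin t)%:R + 1.
  have := @truncn_itv R (N%:R * fr t).
  rewrite natr1; apply; rewrite mulr_ge0 ?ler0n//.
  by have /andP[] := fr01 t.
have binN t : (bin t < N)%N.
  have /andP[h _] := binE t; have /andP[_ h1] := fr01 t.
  by rewrite -(ltr_nat R); apply: (le_lt_trans h); rewrite gtr_pMr.
pose f (i : 'I_N.+1) : 'I_N := Ordinal (binN (z i)).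
have /injectivePn[i [j ij fij]] : ~~ injectiveb f.
  apply/negP => /injectiveP /leq_card; rewrite !card_ord; lia.
exists i, j; split=> //.
apply: (le_trans (int_dist_le (Num.floor (z i) - Num.floor (z j)) _)).
have -> : z i - z j - (Num.floor (z i) - Num.floor (z j))%:~R = fr (z i) - fr (z j).
  by rewrite intrB /fr; lra.
have bij : bin (z i) = bin (z j) by case: (fij).
have h1 := binE (z i); have h2 := binE (z j); rewrite bij in h1.
rewrite -[leRHS]mul1r ler_pdivlMr// -[X in _ * X]gtr0_norm// -normrM mulrC.
rewrite mulrBr ler_norml; lra.
Qed.

(** Among finitely many points of the orbit that are crowded enough, take a pair at
minimal distance: any two distinct points between them are then at least as far apart. *)
Lemma closest_return (z : nat -> R) (d : R) : 0 < d ->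
  exists i p, [/\ (0 < p)%N, int_dist (z (i + p)%N - z i) <= d &
    forall k l n, (k < p)%N -> (l < p)%N -> k != l ->
     int_dist (z (i + p)%N - z i) <= `|z (i + k)%N - z (i + l)%N - n%:~R|].
Proof.
move=> d0.
pose N := (Num.trunc d^-1).+1.
have Nd : N%:R^-1 <= d.
  rewrite -[leRHS]invrK lef_pV2 ?posrE ?invr_gt0 ?ltr0n//.
  by apply/ltW; rewrite /N; exact: truncnS_gt.
have [i0 [j0 [ij0 hij0]]] := @pigeonhole_circle z N isT.
pose P (x : 'I_N.+1 * 'I_N.+1) := x.1 != x.2.
pose G (x : 'I_N.+1 * 'I_N.+1) := int_dist (z x.1 - z x.2).
have [[j i] /= ji hmin] := @Order.TotalTheory.arg_minP _ _ _ (i0, j0) P G ij0.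
have Gsym k l n : (k <= N)%N -> (l <= N)%N -> k != l -> G (j, i) <= `|z k - z l - n%:~R|.
  move=> kN lN kl.
  have := hmin (inord k, inord l); rewrite /P /G /= -val_eqE/= !inordK// => /(_ kl) h.
  exact: le_trans h (int_dist_le _ _).
have Gd : G (j, i) <= d by apply: (le_trans (hmin (i0, j0) ij0)); exact: le_trans Nd.
have nle (m n : nat) : (m < n)%N -> (n <= N)%N -> int_dist (z n - z m) <= G (j, i) ->
  exists i p, [/\ (0 < p)%N, int_dist (z (i + p)%N - z i) <= d &
    forall k l n, (k < p)%N -> (l < p)%N -> k != l ->
     int_dist (z (i + p)%N - z i) <= `|z (i + k)%N - z (i + l)%N - n%:~R|].
  move=> mn nN h; exists m, (n - m)%N; rewrite subnKC ?(ltnW mn)//; split.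
  - by rewrite subn_gt0.
  - exact: le_trans Gd.
  - move=> k l q kp lp kl; apply: (le_trans h); apply: Gsym; lia.
have [lt|] := ltnP i j.
  apply: (nle i j) => //; have := ltn_ord j; lia.
rewrite leq_eqVlt => /orP[/eqP/val_inj e|lt]; first by move: ji; rewrite /P/= e eqxx.
apply: (nle j i) => //; first by have := ltn_ord i; lia.
rewrite /G/=; apply: (le_trans (int_dist_le (- Num.floor (z j - z i + 2^-1)) _)).
by rewrite mulrNz opprK -normrN opprD opprB.
Qed.

End closest_returns.

Section good_orbits.
Context {R : realType} (lam L : R) (F : R -> R).
Hypotheses (lam1 : 1 < lam) (hF : expanding_lift lam L F).
Context (u : R -> R) (C b : R).
Hypotheses (b0 : 0 < b) (hu : holder C b u) (u1 : forall t, u (t + 1) = u t).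
Implicit Types (s t x : R) (n q : int).

Let lam0 : 0 <= lam. Proof. exact: le_trans (ltW lam1). Qed.
Let L1 : 1 <= L. Proof. exact: le_trans (ltW lam1) (expanding_lift_le hF). Qed.

Definition separated_orbit x (g : R) := forall i j n,
  iter i F x = iter j F x + n%:~R \/ g <= `|iter i F x - iter j F x - n%:~R|.

Lemma iter_add p q x k : iter p F x = x + q%:~R ->
  exists n, iter p F (iter k F x) = iter k F x + n%:~R.
Proof.
by move=> h; exists (q * 2 ^+ k); rewrite -iterD addnC iterD h (iter_shift hF).
Qed.

Lemma iter_mod p q x k : (0 < p)%N -> iter p F x = x + q%:~R ->
  exists n, iter k F x = iter (k %% p)%N F x + n%:~R.
Proof.
move=> p0 h; rewrite {1}(divn_eq k p); elim: (k %/ p)%N => [|c [n IH]].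
  by exists 0; rewrite mul0n add0n addr0.
have [n' hn'] := iter_add (c * p + k %% p)%N h.
by exists (n + n'); rewrite mulSn -addnA iterD hn' IH intrD addrA.
Qed.

(** If [n = q], the points are equal by expansion.  Otherwise the translations differ by at
least 1, which the Lipschitz constant [L^p] of [iter p F] excludes for close points. *)
Lemma periodic_separated p s t n q : iter p F s = s + n%:~R ->
  iter p F t = t + q%:~R -> (0 < p)%N -> s = t \/ (L ^+ p + 1)^-1 <= `|s - t|.
Proof.
move=> hs ht p0; have /andP[h1 h2] := iter_dist lam1 hF p s t.
have L0 : 0 < L ^+ p + 1 by rewrite ltr_wpDl ?exprn_ge0//; lra_with L1.
rewrite hs ht in h1 h2.
have [nq|nq] := eqVneq n q; [left|right].
  rewrite nq in h1.
  have e : s + q%:~R - (t + q%:~R) = s - t by lra.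
  rewrite e in h1; apply/eqP; rewrite -subr_eq0 -normr_le0.
  have h3 : lam * `|s - t| <= lam ^+ p * `|s - t| by rewrite ler_wpM2r// lam_exp_ge.
  have h4 : (lam - 1) * `|s - t| <= 0 by rewrite mulrBl mul1r; lra.
  by move: h4; rewrite pmulr_rle0//; lra_with lam1.
rewrite -[leLHS]mul1r ler_pdivrMr//.
have /intr_ge1 h : (n - q != 0) by lia.
have := h R; rewrite intrB.
have -> : n%:~R - q%:~R = (s + n%:~R - (t + q%:~R)) - (s - t) by lra.
move=> h3; have h4 := ler_normB (s + n%:~R - (t + q%:~R)) (s - t).
by rewrite mulrC mulrDl mul1r; lra.
Qed.

Lemma short_orbit_separated p x q : (0 < p)%N -> iter p F x = x + q%:~R ->
  separated_orbit x (L ^+ p + 1)^-1.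
Proof.
move=> p0 h i j n.
have [n1 h1] := iter_add i h; have [n2 h2] := iter_add j h.
have h3 : iter p F (iter j F x + n%:~R) = iter j F x + n%:~R + (n2 + n * 2 ^+ p - n)%:~R.
  by rewrite (iter_shift hF) h2 intrB intrD; lra.
have [->|h4] := periodic_separated h1 h3 p0; first by left.
by right; rewrite -addrA -opprD.
Qed.

(** Shadowing is only precise away from the last [N] indices of the period; moving two
indices forward by at most [2 N] steps brings both into the good range. *)
Lemma window (N p k l : nat) : (0 < N)%N -> (4 * N <= p)%N ->
  (k < p)%N -> (l < p)%N ->
  exists T, [/\ (T <= 2 * N)%N, ((k + T) %% p < p - N)%N &
                ((l + T) %% p < p - N)%N].
Proof.
move=> N0 Np kp lp.
pose bad i T := ((p - N <= i + T) && (i + T < p))%N || (2 * p - N <= i + T)%N.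
have good i T : (i < p)%N -> (T <= 2 * N)%N -> ~~ bad i T ->
    ((i + T) %% p < p - N)%N.
  move=> ip TN nb; have [lt|le] := ltnP (i + T) p.
    by rewrite modn_small//; move: nb; rewrite /bad; lia.
  have -> : (i + T = p + (i + T - p))%N by lia.
  by rewrite modnDl modn_small; move: nb; rewrite /bad; lia.
have : exists2 T, (T <= 2 * N)%N & ~~ bad k T && ~~ bad l T.
  have [?|] := boolP (~~ bad k 0%N && ~~ bad l 0%N); first by exists 0%N.
  rewrite {1 2}/bad => g0.
  have [?|] := boolP (~~ bad k N && ~~ bad l N); first by exists N => //; lia.
  rewrite {1 2}/bad => g1.
  by rewrite /bad; exists (2 * N)%N => //; lia.
by move=> [T TN /andP[g1 g2]]; exists T; split=> //; exact: good.
Qed.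

Let kap := lam / (lam - 1).

Let kap1 : 1 < kap.
Proof. by rewrite /kap ltr_pdivlMr; lra_with lam1. Qed.

(** The closed orbit follows that of [w] within [e / 4], except in the last [N] steps,
so there it inherits half of the separation [e] of the orbit of [w].  Two points with
bad indices are iterated into the good range, which multiplies their distance by at
most [L^(2 N)]. *)
Lemma long_orbit_separated (N p : nat) x w q e : (0 < N)%N -> (4 * N <= p)%N ->
  4 * kap <= lam ^+ N -> 0 <= e <= 1 ->
  iter p F x = x + q%:~R -> `|iter p F x - iter p F w| <= e * kap ->
  (forall k l n, (k < p)%N -> (l < p)%N -> k != l ->
     e <= `|iter k F w - iter l F w - n%:~R|) ->
  separated_orbit x (e / (2 * L ^+ (2 * N))).
Proof.
move=> N0 Np lamN /andP[e0 e1] hx xw sep i j n.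
have p0 : (0 < p)%N by clear -N0 Np; lia.
have L2 : 1 <= L ^+ (2 * N) by rewrite exprn_ege1.
have shadow k : (k < p - N)%N -> `|iter k F x - iter k F w| <= e / 4.
  move=> kp; have kp' : (k <= p)%N := ltnW (leq_trans kp (leq_subr _ _)).
  have h := le_trans (iter_dist_sub lam1 hF x w kp') xw.
  have h2 : lam ^+ N <= lam ^+ (p - k).
    by rewrite ler_weXn2l//; [exact: ltW | clear -kp; lia].
  set D := `|_| in h *.
  have h3 : 4 * kap * D <= e * kap.
    apply: le_trans h; apply: ler_wpM2r; rewrite ?normr_ge0//.
    exact: le_trans lamN h2.
  rewrite mulrAC ler_pM2r in h3; last by lra_with kap1.
  lra.
have [n1 h1] := iter_mod i p0 hx; have [n2 h2] := iter_mod j p0 hx.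
rewrite h1 h2.
set k := (i %% p)%N; set l := (j %% p)%N.
have kp : (k < p)%N by rewrite ltn_mod.
have lp : (l < p)%N by rewrite ltn_mod.
have [<-|kl] := eqVneq k l.
  have [n0|n0] := eqVneq n (n1 - n2); [left|right].
    by rewrite n0 intrB; lra.
  have /intr_ge1 h : (n1 - n2 - n != 0) by clear -n0; lia.
  have := h R; rewrite !intrB.
  have -> : n1%:~R - n2%:~R - n%:~R = iter k F x + n1%:~R - (iter k F x + n2%:~R) - n%:~R by lra.
  apply: le_trans; rewrite ler_pdivrMr ?mul1r; lra.
right.
have [T [TN gk gl]] := window N0 Np kp lp.
set d := `|_|.
have [m1 e1'] := iter_mod (k + T) p0 hx; have [m2 e2'] := iter_mod (l + T) p0 hx.
set k' := ((k + T) %% p)%N in gk e1'; set l' := ((l + T) %% p)%N in gl e2'.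
have kl' : k' != l'.
  apply: contra kl => /eqP; rewrite /k' /l' => /eqP.
  by rewrite eqn_modDr !modn_small.
have s1 := shadow _ gk; have s2 := shadow _ gl.
pose Q : int := (n + n2 - n1) * 2 ^+ T + m2 - m1.
have s3 : e <= `|iter k' F w - iter l' F w - Q%:~R|.
  by apply: sep => //; [apply: leq_trans gk _ | apply: leq_trans gl _]; exact: leq_subr.
have up : `|iter k' F x - iter l' F x - Q%:~R| <= L ^+ T * d.
  have /andP[_] := iter_dist lam1 hF T (iter k F x) (iter l F x + (n + n2 - n1)%:~R).
  rewrite (iter_shift hF) -!iterD ![(T + _)%N]addnC e1' e2'.
  rewrite [in X in _ <= X -> _](_ : _ - _ =
    iter k F x + n1%:~R - (iter l F x + n2%:~R) - n%:~R); last first.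
    by rewrite intrB intrD; lra.
  rewrite -/d; congr (_ <= _); congr `|_|; rewrite /Q !(intrB, intrD); lra.
have up2 : L ^+ T * d <= L ^+ (2 * N) * d.
  by apply: ler_wpM2r; rewrite ?normr_ge0// ler_weXn2l.
have t1 : e <= `|iter k' F x - iter l' F x - Q%:~R| +
    `|iter k' F x - iter k' F w| + `|iter l' F x - iter l' F w|.
  apply: (le_trans s3).
  have -> : iter k' F w - iter l' F w - Q%:~R =
    (iter k' F x - iter l' F x - Q%:~R) - (iter k' F x - iter k' F w)
     + (iter l' F x - iter l' F w) by lra.
  apply: (le_trans (ler_normD _ _)); rewrite lerD2r; exact: ler_normB.
rewrite ler_pdivrMr; last lra.
have -> : d * (2 * L ^+ (2 * N)) = 2 * (L ^+ (2 * N) * d) by lra.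
lra.
Qed.

(** Take a closest return [e] of the orbit of [z] and close it.  For long periods the
gap is given by [long_orbit_separated], for short ones by
[short_orbit_separated]; both are at least [M c e] for the constant [c] chosen below,
so [rho = c e].  As [u] vanishes along the orbit of [z], the sum of [u] along the periodic
orbit is at most the distortion between the two orbits, of order [e^b].  If the orbit of
[z] is preperiodic, its own cycle has sum 0. *)
Lemma good_orbit z M : (forall k, u (iter k F z) = 0) -> 1 <= M ->
  exists2 K, 0 <= K & forall r0, 0 < r0 -> exists rho p q x,
    [/\ 0 < rho < r0, (0 < p)%N, iter p F x = x + q%:~R,
        separated_orbit x (M * rho) &
        - (K * rho `^ b) <= birkhoff F u p x].
Proof.
move=> hz M1.
have [N [N0 lamN]] : exists N, (0 < N)%N /\ 4 * kap <= lam ^+ N.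
  have [n hn] : exists n : nat, 4 * kap <= 1 + n%:R * (lam - 1).
    exists (Num.trunc (4 * kap / (lam - 1))).+1.
    have : 4 * kap / (lam - 1) <= (Num.trunc (4 * kap / (lam - 1))).+1%:R.
      exact/ltW/truncnS_gt.
    by rewrite ler_pdivrMr; lra_with lam1.
  exists n.+1; split=> //; apply: (le_trans hn).
  apply: (le_trans (bernoulli n (ltW lam1))); rewrite exprS ler_peMl ?exprn_ge0//; exact: ltW lam1.
(* The scale is [c] times the closest return distance, which makes the gap of
   [long_orbit_separated] equal to [M] times the scale. *)
pose L2 := L ^+ (2 * N); pose c := (2 * M * L2)^-1.
have L21 : 1 <= L2 by rewrite exprn_ege1.
have c0 : 0 < c by rewrite invr_gt0; nra.
have Mc : M * c * (2 * L2) = 1.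
  by rewrite /c; field; apply/andP; split; rewrite gt_eqF//; lra.
have Mc1 : M * c <= 1 by have : 0 <= M * c; [rewrite mulr_ge0//; lra| nra].
have [D D0 hD] : exists2 D : R, 0 <= D & forall (n : nat) s t,
    \sum_(i < n) `|u (iter i F s) - u (iter i F t)| + D * `|s - t| `^ b <=
    D * `|iter n F s - iter n F t| `^ b.
  exists (distortion lam C b); first exact: distortion_ge0.
  by move=> n s t; exact: (birkhoff_distortion lam1 hF b0 hu).
have K0 : 0 <= D * (kap / c) `^ b by rewrite mulr_ge0// powR_ge0.
exists (D * (kap / c) `^ b) => //.
move=> r0 r00.
(* The gap of an orbit of period [p], by [short_orbit_separated]. *)
pose g p := (L ^+ p + 1)^-1.
have g0 p : 0 < g p <= 1.
  have : 0 <= L ^+ p by rewrite exprn_ge0//; lra_with L1.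
  by move=> h; rewrite invr_gt0 invf_le1; lra.
(* If the orbit of [z] is eventually periodic, its cycle has sum 0. *)
have [[i [p [q [p0 hp]]]]|aper] := pselect (exists i p q, (0 < p)%N /\
    iter p F (iter i F z) = iter i F z + q%:~R).
  pose rho := Num.min (r0 / 2) (g p / M).
  have rho0 : 0 < rho by rewrite lt_min !divr_gt0//; [have /andP[]:= g0 p|lra].
  exists rho, p, q, (iter i F z); split=> //.
  - by rewrite rho0 /rho gt_min; apply/orP; left; lra.
  - move=> k l n; have [|h] := short_orbit_separated p0 hp k l n; [by left|right].
    apply: le_trans h; rewrite mulrC -ler_pdivlMr; last lra.
    by rewrite /rho ge_min lexx orbT.
  - rewrite /birkhoff big1; last by move=> k _; rewrite -iterD hz.
    by rewrite oppr_le0; exact: mulr_ge0 K0 (powR_ge0 _ _).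
pose d := Num.min 1 (Num.min (r0 / (2 * c)) (g (4 * N)%N)).
have d0 : 0 < d.
  rewrite !lt_min ltr01/= divr_gt0//; last lra.
  by have /andP[] := g0 (4 * N)%N.
have [i [p [p0 ed sep]]] := closest_return (fun k => iter k F z) d0.
set w := iter i F z in sep.
have E k : iter (i + k) F z = iter k F w by rewrite addnC iterD.
pose q := Num.floor (iter p F w - w + 2^-1).
set e := int_dist _ in ed sep.
have eE : e = `|iter p F w - w - q%:~R| by rewrite /e E.
have e0 : 0 < e.
  rewrite eE normr_gt0; apply: contra_notN aper => /eqP h.
  by exists i, p, q; split=> //; rewrite -/w; lra.
have [x [hx _ dx]] := closing lam1 hF w q p0.
rewrite -eE -/kap in dx.
have [e1 [er eg]] : e <= 1 /\ e <= r0 / (2 * c) /\ e <= g (4 * N)%N.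
  by move: ed; rewrite !le_min => /andP[-> /andP[-> ->]].
have ce0 : 0 < c * e by rewrite mulr_gt0.
exists (c * e), p, q, x; split=> //.
- rewrite ce0/=; move: er; rewrite ler_pdivlMr; last lra.
  move=> er; have : e * (2 * c) = 2 * (c * e) by lra.
  by lra.
- have [pN|pN] := leqP (4 * N) p.
    have {}sep k l n : (k < p)%N -> (l < p)%N -> k != l ->
        e <= `|iter k F w - iter l F w - n%:~R|.
      by move=> kp lp kl; rewrite -!E; exact: sep.
    have e01 : 0 <= e <= 1 by lra.
    have := long_orbit_separated N0 pN lamN e01 hx dx sep.
    have -> // : e / (2 * L ^+ (2 * N)) = M * (c * e).
    rewrite -/L2 /c; field; apply/andP; split; rewrite gt_eqF//; lra.
  move=> k l n; have [|h] := short_orbit_separated p0 hx k l n; [by left|right].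
  apply: le_trans h; rewrite mulrA.
  apply: (@le_trans _ _ e); first by rewrite ger_pMl//.
  apply: (le_trans eg); rewrite /g lef_pV2 ?posrE.
  + by rewrite lerD2r ler_weXn2l// ltnW.
  + by rewrite ltr_wpDl ?exprn_ge0//; lra_with L1.
  + by rewrite ltr_wpDl ?exprn_ge0//; lra_with L1.
- have := hD p x w.
  have h1 : D * `|iter p F x - iter p F w| `^ b <= D * (kap / c) `^ b * (c * e) `^ b.
    have kc0 : 0 <= kap / c by rewrite divr_ge0//; lra_with kap1.
    rewrite -mulrA -powRM//; last exact: ltW.
    have -> : kap / c * (c * e) = e * kap by field; rewrite gt_eqF.
    by apply: ler_wpM2l => //; apply: powR_le; rewrite ?(ltW b0).
  have h2 : 0 <= D * `|x - w| `^ b by rewrite mulr_ge0// powR_ge0.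
  have h3 : - birkhoff F u p x <= \sum_(i0 < p) `|u (iter i0 F x) - u (iter i0 F w)|.
    rewrite /birkhoff -sumrN; apply: ler_sum => k _.
    by rewrite -E hz subr0 -normrN; exact: ler_norm.
  lra.
Qed.

End good_orbits.

(** * Bumps at the points of a separated set *)

Section bump.
Context {R : realType}.
Implicit Types (s t x h : R).

(** A Taylor bound with quadratic remainder determines the derivative.  The piecewise
quadratic [bump_primitive] satisfies such a bound with no case analysis at its
corners. *)
Lemma quadratic_is_derive (f : R -> R) x (d C e : R) : 0 < e ->
  (forall h, `|h| < e -> `|f (x + h) - f x - d * h| <= C * h ^+ 2) ->
  is_derive x 1 f d.
Proof.
move=> e0 H.
have C0 : 0 <= C.
  have h0 : `|e / 2| < e by rewrite ger0_norm; lra.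
  have := le_trans (normr_ge0 _) (H _ h0).
  by rewrite pmulr_lge0// exprn_gt0//; lra.
have cv : h^-1 *: (f (h *: 1 + x) - f x) @[h --> 0^'] --> d.
  apply/cvgrPdist_le => eps eps0; near=> h.
  have h0 : h != 0 by near: h; exact: nbhs_dnbhs_neq.
  have he : `|h| < e.
    by near: h; apply: dnbhs0_lt.
  have hC : `|h| <= eps / (C + 1).
    near: h; apply: dnbhs0_le; rewrite divr_gt0//; lra.
  have -> : d - h^-1 *: (f (h *: 1 + x) - f x) = - (h^-1 * (f (x + h) - f x - d * h)).
    rewrite /GRing.scale/= mulr1 [h + x]addrC; field.
    exact: h0.
  rewrite normrN normrM normfV ler_pdivrMl ?normr_gt0//.
  apply: (le_trans (H _ he)).
  have h2 : h ^+ 2 = `|h| * `|h| by rewrite -normrM -expr2 ger0_norm ?sqr_ge0.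
  rewrite h2; rewrite ler_pdivlMr in hC; last lra.
  have := normr_ge0 h; move: (`|h|) hC => y hC y0; nra.
apply: DeriveDef; first by apply/cvg_ex; exists d.
exact/cvg_lim.
Unshelve. all: by end_near.
Qed.

Definition pospart x : R := Num.max 0 x.
Definition possq x : R := pospart x ^+ 2.

Definition bump_primitive s : R := s
  - 1/2 * (possq (s - 1) - possq (- s - 1))
  + 3/4 * (possq (s - 3) - possq (- s - 3))
  - 1/4 * (possq (s - 5) - possq (- s - 5)).

(** The even piecewise affine function equal to 1 on [0, 1], of slope [- 1] on [1, 3]
and of slope [1 / 2] on [3, 5], where it comes back to 0.  It vanishes at 2 and has
integral 0, so that its odd primitive vanishes beyond 5. *)
Definition bump_profile s : R :=
  1 - (pospart (s - 1) + pospart (- s - 1))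
  + 3/2 * (pospart (s - 3) + pospart (- s - 3))
  - 1/2 * (pospart (s - 5) + pospart (- s - 5)).

Lemma pospart_ge x : 0 <= x -> pospart x = x.
Proof. by move=> ?; rewrite /pospart max_r. Qed.

Lemma pospart_le x : x <= 0 -> pospart x = 0.
Proof. by move=> ?; rewrite /pospart max_l. Qed.

Lemma possq_quadratic x h : `|possq (x + h) - possq x - 2 * pospart x * h| <= h ^+ 2.
Proof.
rewrite /possq !expr2 ler_norml.
have [x0|/ltW x0] := leP 0 x; have [y0|/ltW y0] := leP 0 (x + h);
rewrite ?(pospart_ge x0) ?(pospart_le x0) ?(pospart_ge y0) ?(pospart_le y0);
apply/andP; split; nra.
Qed.

Lemma bump_quadratic s h :
  `|bump_primitive (s + h) - bump_primitive s - bump_profile s * h| <= 4 * h ^+ 2.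
Proof.
rewrite /bump_primitive /bump_profile.
have := possq_quadratic (s - 1) h; have := possq_quadratic (- s - 1) (- h).
have := possq_quadratic (s - 3) h; have := possq_quadratic (- s - 3) (- h).
have := possq_quadratic (s - 5) h; have := possq_quadratic (- s - 5) (- h).
have e1 (c : R) : - s - c + - h = - (s + h) - c by lra.
have e2 (c : R) : s - c + h = s + h - c by lra.
rewrite !e1 !e2 sqrrN !ler_norml.
move: (possq _) (possq _) (possq _) (possq _) (possq _) (possq _)
 (possq _) (possq _) (possq _) (possq _) (possq _) (possq _).
move=> *; nra.
Qed.

Lemma bump_profileN s : bump_profile (- s) = bump_profile s.
Proof. by rewrite /bump_profile opprK; lra. Qed.

Lemma bump_primitiveN s : bump_primitive (- s) = - bump_primitive s.
Proof. by rewrite /bump_primitive opprK; lra. Qed.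

Lemma bump_profileE s : 0 <= s -> bump_profile s =
  1 - pospart (s - 1) + 3/2 * pospart (s - 3) - 1/2 * pospart (s - 5).
Proof.
move=> s0; rewrite /bump_profile.
rewrite (@pospart_le (- s - 1)) ?(@pospart_le (- s - 3)) ?(@pospart_le (- s - 5)); lra.
Qed.

Lemma bump_primitiveE s : 0 <= s -> bump_primitive s =
  s - 1/2 * possq (s - 1) + 3/4 * possq (s - 3) - 1/4 * possq (s - 5).
Proof.
move=> s0; rewrite /bump_primitive {2 4 6}/possq.
rewrite (@pospart_le (- s - 1)) ?(@pospart_le (- s - 3)) ?(@pospart_le (- s - 5)); lra.
Qed.

Lemma bump_primitive_bounds s : `|bump_primitive s| <= 2.
Proof.
wlog s0 : s / 0 <= s.
  move=> w; have [/w//|s0] := leP 0 s.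
  by rewrite -normrN -bump_primitiveN; apply: w; lra.
rewrite bump_primitiveE// ler_norml /possq !expr2.
have [x1|x1] := leP 0 (s - 1); have [x3|x3] := leP 0 (s - 3);
have [x5|x5] := leP 0 (s - 5); try lra;
rewrite ?(pospart_ge x1) ?(pospart_le (ltW x1)) ?(pospart_ge x3) ?(pospart_le (ltW x3))
   ?(pospart_ge x5) ?(pospart_le (ltW x5)); apply/andP; split; nra.
Qed.

Lemma bump_primitive0 : bump_primitive 0 = 0.
Proof.
rewrite bump_primitiveE// /possq !pospart_le ?expr2; lra.
Qed.

Lemma bump_primitive_out s : 5 <= `|s| -> bump_primitive s = 0.
Proof.
wlog s0 : s / 0 <= s.
  move=> w; have [/w//|s0] := leP 0 s; rewrite -normrN => h.
  by apply: oppr_inj; rewrite -bump_primitiveN oppr0; apply: w => //; lra.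
rewrite ger0_norm// => s5.
by rewrite bump_primitiveE// /possq !pospart_ge ?expr2; lra.
Qed.

Lemma bump_profile_bounds s : `|bump_profile s| <= 1.
Proof.
wlog s0 : s / 0 <= s.
  move=> w; have [/w//|s0] := leP 0 s.
  by rewrite -bump_profileN; apply: w; lra.
rewrite bump_profileE// ler_norml.
have [x1|x1] := leP 0 (s - 1); have [x3|x3] := leP 0 (s - 3);
have [x5|x5] := leP 0 (s - 5); try lra;
rewrite ?(pospart_ge x1) ?(pospart_le (ltW x1)) ?(pospart_ge x3) ?(pospart_le (ltW x3))
   ?(pospart_ge x5) ?(pospart_le (ltW x5)); apply/andP; split; lra.
Qed.

Lemma bump_profile_in s : `|s| <= 1 -> bump_profile s = 1.
Proof.
rewrite ler_norml => h.
rewrite /bump_profile !pospart_le; lra.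
Qed.

Lemma bump_profile_le0 s : 2 <= `|s| -> bump_profile s <= 0.
Proof.
wlog s0 : s / 0 <= s.
  move=> w; have [/w//|s0] := leP 0 s; rewrite -normrN => h.
  by rewrite -bump_profileN; apply: w => //; lra.
rewrite ger0_norm// => s2; rewrite bump_profileE//.
have [x1|x1] := leP 0 (s - 1); have [x3|x3] := leP 0 (s - 3);
have [x5|x5] := leP 0 (s - 5); try lra;
rewrite ?(pospart_ge x1) ?(pospart_le (ltW x1)) ?(pospart_ge x3) ?(pospart_le (ltW x3))
   ?(pospart_ge x5) ?(pospart_le (ltW x5)); lra.
Qed.

Lemma bump_profile_out s : 5 <= `|s| -> bump_profile s = 0.
Proof.
wlog s0 : s / 0 <= s.
  move=> w; have [/w//|s0] := leP 0 s; rewrite -normrN => h.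
  by rewrite -bump_profileN; apply: w => //; lra.
rewrite ger0_norm// => s5.
by rewrite bump_profileE// !pospart_ge; lra.
Qed.

Lemma pospart_convex (x y : R) h : 0 <= h -> x <= y ->
  pospart (x + h) - pospart x <= pospart (y + h) - pospart y.
Proof.
move=> h0 xy.
have [x1|x1] := leP 0 x; have [x2|x2] := leP 0 (x + h); have [x3|x3] := leP 0 y;
have [x4|x4] := leP 0 (y + h); try lra;
rewrite ?(pospart_ge x1) ?(pospart_le (ltW x1)) ?(pospart_ge x2) ?(pospart_le (ltW x2))
   ?(pospart_ge x3) ?(pospart_le (ltW x3)) ?(pospart_ge x4) ?(pospart_le (ltW x4)); lra.
Qed.

Lemma pospart_mono (x : R) h : 0 <= h -> 0 <= pospart (x + h) - pospart x.
Proof.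
move=> h0.
have [x1|x1] := leP 0 x; have [x2|x2] := leP 0 (x + h); try lra;
rewrite ?(pospart_ge x1) ?(pospart_le (ltW x1)) ?(pospart_ge x2) ?(pospart_le (ltW x2)); lra.
Qed.

(** For [h > 0] the increments [pospart (s + h) - pospart s] increase with [s], and
those at the two outermost corners add up to at most [h]; hence the alternating coefficients
[- 1, 3/2, - 1/2] keep the increments of the profile between [- h] and [h]. *)
Lemma bump_profile_lip s t : `|bump_profile s - bump_profile t| <= `|s - t|.
Proof.
wlog st : s t / s <= t.
  move=> w; have [/w//|/ltW/w] := leP s t.
  by rewrite distrC (distrC t).
pose h := t - s; have h0 : 0 <= h by rewrite /h; lra.
have e1 (c : R) : t - c = s - c + h by rewrite /h; lra.
have e2 (c : R) : - s - c = - t - c + h by rewrite /h; lra.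
rewrite (distrC s) (ger0_norm (_ : 0 <= t - s))// -/h.
rewrite /bump_profile !e1 !e2.
have a13 : pospart (s - 3 + h) - pospart (s - 3) <= pospart (s - 1 + h) - pospart (s - 1).
  by apply: pospart_convex => //; lra.
have a35 : pospart (s - 5 + h) - pospart (s - 5) <= pospart (s - 3 + h) - pospart (s - 3).
  by apply: pospart_convex => //; lra.
have a5 := pospart_mono (s - 5) h0.
have b13 : pospart (- t - 3 + h) - pospart (- t - 3) <= pospart (- t - 1 + h) - pospart (- t - 1).
  by apply: pospart_convex => //; lra.
have b35 : pospart (- t - 5 + h) - pospart (- t - 5) <= pospart (- t - 3 + h) - pospart (- t - 3).
  by apply: pospart_convex => //; lra.
have b5 := pospart_mono (- t - 5) h0.
have ab : pospart (s - 1 + h) - pospart (s - 1) + (pospart (- t - 1 + h) - pospart (- t - 1)) <= h.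
  rewrite -e1 -e2.
  have [x1|x1] := leP 0 (t - 1); have [x2|x2] := leP 0 (s - 1);
  have [x3|x3] := leP 0 (- s - 1); have [x4|x4] := leP 0 (- t - 1); try lra;
  rewrite ?(pospart_ge x1) ?(pospart_le (ltW x1)) ?(pospart_ge x2) ?(pospart_le (ltW x2))
   ?(pospart_ge x3) ?(pospart_le (ltW x3)) ?(pospart_ge x4) ?(pospart_le (ltW x4)) /h; lra.
rewrite ler_norml; lra.
Qed.

End bump.

Section periodic_bump.
Context {R : realType} (P : set R) (rho k0 : R).
Hypotheses (rho0 : 0 < rho) (k00 : 0 <= k0).
Hypothesis P_sep : forall v w, P v -> P w -> v = w \/ 25 * rho <= `|v - w|.
Hypothesis P1 : forall v, P (v + 1) <-> P v.
Implicit Types (s t v w : R).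

(* The default value makes the bump vanish away from [P]. *)
Definition near_center s : R := xget (s + 10 * rho) [set v | P v /\ `|s - v| < 10 * rho].

(** The points of [P] are 25 rho apart while each bump has radius 5 rho, so at most one
of them is active at [s] and the sum of the bumps is the bump at the near center. *)
Definition bump s : R := k0 * rho * bump_primitive ((s - near_center s) / rho).
Definition dbump s : R := k0 * bump_profile ((s - near_center s) / rho).

Let scale s : 0 <= s -> `|s / rho| = `|s| / rho.
Proof. by move=> _; rewrite normrM normfV (gtr0_norm rho0). Qed.

Let big_scale (c : R) s : c * rho <= `|s| -> c <= `|s / rho|.
Proof. by move=> h; rewrite normrM normfV (gtr0_norm rho0) ler_pdivlMr. Qed.

(** The bump at [v] may be evaluated at all distances up to 12 rho: beyond
10 rho, where [near_center] forgets [v], both sides vanish.  The margin leaves room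
for increments in the differential and Lipschitz estimates. *)
Lemma bump_near s v : P v -> `|s - v| < 12 * rho ->
  bump s = k0 * rho * bump_primitive ((s - v) / rho) /\
  dbump s = k0 * bump_profile ((s - v) / rho).
Proof.
move=> Pv sv; have r0 := rho0; rewrite /bump /dbump /near_center.
case: xgetP => [w _ [Pw sw]|none].
  have [->//|h] := P_sep Pv Pw.
  have := ler_distD s v w; rewrite (distrC v s); lra.
have h10 : 10 * rho <= `|s - v| by rewrite leNgt; apply/negP => h; exact: (none v).
have far : 5 <= `|(s - v) / rho| by apply: big_scale; lra.
have far' : 5 <= `|(s - (s + 10 * rho)) / rho|.
  by apply: big_scale; rewrite opprD addNKr normrN gtr0_norm; lra.
by rewrite !bump_primitive_out// !bump_profile_out.
Qed.

Lemma bump_far s : (forall v, P v -> 5 * rho <= `|s - v|) ->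
  bump s = 0 /\ dbump s = 0.
Proof.
move=> h; have r0 := rho0; rewrite /bump /dbump /near_center.
suff far : 5 <= `|(s - xget (s + 10 * rho) [set v | P v /\ `|s - v| < 10 * rho]) / rho|.
  by rewrite bump_primitive_out// bump_profile_out// !mulr0.
apply: big_scale; case: xgetP => [w _ [Pw _]|_]; first exact: h.
rewrite opprD addNKr normrN gtr0_norm; lra.
Qed.

Lemma near_dec s (c : R) :
  (exists2 v, P v & `|s - v| < c) \/ (forall v, P v -> c <= `|s - v|).
Proof.
have [h|h] := pselect (exists2 v, P v & `|s - v| < c); [by left|right].
by move=> v Pv; rewrite leNgt; apply/negP => hv; apply: h; exists v.
Qed.

Lemma bump_is_derive s : is_derive s 1 bump (dbump s).
Proof.
have r0 := rho0.
apply: (@quadratic_is_derive _ _ _ _ (4 * k0 / rho) rho) => // h hr.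
have [[v Pv sv]|far] := near_dec s (11 * rho).
  have hv : `|s + h - v| < 12 * rho.
    by rewrite addrAC; have := ler_normD (s - v) h; lra.
  have sv' : `|s - v| < 12 * rho by lra.
  have [-> _] := bump_near Pv hv; have [-> ->] := bump_near Pv sv'.
  have := bump_quadratic ((s - v) / rho) (h / rho).
  have -> : (s - v) / rho + h / rho = (s + h - v) / rho by rewrite -mulrDl addrAC.
  set a1 := bump_primitive ((s + h - v) / rho); set a2 := bump_primitive _.
  set a3 := bump_profile _ => H.
  have -> : k0 * rho * a1 - k0 * rho * a2 - k0 * a3 * h =
     (k0 * rho) * (a1 - a2 - a3 * (h / rho)) by field; rewrite gt_eqF.
  rewrite normrM ger0_norm; last by rewrite mulr_ge0// ltW.
  have -> : 4 * k0 / rho * h ^+ 2 = k0 * rho * (4 * (h / rho) ^+ 2).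
    by field; rewrite gt_eqF.
  by rewrite ler_wpM2l// mulr_ge0// ltW.
have [-> ->] : bump s = 0 /\ dbump s = 0.
  by apply: bump_far => v /far; lra.
have [-> _] : bump (s + h) = 0 /\ dbump (s + h) = 0.
  apply: bump_far => v /far sv.
  have -> : s + h - v = s - v + h by lra.
  have := lerB_normD (s - v) h; lra.
rewrite mul0r !subr0 normr0 mulr_ge0 ?sqr_ge0// divr_ge0//.
  by rewrite mulr_ge0.
exact: ltW.
Qed.

Lemma bump_shift_near s v : P v -> `|s - v| < 10 * rho ->
  bump (s + 1) = bump s /\ dbump (s + 1) = dbump s.
Proof.
move=> Pv sv; have r0 := rho0.
have sv1 : `|s + 1 - (v + 1)| < 12 * rho.
  have -> : s + 1 - (v + 1) = s - v by lra.
  lra.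
have sv2 : `|s - v| < 12 * rho by lra.
have Pv1 : P (v + 1) by apply/P1.
have [-> ->] := bump_near Pv1 sv1; have [-> ->] := bump_near Pv sv2.
by have -> : s + 1 - (v + 1) = s - v by lra.
Qed.

Lemma bump_shift s : bump (s + 1) = bump s /\ dbump (s + 1) = dbump s.
Proof.
have r0 := rho0.
have [[v Pv sv]|far] := near_dec s (10 * rho); first exact: bump_shift_near sv.
have [-> ->] : bump s = 0 /\ dbump s = 0 by apply: bump_far => v /far; lra.
apply: bump_far => v Pv.
have Pv' : P (v - 1) by apply/P1; rewrite subrK.
have := far _ Pv'; have -> : s - (v - 1) = s + 1 - v by lra.
lra.
Qed.

Lemma bump_center v : P v -> bump v = 0.
Proof.
move=> Pv; have r0 := rho0.
have h : `|v - v| < 12 * rho by rewrite subrr normr0; lra.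
by have [-> _] := bump_near Pv h; rewrite subrr mul0r bump_primitive0 mulr0.
Qed.

Lemma bump_bounds s : `|bump s| <= 2 * k0 * rho.
Proof.
rewrite /bump normrM ger0_norm; last by rewrite mulr_ge0// ltW.
rewrite mulrC -mulrA ler_wpM2r//; first by rewrite mulr_ge0// ltW.
exact: bump_primitive_bounds.
Qed.

Lemma dbump_bounds s : `|dbump s| <= k0.
Proof.
by rewrite /dbump normrM ger0_norm// ler_piMr//; exact: bump_profile_bounds.
Qed.

Lemma dbump_center s v : P v -> `|s - v| <= rho -> dbump s = k0.
Proof.
move=> Pv sv; have r0 := rho0.
have h : `|s - v| < 12 * rho by lra.
have [_ ->] := bump_near Pv h; rewrite bump_profile_in ?mulr1//.
by rewrite normrM normfV (gtr0_norm r0) ler_pdivrMr// mul1r.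
Qed.

Lemma dbump_le0 s : (forall v, P v -> 2 * rho <= `|s - v|) -> dbump s <= 0.
Proof.
move=> far; rewrite /dbump -oppr_ge0 -mulrN mulr_ge0// oppr_ge0.
apply: bump_profile_le0; apply: big_scale; rewrite /near_center; have r0 := rho0.
case: xgetP => [w _ [Pw _]|_]; first exact: far.
rewrite opprD addNKr normrN gtr0_norm; lra.
Qed.

Lemma dbump_lip s t : `|dbump s - dbump t| <= k0 / rho * `|s - t|.
Proof.
have r0 := rho0; have kr : 0 <= k0 / rho by rewrite divr_ge0// ltW.
have main v s' t' : P v -> `|s' - v| < 12 * rho -> `|t' - v| < 12 * rho ->
    `|dbump s' - dbump t'| <= k0 / rho * `|s' - t'|.
  move=> Pv h1 h2; have [_ ->] := bump_near Pv h1; have [_ ->] := bump_near Pv h2.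
  rewrite -mulrBr normrM (ger0_norm k00) -mulrA ler_wpM2l//.
  apply: (le_trans (bump_profile_lip _ _)).
  rewrite -mulrBl normrM normfV (gtr0_norm r0) mulrC.
  by have -> : s' - v - (t' - v) = s' - t' by lra.
(* With only [s'] near a center, either [t'] is near the same center or the two
   points are at least 2 rho apart and the bound of [dbump] suffices. *)
have half s' t' v : P v -> `|s' - v| < 5 * rho ->
    `|dbump s' - dbump t'| <= k0 / rho * `|s' - t'|.
  move=> Pv h1.
  have [h2|h2] := ltP `|t' - v| (12 * rho).
    by apply: (main v) => //; lra.
  have h3 : 2 * rho <= `|s' - t'|.
    have := ler_distD s' t' v; rewrite (distrC t' s'); lra.
  apply: (@le_trans _ _ (2 * k0)).
    by apply: (le_trans (ler_normB _ _)); have := dbump_bounds s'; have := dbump_bounds t'; lra.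
  apply: (@le_trans _ _ (k0 / rho * (2 * rho))); last by rewrite ler_wpM2l.
  by have -> : k0 / rho * (2 * rho) = 2 * k0 by field; rewrite gt_eqF.
have [[v Pv sv]|fs] := near_dec s (5 * rho); first exact: half sv.
have [[v Pv tv]|ft] := near_dec t (5 * rho).
  by rewrite distrC (distrC s); exact: half tv.
have [_ ->] := bump_far fs; have [_ ->] := bump_far ft.
by rewrite subrr normr0 mulr_ge0.
Qed.

(** Interpolation between the Lipschitz constant [k0 / rho] and the bound [k0].  With
[k0] of order [rho^a] the Hölder constant is independent of [rho]. *)
Lemma dbump_holder a : 0 <= a <= 1 -> holder (2 * k0 / rho `^ a) a dbump.
Proof.
move=> /andP[a0 a1] s t; have r0 := rho0.
have -> : 2 * k0 / rho `^ a * `|s - t| `^ a = 2 * k0 * (`|s - t| / rho) `^ a.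
  have ra0 : 0 < rho `^ a by exact: powR_gt0.
  have e : (`|s - t| / rho) `^ a * rho `^ a = `|s - t| `^ a.
    rewrite -powRM; [|by rewrite divr_ge0// ltW|exact: ltW].
    by rewrite divfK// gt_eqF.
  by rewrite -e; field; rewrite gt_eqF.
set y := `|s - t| / rho; have y0 : 0 <= y by rewrite divr_ge0// ltW.
have [y1|y1] := leP y 1.
  have h1 : k0 / rho * `|s - t| = k0 * y by rewrite /y; lra.
  apply: (le_trans (dbump_lip s t)); rewrite h1.
  have : y <= y `^ a.
    move: y0; rewrite le_eqVlt => /orP[/eqP<-|y0]; first exact: powR_ge0.
    by apply: ger1_powR; rewrite ?y0.
  move=> h2; have h3 : k0 * y <= k0 * y `^ a by rewrite ler_wpM2l.
  have : 0 <= k0 * y `^ a by rewrite mulr_ge0// powR_ge0.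
  lra.
apply: (@le_trans _ _ (2 * k0)).
  by apply: (le_trans (ler_normB _ _)); have := dbump_bounds s; have := dbump_bounds t; lra.
rewrite ler_peMr//; first by rewrite mulr_ge0.
rewrite -[leLHS](_ : 1 `^ a = 1); last by rewrite powR1.
by apply: powR_le => //; exact: ltW.
Qed.

End periodic_bump.

(** * The locking estimate for a perturbed lift *)

Lemma ln_lip {R : realType} (s t : R) : 1 <= s -> 1 <= t -> `|ln s - ln t| <= `|s - t|.
Proof.
wlog st : s t / t <= s.
  move=> w; have [/w//|/ltW/w] := leP t s => h s1 t1.
  by rewrite distrC (distrC s); exact: h.
move=> s1 t1.
have h : ln t <= ln s by rewrite ler_ln ?posrE; lra.
rewrite !ger0_norm ?subr_ge0// -ln_div ?posrE; [|lra|lra].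
have -> : s / t = 1 + (s / t - 1) by lra.
have st' : s / t - 1 = (s - t) / t by field; rewrite gt_eqF//; lra.
apply: (le_trans (le_ln1Dx _)).
  by rewrite st' ltr_pdivlMr; lra.
rewrite st' ler_pdivrMr; [nra | lra].
Qed.

(** The closed [r]-neighbourhood of the set of all lifts of the circle orbit of [y]. *)
Definition near_lift {R : realType} (G : R -> R) (y r t : R) : Prop :=
  exists (j : nat) (n : int), `|t - iter j G y - n%:~R| <= r.

Section locking.
Context {R : realType} (lam L : R) (F dF : R -> R).
Hypotheses (lam1 : 1 < lam) (hF : expanding_lift lam L F).
Context (a b CF CV m : R) (V : R -> R).
Hypotheses (a0 : 0 < a) (ab : a < b).
Hypotheses (dF_ge1 : forall t, 1 <= dF t) (dF_holder : holder CF b dF).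
Hypotheses (V1 : forall t, V (t + 1) = V t) (V_holder : holder CV b V).
Let red t := ln (dF t) - m + V t - V (F t).
Hypothesis red_le0 : forall t, red t <= 0.

Context (p : nat) (q : int) (x rho delta k0 : R) (k dk : R -> R).
Hypotheses (p0 : (0 < p)%N) (hx : iter p F x = x + q%:~R).
Hypotheses (rho0 : 0 < rho) (k00 : 0 < k0) (k01 : k0 <= 1 / 8).
(** The set of all lifts of the circle orbit of [x]. *)
Definition orbit_lift : set R := [set v | exists j n, v = iter j F x + n%:~R].
Local Notation P := orbit_lift.
(* A step sends points 4 rho apart to points at most 4 L rho apart; the constant 30
   leaves room for the radii of the neighbourhoods and for the distance of [G] to [F]. *)
Hypothesis P_sep : forall v w, P v -> P w -> v = w \/ (4 * L + 30) * rho <= `|v - w|.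
Hypothesis hdelta : - delta <= birkhoff F red p x.
Hypotheses (k_center : forall v, P v -> k v = 0)
  (k_bounds : forall s, `|k s| <= 2 * k0 * rho)
  (dk_bounds : forall s, `|dk s| <= k0)
  (dk_center : forall s v, P v -> `|s - v| <= rho -> dk s = k0)
  (dk_le0 : forall s, (forall v, P v -> 2 * rho <= `|s - v|) -> dk s <= 0).

Let dF1 t := dF t * (1 + dk (F t)).
Hypothesis dF1_ge1 : forall t, 1 <= dF1 t.

Context (eta : R) (L' : R) (G dG : R -> R).
Hypotheses (hG : expanding_lift lam L' G) (dG_ge1 : forall t, 1 <= dG t)
  (dG1 : forall t, dG (t + 1) = dG t).
Hypotheses (eta0 : 0 <= eta) (G_near : forall t, `|G t - (F t + k (F t))| <= eta)
  (dG_near : forall t, `|dG t - dF1 t| <= eta)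
  (dG_holder : holder eta a (fun t => dG t - dF1 t)).

Let gam := ln (1 + k0).
Let eta' := eta / (lam - 1).
Let xi := eta + (CF + 2 * CV) * eta' `^ b.
Let kap := (2 * CF * (3 * rho) `^ (b - a) + eta) / (lam `^ a - 1).
Hypotheses (small_eta : eta + (L + 1) * eta' <= rho / 4).
Hypotheses (small_V : CV * (3 * rho) `^ b + eta <= gam / 32).
Hypotheses (small_delta : delta <= gam / 64).
Hypotheses (small_xi : p%:R * xi <= gam / 64).
Hypotheses (small_kap : kap * (3 * rho) `^ a <= gam / 32).
Implicit Types (s t u v w : R) (n : int).

Let b0 : 0 < b. Proof. exact: lt_trans a0 ab. Qed.
Let lam0 : 0 <= lam. Proof. exact: le_trans (ltW lam1). Qed.
Let L1 : 1 <= L. Proof. exact: le_trans (ltW lam1) (expanding_lift_le hF). Qed.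
Let CF0 : 0 <= CF. Proof. exact: holder_ge0 dF_holder. Qed.
Let CV0 : 0 <= CV. Proof. exact: holder_ge0 V_holder. Qed.
Let eta'0 : 0 <= eta'.
Proof. by rewrite /eta' divr_ge0//; lra_with lam1. Qed.
Let lama : 1 < lam `^ a. Proof. exact: powR_gt1. Qed.
Let xi0 : 0 <= xi.
Proof.
by rewrite /xi addr_ge0// mulr_ge0 ?powR_ge0// addr_ge0// mulr_ge0.
Qed.
Let kap0 : 0 <= kap.
Proof.
rewrite /kap divr_ge0//; last by lra_with lama.
by rewrite addr_ge0// mulr_ge0 ?powR_ge0// mulr_ge0.
Qed.
Let gam0 : 0 < gam.
Proof. by rewrite /gam ln_gt0//; lra_with k00. Qed.
Let p0' : 0 < p%:R :> R. Proof. by rewrite ltr0n. Qed.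
Let p1' : 1 <= p%:R :> R. Proof. by rewrite ler1n. Qed.

Lemma orbit_lift_step v : P v -> P (F v).
Proof.
move=> [j [n ->]]; exists j.+1, (2 * n).
by rewrite (shiftz hF.2) (intrM _ 2).
Qed.

(** The closing lemma for [G] gives the periodic point; a distance above [eta']
between the two orbits would grow by the factor [lam] at each step, which is
impossible over one period. *)
Lemma exists_shadow : exists y, iter p G y = y + q%:~R /\
  forall j, `|iter j G y - iter j F x| <= eta'.
Proof.
have [y [hy _ _]] := closing lam1 hG x q p0; exists y; split=> // j.
pose e i := `|iter i G y - iter i F x|.
have step i : lam * (e i - eta') <= e i.+1 - eta'.
  have /andP[h1 _] := bilip_abs lam0 hG.1 (iter i G y) (iter i F x).
  have := G_near (iter i F x).
  rewrite k_center ?addr0; last by exists i.+1, 0; rewrite addr0.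
  have -> : G (iter i F x) - F (iter i F x) =
    (iter i.+1 G y - iter i.+1 F x) - (G (iter i G y) - G (iter i F x)) by rewrite /=; lra.
  rewrite distrC => h2.
  have := lerB_dist (G (iter i G y) - G (iter i F x)) (iter i.+1 G y - iter i.+1 F x).
  have : lam * eta' - eta' = eta.
    by rewrite /eta' -[X in _ - X]mul1r -mulrBl mulrC divfK// subr_eq0 gt_eqF.
  by rewrite /e; lra.
have steps i : lam ^+ i * (e j - eta') <= e (i + j)%N - eta'.
  elim: i => [|i IH]; first by rewrite mul1r.
  rewrite exprS -mulrA addSn; apply: le_trans (step _).
  by rewrite ler_wpM2l.
have := steps p; rewrite {2}/e addnC !iterD hy hx !(iter_shift hG, iter_shift hF).
have -> : forall c, iter j G y + c - (iter j F x + c) = iter j G y - iter j F x :> R.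
  by move=> c; lra.
rewrite -/(e j) => h.
have lp := lam_exp_ge lam1 p0.
rewrite leNgt; apply/negP; rewrite -subr_gt0 => h1.
have h2 : lam * (e j - eta') <= lam ^+ p * (e j - eta') by rewrite ler_wpM2r// ltW.
have h3 : 0 < (lam - 1) * (e j - eta') by rewrite mulr_gt0//; lra_with lam1.
by have := le_trans h2 h; rewrite mulrBl mul1r in h3; lra.
Qed.

Lemma ln_dF1 t : ln (dF1 t) = ln (dF t) + ln (1 + dk (F t)).
Proof.
have := dk_bounds (F t); rewrite ler_norml => h.
rewrite /dF1 lnM ?posrE//.
  by have := dF_ge1 t; lra.
by lra_with k01.
Qed.

Lemma ln_dk_le t : ln (1 + dk t) <= gam.
Proof.
have := dk_bounds t; rewrite ler_norml => h.
by rewrite /gam ler_ln ?posrE; lra_with k01.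
Qed.

Lemma ln_dk_le0 t : dk t <= 0 -> ln (1 + dk t) <= 0.
Proof.
move=> h0; have := dk_bounds t; rewrite ler_norml => h.
by rewrite ln_le0//; lra.
Qed.

Lemma G_near_F t : `|G t - F t| + eta' <= rho.
Proof.
have h1 := G_near t; have h2 := k_bounds (F t).
have -> : G t - F t = (G t - (F t + k (F t))) + k (F t) by lra.
have h3 := ler_normD (G t - (F t + k (F t))) (k (F t)).
have h4 := small_eta.
have h5 : 0 <= L * eta' by rewrite mulr_ge0//; lra_with L1.
have h6 : k0 * rho <= 1 / 8 * rho by rewrite ler_wpM2r// ltW.
have r0 := rho0.
rewrite mulrDl mul1r in h4; rewrite -mulrA in h2; lra.
Qed.

(** Up to a coboundary only the factor [1 + k'] can push [ln G'] above [m], because the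
reduced function of [F] is nonpositive. *)
Lemma theta_upper t : ln (dG t) + V t - V (G t) <= m + ln (1 + dk (F t)) + gam / 32.
Proof.
have h1 := ln_lip (dG_ge1 t) (dF1_ge1 t); have h2 := dG_near t.
have h3 := V_holder (F t) (G t).
have h4 : CV * `|F t - G t| `^ b <= CV * (3 * rho) `^ b.
  apply: ler_wpM2l => //; apply: powR_le; rewrite ?(ltW b0)// distrC.
  have := G_near_F t; have e0 := eta'0; have r0 := rho0; lra.
have h5 := small_V; have h6 := red_le0 t; rewrite /red in h6.
rewrite ln_dF1 in h1.
move: h1 h3; rewrite !ler_norml; lra.
Qed.

Section shadow.
Context (y : R) (hy : iter p G y = y + q%:~R)
  (yx : forall j, `|iter j G y - iter j F x| <= eta').

Let c := birkhoff G (fun t => ln (dG t)) p y / p%:R.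
Let theta t := ln (dG t) - c + V t - V (G t).

(** On the shadowing orbit the perturbed derivative is multiplied by exactly [1 + k0],
because the bump has a flat top; the remaining errors are Hölder in the shadowing
distance. *)
Lemma theta_shadow j : `|theta (iter j G y) - (m - c + gam + red (iter j F x))| <= xi.
Proof.
set s := iter j G y; set t := iter j F x.
have st : `|s - t| <= eta' := yx j.
have st1 : `|G s - F t| <= eta' := yx j.+1.
have Ps : P (F t) by exists j.+1, 0; rewrite addr0.
have dks : dk (F s) = k0.
  apply: dk_center Ps _.
  have /andP[_ h] := bilip_abs lam0 hF.1 s t; apply: (le_trans h).
  have h1 : L * `|s - t| <= L * eta' by rewrite ler_wpM2l//; lra_with L1.
  have h2 := small_eta; rewrite mulrDl mul1r in h2.
  have e0 := eta0; have e1 := eta'0; have r0 := rho0; lra.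
have h1 := ln_lip (dG_ge1 s) (dF1_ge1 s); have h2 := dG_near s.
rewrite ln_dF1 dks -/gam in h1.
have h3 := ln_lip (dF_ge1 s) (dF_ge1 t).
have h4 := dF_holder s t; have h5 := V_holder s t; have h6 := V_holder (G s) (F t).
have h7 : `|s - t| `^ b <= eta' `^ b by apply: powR_le; rewrite ?(ltW b0).
have h8 : `|G s - F t| `^ b <= eta' `^ b by apply: powR_le; rewrite ?(ltW b0).
have h9 : CF * `|s - t| `^ b <= CF * eta' `^ b by rewrite ler_wpM2l.
have h10 : CV * `|s - t| `^ b <= CV * eta' `^ b by rewrite ler_wpM2l.
have h11 : CV * `|G s - F t| `^ b <= CV * eta' `^ b by rewrite ler_wpM2l.
have h12 := le_trans h1 h2; have h13 := le_trans (le_trans h3 h4) h9.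
have h14 := le_trans h5 h10; have h15 := le_trans h6 h11.
rewrite /theta /red /xi mulrDl -mulrA.
move: h12 h13 h14 h15; rewrite !ler_norml; lra.
Qed.

Lemma theta_periodic t : theta (t + 1) = theta t.
Proof.
by rewrite /theta dG1 V1 hG.2 -[2]/(2%:~R) (shiftz0 V1).
Qed.

(** The mean growth per step of [theta] along the shadowing orbit, up to the reduced
function of [F]; it is close to 0 because [theta] sums to 0 over a period. *)
Let drift := m - c + gam.
Let w j := birkhoff G theta j y.

Lemma w_period : w p = 0.
Proof.
rewrite /w /theta birkhoff_coboundary hy (shiftz0 V1) addrK -mulr_natr /c.
by rewrite divfK ?subrr// gt_eqF.
Qed.

Lemma w_approx j : `|w j - (drift * j%:R + birkhoff F red j x)| <= xi * j%:R.
Proof.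
elim: j => [|j IH]; first by rewrite /w /birkhoff !big_ord0 !mulr0 addr0 subr0 normr0.
have := theta_shadow j; rewrite -/drift => h.
rewrite /w !birkhoffSr -/(w j) -natr1 !mulrDr !mulr1.
move: IH h; rewrite !ler_norml; lra.
Qed.

Lemma birkhoff_red_le0 (n : nat) t : birkhoff F red n t <= 0.
Proof. by apply: sumr_le0. Qed.

(** Over a period [theta] sums to 0; up to an error [p * xi] this sum is [drift * p] plus the
sum of the reduced function along the orbit of [x], which lies between [- delta] and 0. *)
Lemma drift_bounds : - (gam / 64) <= drift * p%:R <= gam / 32.
Proof.
have := w_approx p; rewrite w_period ler_norml => h.
have h1 := birkhoff_red_le0 p x; have h2 := hdelta; have h3 := small_delta.
have h4 := small_xi; rewrite mulrC in h4; lra.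
Qed.

Lemma drift_le : drift <= gam / 32.
Proof.
have /andP[_ h] := drift_bounds; have g0 := gam0; have p1 := p1'.
have [d0|d0] := leP drift 0; first lra.
apply: le_trans h; rewrite ler_peMr//; exact: ltW.
Qed.

(** Partial sums of the reduced function, which is nonpositive, stay between [- delta]
and 0 and the drift is controlled over a whole period. *)
Lemma w_bound_lt j : (j <= p)%N -> `|w j| <= 3 * gam / 64.
Proof.
move=> jp; have := w_approx j; have /andP[d1 d2] := drift_bounds.
have jp' : j%:R <= p%:R :> R by rewrite ler_nat.
have j0 : 0 <= j%:R :> R by [].
have h1 : xi * j%:R <= gam / 64.
  by apply: le_trans small_xi; rewrite mulrC ler_wpM2r.
have h2 : - (gam / 64) <= drift * j%:R <= gam / 32.
  have g0 := gam0.
  have [d0|d0] := leP drift 0.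
    have e1 : drift * p%:R <= drift * j%:R by rewrite ler_wnM2l.
    have e2 : drift * j%:R <= 0 by rewrite mulr_le0_ge0.
    lra.
  have e1 : drift * j%:R <= drift * p%:R by rewrite ler_pM2l.
  have e2 : 0 <= drift * j%:R by rewrite mulr_ge0// ltW.
  lra.
have h3 := birkhoff_red_le0 j x.
have h4 : - delta <= birkhoff F red j x.
  apply: (le_trans hdelta); rewrite -(subnKC jp) birkhoffD gerDl.
  exact: birkhoff_red_le0.
have h5 := small_delta; rewrite !ler_norml; lra.
Qed.

Lemma w_bound j : `|w j| <= 3 * gam / 64.
Proof.
have [n] := ubnP j; elim: n j => // n IH j; rewrite ltnS => jn.
have [jp|pj] := leqP j p; first exact: w_bound_lt.
rewrite /w -(subnKC (ltnW pj)) birkhoffD -/(w p) w_period add0r hy.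
have -> : birkhoff G theta (j - p) (y + q%:~R) = w (j - p).
  by apply: eq_bigr => i _; rewrite (iter_shift hG) (shiftz0 theta_periodic).
apply: IH; rewrite (leq_trans _ jn)// ltn_subrL p0/=; exact: leq_ltn_trans pj.
Qed.

Local Notation near_orbit := (near_lift G y (3 * rho)).

(** A relation instead of a function: near the orbit the index [j] and the lift [n] of
the nearby orbit point need not be chosen, which lets [potential_step] follow the orbit
point by its image.  Near the orbit the values [w j + V] make [ln G' - c] a coboundary
along the orbit, and the term in [kap] absorbs the variation of [ln G'] around it.  Away
from it the potential is lowered by [gam / 2]: a step that comes back to the orbit is charged
this amount, and a step that leaves the orbit, where [gam] is lost, receives it. *)
Inductive potential t u : Prop :=
| pot_near j n of `|t - iter j G y - n%:~R| <= 3 * rho &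
    u = w j + V (iter j G y) + kap * `|t - iter j G y - n%:~R| `^ a
| pot_far of ~ near_orbit t & u = V t - gam / 2.

Lemma potential_exists t : exists u, potential t u.
Proof.
have [[j [n h]]|h] := pselect (near_orbit t).
  by eexists; apply: pot_near h erefl.
by eexists; apply: pot_far h erefl.
Qed.

Lemma potential_near_bounds t j n : `|t - iter j G y - n%:~R| <= 3 * rho ->
  `|w j + V (iter j G y) + kap * `|t - iter j G y - n%:~R| `^ a - V t| <= gam / 8.
Proof.
move=> h; have h1 := w_bound j.
have h2 := V_holder (t - n%:~R) (iter j G y).
rewrite -mulrNz (shiftz0 V1) mulrNz addrAC in h2.
have h3 : CV * `|t - iter j G y - n%:~R| `^ b <= CV * (3 * rho) `^ b.
  by apply: ler_wpM2l => //; apply: powR_le; rewrite ?(ltW b0).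
have h4 : kap * `|t - iter j G y - n%:~R| `^ a <= kap * (3 * rho) `^ a.
  by apply: ler_wpM2l => //; apply: powR_le; rewrite ?(ltW a0).
have h5 : 0 <= kap * `|t - iter j G y - n%:~R| `^ a by rewrite mulr_ge0 ?powR_ge0.
have h6 := small_V; have h7 := small_kap; have h8 := eta0.
move: h1 h2; rewrite !ler_norml; lra.
Qed.

Lemma potential_bounds t u : potential t u -> V t - gam / 2 <= u <= V t + gam / 8.
Proof.
have g0 := gam0; case=> [j n h ->|_ ->]; last lra.
by have := potential_near_bounds h; rewrite ler_norml; lra.
Qed.

Lemma theta_gain t : dk (F t) <= 0 -> theta t <= - gam + gam / 16.
Proof.
move=> h; have h1 := theta_upper t; have h2 := ln_dk_le0 h; have h3 := drift_le.
by move: h3; rewrite /drift /theta; lra.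
Qed.

Lemma theta_le t : theta t <= gam / 16.
Proof.
have h1 := theta_upper t; have h2 := ln_dk_le (F t); have h3 := drift_le.
by move: h3; rewrite /drift /theta; lra.
Qed.

Lemma close_to_center t v j n : `|F t - v| < 2 * rho -> v = iter j F x + n%:~R ->
  `|G t - iter j G y - n%:~R| <= 3 * rho.
Proof.
move=> h1 vE; have h2 := G_near_F t; have h3 := yx j.
have -> : G t - iter j G y - n%:~R = (F t - v) + (G t - F t) - (iter j G y - iter j F x).
  by rewrite vE; lra.
have := ler_normB ((F t - v) + (G t - F t)) (iter j G y - iter j F x).
have := ler_normD (F t - v) (G t - F t); lra.
Qed.

(** The bump has positive derivative only within 2 rho of the orbit of [x], hence only
when [G t] is within 3 rho of the shadowing orbit. *)
Lemma gain_far t : ~ near_orbit (G t) -> dk (F t) <= 0.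
Proof.
move=> h; apply: dk_le0 => v [j [n vE]]; rewrite leNgt; apply/negP => hv.
by apply: h; exists j, n; exact: close_to_center hv vE.
Qed.

(** The image of a point near the orbit point [j] is within about 4 L rho of the orbit
point [j + 1], so by the gap (4 L + 30) rho it is not near any other orbit point; if it is not near
the point [j + 1] either, the bump does not act. *)
Lemma gain_exit t j n : `|t - iter j G y - n%:~R| <= 3 * rho ->
  3 * rho < `|G t - iter j.+1 G y - (2 * n)%:~R| -> dk (F t) <= 0.
Proof.
move=> h1 h2; apply: dk_le0 => v Pv; rewrite leNgt; apply/negP => hv.
have Pj : P (iter j.+1 F x + (2 * n)%:~R) by exists j.+1, (2 * n).
have r0 := rho0; have e0 := eta'0; have l1 := L1.
have [vE|] := P_sep Pv Pj.
  by have := close_to_center hv vE; lra.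
have FE : iter j.+1 F x + (2 * n)%:~R = F (iter j F x + n%:~R).
  by rewrite (shiftz hF.2) (intrM _ 2).
rewrite FE => h3.
have /andP[_ h4] := bilip_abs lam0 hF.1 t (iter j F x + n%:~R).
have h5 : `|t - (iter j F x + n%:~R)| <= 4 * rho.
  have -> : t - (iter j F x + n%:~R) = (t - iter j G y - n%:~R) + (iter j G y - iter j F x) by lra.
  apply: (le_trans (ler_normD _ _)); have := yx j.
  have := G_near_F t; have := normr_ge0 (G t - F t); lra.
have h6 : L * `|t - (iter j F x + n%:~R)| <= L * (4 * rho) by rewrite ler_wpM2l//; lra.
have := ler_distD (F t) v (F (iter j F x + n%:~R)); rewrite (distrC v (F t)).
rewrite mulrDl in h3; lra.
Qed.

(** At the orbit point the factor [1 + k'] takes its maximal value [1 + k0], so the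
variation of [k'] can only lower [G'].  What remains is the variation of [F'], Hölder of
exponent [b > a] and so small at scale [rho] in terms of the exponent [a], and the [a]-Hölder
error between [G'] and the perturbed derivative. *)
Lemma log_derivative_growth t j n : `|t - iter j G y - n%:~R| <= 3 * rho ->
  ln (dG t) - ln (dG (iter j G y + n%:~R)) <=
  kap * (lam `^ a - 1) * `|t - iter j G y - n%:~R| `^ a.
Proof.
set d := `|_|; set s := iter j G y + n%:~R => h.
have ts : `|t - s| = d by rewrite /s /d opprD addrA.
have d0 : 0 <= d := normr_ge0 _.
rewrite /kap divfK; last by rewrite gt_eqF//; lra_with lama.
have db : d `^ b <= (3 * rho) `^ (b - a) * d `^ a.
  move: d0; rewrite le_eqVlt => /orP[/eqP<-|d0].
    by rewrite !powR0 ?gt_eqF// mulr0.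
  have -> : d `^ b = d `^ (b - a) * d `^ a.
    by rewrite -powRD ?subrK// (gt_eqF d0) implybT.
  by rewrite ler_wpM2r ?powR_ge0//; apply: powR_le; rewrite ?(ltW d0)//; lra_with ab.
have e1 := dG_holder t s; rewrite ts in e1.
have e2 := dF_holder t s; rewrite ts in e2.
have dks : dk (F s) = k0.
  have Pj : P (iter j.+1 F x + (2 * n)%:~R) by exists j.+1, (2 * n).
  apply: dk_center Pj _.
  have FE : iter j.+1 F x + (2 * n)%:~R = F (iter j F x + n%:~R).
    by rewrite (shiftz hF.2) (intrM _ 2).
  have /andP[_ h3] := bilip_abs lam0 hF.1 s (iter j F x + n%:~R).
  rewrite FE; apply: (le_trans h3).
  have -> : s - (iter j F x + n%:~R) = iter j G y - iter j F x by rewrite /s; lra.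
  have h4 : L * `|iter j G y - iter j F x| <= L * eta' by rewrite ler_wpM2l//; lra_with L1.
  have h5 := small_eta; rewrite mulrDl mul1r in h5.
  have e0 := eta0; have e3 := eta'0; have r0 := rho0; lra.
have e3 : dF1 t - dF1 s <= 2 * (CF * d `^ b).
  rewrite /dF1 dks; have h5 := dk_bounds (F t); have h6 := dF_ge1 t.
  have h7 : dF t * (1 + dk (F t)) <= dF t * (1 + k0).
    rewrite ler_wpM2l//; [lra|]; move: h5; rewrite ler_norml; lra.
  have h8 : (dF t - dF s) * (1 + k0) <= CF * d `^ b * (1 + k0).
    rewrite ler_wpM2r//; [by lra_with k00|]; move: e2; rewrite ler_norml; lra.
  have h9 : CF * d `^ b * (1 + k0) <= CF * d `^ b * 2.
    by rewrite ler_wpM2l//; [rewrite mulr_ge0 ?powR_ge0|lra_with k01].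
  rewrite mulrBl in h8; lra.
have e4 : dG t - dG s <= 2 * (CF * d `^ b) + eta * d `^ a.
  by move: e1; rewrite ler_norml; lra.
have e5 : CF * d `^ b <= CF * ((3 * rho) `^ (b - a) * d `^ a) by rewrite ler_wpM2l.
have e6 : ln (dG t) - ln (dG s) <= Num.max 0 (dG t - dG s).
  have gt1 := dG_ge1 t; have gs1 := dG_ge1 s.
  have [le|lt] := leP (dG t) (dG s).
    rewrite max_l; last lra.
    by rewrite subr_le0 ler_ln ?posrE; lra.
  rewrite max_r; last lra.
  have := ln_lip gt1 gs1; rewrite (ger0_norm (_ : 0 <= dG t - dG s)); last lra.
  by apply: le_trans; exact: ler_norm.
apply: (le_trans e6); rewrite ge_max; apply/andP; split.
  by rewrite mulr_ge0 ?powR_ge0// addr_ge0// mulr_ge0 ?powR_ge0// mulr_ge0.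
rewrite mulrDl; lra.
Qed.

(** If the step ends far from the orbit, or stops following the orbit point it starts
near, the bump does not act and [gam] is lost, more than the variation of the potential.  If it
comes from far to near, the potential climbs from its lowered value by at least [3 gam / 8],
relative to [V].  From near an orbit point to near its image, the term in [kap] grows by the
factor [lam^a], which dominates the variation of [ln G']. *)
Lemma potential_step t u : potential t u -> exists2 u', potential (G t) u' &
  ln (dG t) - c + u - u' <= - (gam / 8 * \1_[set s | ~ near_orbit s] t).
Proof.
have g0 := gam0.
have ind_le : gam / 8 * \1_[set s | ~ near_orbit s] t <= gam / 8.
  by rewrite ler_piMr ?indicE ?lern1 ?leq_b1//; lra.
move=> pot_t; have ub := potential_bounds pot_t.
case: pot_t ub => [j n h ->|far ->] ub; last first.
  have [u' hu'] := potential_exists (G t); exists u' => //.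
  case: hu' => [j n h ->|far' ->].
    have := potential_near_bounds h; rewrite ler_norml => h1.
    have h2 := theta_le t; rewrite /theta in h2; lra.
  have := theta_gain (gain_far far'); rewrite /theta; lra.
have ind0 : \1_[set s | ~ near_orbit s] t = 0 :> R.
  by rewrite indicE memNset//=; apply; exists j, n.
rewrite ind0 mulr0 oppr0.
have [h'|h'] := leP `|G t - iter j.+1 G y - (2 * n)%:~R| (3 * rho); last first.
  have [u' hu'] := potential_exists (G t); exists u' => //.
  have ub' := potential_bounds hu'.
  have := theta_gain (gain_exit h h'); rewrite /theta; lra.
eexists; first by apply: pot_near h' erefl.
set d := `|t - _ - _| in h *; set d' := `|G t - _ - _| in h' *.
have dd : lam * d <= d'.
  have /andP[h1 _] := bilip_abs lam0 hG.1 t (iter j G y + n%:~R).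
  by rewrite (shiftz hG.2) -(intrM _ 2) !opprD !addrA in h1.
have d0 : 0 <= d := normr_ge0 _.
have h1 : lam `^ a * d `^ a <= d' `^ a.
  rewrite -powRM//; apply: powR_le; rewrite ?(ltW a0) ?mulr_ge0//.
have dGn : dG (iter j G y) = dG (iter j G y + n%:~R) by rewrite (shiftz0 dG1).
set s := iter j G y + n%:~R in dGn.
have h2 := log_derivative_growth h.
rewrite -/d -/s in h2.
have h3 : kap * (lam `^ a * d `^ a) <= kap * d' `^ a by rewrite ler_wpM2l.
have wS : w j.+1 = w j + theta (iter j G y) by rewrite /w birkhoffSr.
rewrite wS /theta dGn -/s -/d -/d' /=.
have : kap * (lam `^ a - 1) * d `^ a = kap * (lam `^ a * d `^ a) - kap * d `^ a by lra.
lra.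
Qed.

Lemma birkhoff_potential (n : nat) t u : potential t u ->
  birkhoff G (fun s => ln (dG s) - c) n t <=
  V 0 + CV + gam / 8 - u - gam / 8 * birkhoff G \1_[set s | ~ near_orbit s] n t.
Proof.
elim: n t u => [|n IH] t u hu.
  rewrite /birkhoff !big_ord0 mulr0 subr0 subr_ge0.
  have /andP[_ h1] := potential_bounds hu.
  by have := periodic_holder_bound b0 V_holder V1 t; rewrite ler_norml; lra.
have [u' hu' h] := potential_step hu.
have -> : birkhoff G \1_[set s | ~ near_orbit s] n.+1 t =
  (\1_[set s | ~ near_orbit s] t : R) + birkhoff G \1_[set s | ~ near_orbit s] n (G t) :> R.
  exact: birkhoffS.
by rewrite birkhoffS; have := IH _ _ hu'; cbv beta; lra.
Qed.

Lemma birkhoff_locked (n : nat) t : birkhoff G (fun s => ln (dG s) - c) n t <=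
  2 * CV + gam - gam / 8 * birkhoff G \1_[set s | ~ near_orbit s] n t.
Proof.
have [u hu] := potential_exists t; have g0 := gam0.
have := birkhoff_potential n hu; have := potential_bounds hu.
by have := periodic_holder_bound b0 V_holder V1 t; rewrite ler_norml; lra.
Qed.

Lemma eta'_le : eta' <= rho.
Proof.
by have h1 := G_near_F 0; have := normr_ge0 (G 0 - F 0); lra.
Qed.

(** As in [gain_exit]: if [G t] is near the orbit at all, it is near the image of the
orbit point that [t] follows. *)
Lemma follow_center t v : P v -> `|t - v| <= 4 * rho -> near_orbit (G t) ->
  `|G t - F v| <= 4 * rho.
Proof.
move=> Pv tv [j [n h]]; have r0 := rho0; have l1 := L1.
have Pj : P (iter j F x + n%:~R) by exists j, n.
have h1 : `|G t - (iter j F x + n%:~R)| <= 4 * rho.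
  have -> : G t - (iter j F x + n%:~R) =
    (G t - iter j G y - n%:~R) + (iter j G y - iter j F x) by lra.
  by apply: (le_trans (ler_normD _ _)); have := yx j; have := eta'_le; lra.
have [->//|h2] := P_sep (orbit_lift_step Pv) Pj.
have /andP[_ h3] := bilip_abs lam0 hF.1 t v.
have h4 : L * `|t - v| <= L * (4 * rho) by rewrite ler_wpM2l//; lra.
have h5 := G_near_F t; have h6 := eta'0.
have h7 := ler_distD (G t) (F v) (iter j F x + n%:~R).
have h8 := ler_distD (F t) (F v) (G t).
rewrite (distrC (F v) (F t)) (distrC (F t) (G t)) in h8.
rewrite mulrDl in h2; lra.
Qed.

(** By [follow_center] the orbit of [t] follows that of a single lifted point, hence the
shadowing orbit of that point, for all times. *)
Lemma near_orbit_expansive t : (forall i, near_orbit (iter i G t)) ->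
  exists j n, t = iter j G y + n%:~R.
Proof.
move=> H; have [j [n h]] := H 0%N; exists j, n; have r0 := rho0.
pose v := iter j F x + n%:~R.
have Pv i : P (iter i F v).
  by elim: i => [|i IH]; [exists j, n | exact: orbit_lift_step].
have tv i : `|iter i G t - iter i F v| <= 4 * rho.
  elim: i => [|i IH]; last by apply: follow_center (Pv i) IH (H i.+1).
  rewrite /v /= (_ : t - _ = (t - iter j G y - n%:~R) + (iter j G y - iter j F x)); last lra.
  by apply: (le_trans (ler_normD _ _)); have := yx j; have := eta'_le; move: h => /=; lra.
have hs i : lam ^+ i * `|t - (iter j G y + n%:~R)| <= 5 * rho.
  have /andP[h1 _] := iter_dist lam1 hG i t (iter j G y + n%:~R).
  apply: (le_trans h1).
  have -> : iter i G t - iter i G (iter j G y + n%:~R) =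
    (iter i G t - iter i F v) - (iter (i + j) G y - iter (i + j) F x).
    by rewrite /v !(iter_shift hG, iter_shift hF) -!iterD; lra.
  apply: (le_trans (ler_normB _ _)); have := yx (i + j)%N; have := tv i; have := eta'_le; lra.
by apply/eqP; rewrite -subr_eq0 -normr_le0; exact: expand_bounded lam1 hs.
Qed.

End shadow.

Lemma locking : exists y C e, [/\ iter p G y = y + q%:~R, 0 < e,
  forall (n : nat) t,
    birkhoff G (fun s => ln (dG s) - birkhoff G (fun s => ln (dG s)) p y / p%:R) n t <=
    C - e * birkhoff G \1_[set s | ~ near_lift G y (3 * rho) s] n t &
  forall t, (forall i, near_lift G y (3 * rho) (iter i G t)) ->
    exists j n, t = iter j G y + n%:~R].
Proof.
have [y [hy yx]] := exists_shadow.
exists y, (2 * CV + gam), (gam / 8); split=> //.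
- by rewrite divr_gt0.
- exact: birkhoff_locked.
- exact: near_orbit_expansive.
Qed.

End locking.

(** * Lifts of circle maps and their derivatives *)

Section circle_lifts.
Context {R : realType}.
Local Open Scope quotient_scope.
Local Notation S1 := (circle R).
Local Notation proj := (\pi_S1 : R -> S1).
Implicit Types (f g : S1 -> S1) (F G h : R -> R) (s t : R) (n : int).

Lemma proj_shift t n : proj (t + n%:~R) = proj t.
Proof. by apply/circle_piP; rewrite addrAC subrr add0r intr_int. Qed.

Lemma proj_eq s t : proj s = proj t -> exists n, s = t + n%:~R.
Proof. by move/circle_piP/intrP => [n h]; exists n; rewrite -h; lra. Qed.

Lemma proj_surj (x : S1) : exists t, proj t = x.
Proof. by exists (repr x); rewrite reprK. Qed.

Lemma proj_continuous : continuous proj.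
Proof. exact: pi_continuous. Qed.

Lemma circle_distE s t : circle_dist (proj s) (proj t) = int_dist (s - t).
Proof.
apply/eqP; rewrite eq_le; apply/andP; split.
  rewrite /int_dist -addrA -opprD -[X in circle_dist _ X](proj_shift _ (Num.floor (s - t + 2^-1))).
  exact: circle_dist_le.
apply: lb_le_inf; first by exists `|s - t|, s, t.
move=> _ [s' [t' [/proj_eq[n ->] /proj_eq[n' ->] ->]]].
apply: (le_trans (int_dist_le (n' - n) _)).
by rewrite intrB; have -> : s - t - (n'%:~R - n%:~R) = s + n%:~R - (t + n'%:~R) by lra.
Qed.

Lemma int_dist_small t : `|t| <= 2^-1 -> int_dist t = `|t|.
Proof.
move=> h; apply/eqP; rewrite eq_le; apply/andP; split.
  by have := int_dist_le 0 t; rewrite subr0.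
rewrite /int_dist; set n := Num.floor _.
have [->|/intr_ge1 h1] := eqVneq n 0; first by rewrite subr0.
have := h1 R; have := lerB_normD (- n%:~R) t; rewrite normrN [- _ + _]addrC => h2 h3.
lra.
Qed.

(** Otherwise a half-integer would be an intermediate value. *)
Lemma integer_valued_const h : continuous h -> (forall t, h t \is a Num.int) ->
  forall s t, h s = h t.
Proof.
move=> ch hi.
suff H s t : h s < h t -> False.
  by move=> s t; case: (ltgtP (h s) (h t)) => // /H.
move=> st.
have main (a b v : R) : a <= b -> Num.min (h a) (h b) <= v <= Num.max (h a) (h b) ->
    exists c, h c = v.
  move=> ab hv; have [|//|c _ hc] := @IVT R h a b v ab; last by exists c.
  exact: continuous_subspaceT.
have /intrP[n hn] := hi s; have /intrP[k hk] := hi t.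
have nk : (n + 1 <= k)%R by rewrite lezD1 -(ltr_int R) -hn -hk.
have nk' : h s + 1 <= h t by rewrite hn hk -[1]/(1%:~R) -intrD ler_int.
have [c hc] : exists c, h c = h s + 2^-1.
  have [le|/ltW le] := leP s t; apply: (main _ _ _ le).
    by rewrite min_l ?max_r; lra.
  by rewrite min_r ?max_l; lra.
have /intrP[l hl] := hi c.
have e : (l - n)%:~R = 2^-1 :> R by rewrite intrB -hl -hn hc; lra.
have /intr_lt1 ln : `|(l - n)%:~R : R| < 1 by rewrite e ger0_norm; lra.
by move: e; rewrite ln; lra.
Qed.

Lemma is_lift_unique f F G : is_lift f F -> is_lift f G ->
  exists n, forall t, G t = F t + n%:~R.
Proof.
move=> [cF hF] [cG hG].
have /integer_valued_const H : continuous (fun t => G t - F t).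
  by move=> t; apply: cvgB; [exact: cG|exact: cF].
have hi t : G t - F t \is a Num.int by apply/circle_piP; rewrite hF hG.
have /intrP[n hn] := hi 0; exists n => t.
by rewrite -hn -(H hi t 0); lra.
Qed.

Lemma is_lift_add f F n : is_lift f F -> is_lift f (fun t => F t + n%:~R).
Proof.
move=> [cF hF]; split=> t; last by rewrite -hF; exact: proj_shift.
by apply: cvgD; [exact: cF|exact: cvg_cst].
Qed.

Lemma is_lift_shift f F : is_lift f F -> exists n, forall t, F (t + 1) = F t + n%:~R.
Proof.
move=> hF; apply: (is_lift_unique hF); split=> t.
  apply: (@continuous_comp _ _ _ (fun t => t + 1) F); last exact: hF.1.
  by apply: cvgD; [exact: cvg_id|exact: cvg_cst].
by rewrite hF.2 -[1]/(1%:~R); congr f; exact: proj_shift.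
Qed.

(** Carries the derivative of the lift along with the derivative of the circle map, so
that the lift chosen in the definition of the latter never has to be mentioned again. *)
Definition c1_lift f F (dF : R -> R) := [/\ is_lift f F,
  forall t : R, is_derive t 1 F (dF t), continuous dF &
  forall t, Defs.deriv f (proj t) = dF t].

Lemma is_derive_translate F (dF : R -> R) (c : R) t :
  is_derive (t + c) 1 F (dF (t + c)) -> is_derive t 1 (fun s => F (s + c)) (dF (t + c)).
Proof.
move=> h; have h1 : is_derive t 1 (fun s : R => s + c) 1.
  have -> : (fun s : R => s + c) = shift c by [].
  exact: is_derive_shift.
have := @is_derive1_comp _ F (fun s => s + c) t _ _ h h1.
by rewrite mulr1.
Qed.

Lemma derive_periodic F (dF : R -> R) (c : R) : (forall t : R, is_derive t 1 F (dF t)) ->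
  (forall t, F (t + 1) = F t + c) -> forall t, dF (t + 1) = dF t.
Proof.
move=> h hs t.
have h1 := is_derive_translate (h (t + 1)).
have h2 : is_derive t 1 (fun s => F (s + 1)) (dF t).
  have -> : (fun s => F (s + 1)) = (F + cst c) by apply/funext => s; rewrite hs.
  have := is_deriveD (h t) (is_derive_cst c t 1).
  by rewrite addr0.
by rewrite -(@derive_val _ _ _ _ _ _ _ h1) (@derive_val _ _ _ _ _ _ _ h2).
Qed.

Lemma lift_is_lift f F : is_lift f F -> is_lift f (Defs.lift f).
Proof. by move=> h; rewrite /Defs.lift; case: xgetP => [G _ //|/(_ F)]. Qed.

Lemma deriv_lift f F (dF : R -> R) : is_lift f F ->
  (forall t : R, is_derive t 1 F (dF t)) -> forall t, Defs.deriv f (proj t) = dF t.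
Proof.
move=> hF hd t.
have [n hn] := is_lift_unique hF (lift_is_lift hF).
have [k hk] := is_lift_shift hF.
have per := derive_periodic hd hk.
rewrite /Defs.deriv; have /proj_eq[l ->] : proj (repr (proj t)) = proj t by rewrite reprK.
have h2 : is_derive (t + l%:~R) 1 (Defs.lift f) (dF (t + l%:~R)).
  have -> : Defs.lift f = (F + cst n%:~R) by apply/funext => s; rewrite hn.
  have := is_deriveD (hd (t + l%:~R)) (is_derive_cst (n%:~R : R) (t + l%:~R) 1).
  by rewrite addr0.
by rewrite derive1E (@derive_val _ _ _ _ _ _ _ h2) (shiftz0 per).
Qed.

Lemma C1_map_lift f : C1_map f -> exists F dF, c1_lift f F dF.
Proof.
move=> [F [hF hd hc]]; exists F, (derive1 F).
have hd' (t : R) : is_derive t 1 F (derive1 F t).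
  by rewrite derive1E; exact: derivableP.
by split=> //; exact: deriv_lift.
Qed.

Lemma c1_lift_C1 f F dF : c1_lift f F dF -> C1_map f.
Proof.
move=> [hF hd hc _]; exists F.
have e : derive1 F = dF.
  by apply/funext => t; rewrite derive1E; exact: (@derive_val _ _ _ _ _ _ _ (hd t)).
by split; [ | move=> t; have := hd t; case | rewrite e].
Qed.

End circle_lifts.

(** * Degree, Hölder constants and expanding lifts of the maps of the class *)

Section circle_class.
Context {R : realType}.
Local Open Scope quotient_scope.
Local Notation S1 := (circle R).
Local Notation proj := (\pi_S1 : R -> S1).
Implicit Types (f g : S1 -> S1) (F G h : R -> R) (s t : R) (n : int).

Lemma frac_rep (x : S1) : exists2 t, 0 <= t < 1 & proj t = x.
Proof.
have [t <-] := proj_surj x; exists (t - (Num.floor t)%:~R).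
  by have := floor_itv t; rewrite intrD; lra.
by rewrite -mulrNz proj_shift.
Qed.

Lemma small_integer_eq s t : proj s = proj t -> `|s - t| < 1 -> s = t.
Proof.
move=> /proj_eq[n ->]; rewrite addrAC subrr add0r => /intr_lt1 ->.
by rewrite addr0.
Qed.

(** The lift increases by a positive integer [n] on a period.  With [n = 1] the map would be
injective, whereas the two sheets over [f 0] contain distinct points with the same image;
with [n >= 3] there would be three preimages of [f 0], two of which lie in the same sheet. *)
Lemma lift_degree2 f F : covering_of_degree 2 f -> is_lift f F ->
  {homo F : s t / s < t} -> forall t, F (t + 1) = F t + 2.
Proof.
move=> [_ cov] hF mono.
have [n hn] := is_lift_shift hF.
have n0 : (0 < n)%R.
  by rewrite -(ltr_int R); have := mono 0 1 ltr01; rewrite -{1}[1]add0r hn; lra.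
have fF t : f (proj t) = proj (F t) by rewrite hF.2.
have [V [oV Vy] [U [oU tU fVU hU]]] := cov (f (proj 0)).
have inU x : f x = f (proj 0) -> exists i, U i x.
  move=> fx; have : (f @^-1` V) x by rewrite /= fx.
  by rewrite fVU => -[i _ Ux]; exists i.
have Uinj i x x' : U i x -> U i x' -> f x = f x' -> x = x'.
  move=> Ux Ux' e; have [[_ inj _] _] := hU i.
  by apply: inj => //; rewrite inE.
have Usurj i : exists2 x, U i x & f x = f (proj 0).
  have [[_ _ sur] _] := hU i.
  by have [x Ux fx] := sur _ Vy; exists x.
have n1 : n != 1.
  apply/eqP => ne1.
  have [x0 U0 f0] := Usurj ord0; have [x1 U1 f1] := Usurj ord_max.
  have x01 : x0 <> x1.
    move=> e; have /trivIsetP := tU => /(_ ord0 ord_max I I isT).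
    by move/seteqP => [h _]; apply: (h x0); split=> //; rewrite e.
  have [s s01 sE] := frac_rep x0; have [t t01 tE] := frac_rep x1.
  have fst : f (proj s) = f (proj t) by rewrite sE tE f0 f1.
  have key (a c : R) : 0 <= a -> c < 1 -> f (proj a) = f (proj c) -> a < c -> False.
    move=> a0 c1 e ac; have := mono _ _ ac.
    have : F c < F (a + 1) by apply: mono; lra.
    rewrite hn ne1 => h1 h2.
    have := @small_integer_eq (F a) (F c); rewrite -!fF => /(_ e) e'.
    have : F a = F c by apply: e'; rewrite ltr_norml; lra.
    lra.
  case: (ltgtP s t) => [st|ts|e].
  - by apply: (key s t) => //; [case/andP: s01 | case/andP: t01].
  - by apply: (key t s) => //; [case/andP: t01 | case/andP: s01].
  - by apply: x01; rewrite -sE -tE e.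
suff n3 : ~ (3 <= n)%R.
  have n2 : n = 2 by move: n0 n1 n3; clear; lia.
  by move=> t; rewrite hn n2.
move=> n3.
have F1 : F 0 + 3 <= F 1.
  by rewrite -{2}[1]add0r hn lerD2l -[3]/(3%:~R) ler_int.
have root (j : 'I_3) : exists t, [/\ 0 <= t, t < 1 & F t = F 0 + j%:R].
  have j2 : j%:R <= 2 :> R by rewrite ler_nat -ltnS ltn_ord.
  have j0 : 0 <= j%:R :> R by [].
  have [||t t01 Ft] := @IVT R F 0 1 (F 0 + j%:R) ler01.
  - by apply: continuous_subspaceT; exact: hF.1.
  - by rewrite min_l ?max_r; lra.
  move: t01; rewrite in_itv/= => /andP[t0 t1]; exists t; split=> //.
  rewrite lt_neqAle t1 andbT; apply/eqP => e.
  have e' : F 1 = F 0 + j%:R by rewrite -Ft e.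
  move: F1; rewrite e' lerD2l => h3.
  by have := le_trans h3 j2; rewrite ler_nat.
have /choice[r hr] := root.
have fr j : f (proj (r j)) = f (proj 0).
  by have [_ _ e] := hr j; rewrite !fF e -[j%:R]/(j%:~R) proj_shift.
have /choice[c hc] : forall j, exists i, U i (proj (r j)) by move=> j; apply: inU.
have /injectivePn[i [j ij cij]] : ~~ injectiveb c.
  by apply/negP => /injectiveP /leq_card; rewrite !card_ord.
have hi := hc i; rewrite cij in hi.
have e := Uinj _ _ _ hi (hc j); rewrite !fr in e.
have [ri0 ri1 Fi] := hr i; have [rj0 rj1 Fj] := hr j.
have er : r i = r j by apply: small_integer_eq (e erefl) _; rewrite ltr_norml; lra.
move: Fi; rewrite er Fj => /addrI/eqP; rewrite eqr_nat => /eqP /val_inj h.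
by rewrite h eqxx in ij.
Qed.

(** The Hölder constant on the circle bounds the increments up to distance [1 / 2]; larger
ones reduce to these, since moving a lift by an integer brings the points closer. *)
Lemma Hold_holder (a C : R) (u : S1 -> R) : 0 < a ->
  (Hold a u <= C%:E)%E -> holder C a (u \o proj).
Proof.
move=> a0 hC.
have main s t : 0 < `|s - t| <= 2^-1 -> `|u (proj s) - u (proj t)| <= C * `|s - t| `^ a.
  move=> /andP[h1 h2].
  have e : circle_dist (proj s) (proj t) = `|s - t| by rewrite circle_distE int_dist_small.
  rewrite -ler_pdivrMr ?powR_gt0// -lee_fin; apply: le_trans hC.
  apply: ereal_sup_ubound; exists (proj s, proj t); rewrite /= e//.
  by apply/andP; split => //; lra.
have C0 : 0 <= C.
  have h : 0 < `|0 - 2^-1 : R| <= 2^-1.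
    by rewrite sub0r normrN gtr0_norm; [apply/andP; split|]; lra.
  have := le_trans (normr_ge0 _) (main _ _ h).
  by rewrite pmulr_lge0// powR_gt0//; case/andP: h.
move=> s t /=.
have [n hn] := round_int (s - t).
rewrite -(proj_shift t n).
have [e|st0] := eqVneq s (t + n%:~R).
  by rewrite e subrr normr0 mulr_ge0 ?powR_ge0.
have e : s - t - n%:~R = s - (t + n%:~R) by lra.
have h : 0 < `|s - (t + n%:~R)| <= 2^-1 by rewrite -{2}e hn normr_gt0 subr_eq0 st0.
apply: (le_trans (main _ _ h)); rewrite ler_wpM2l//.
apply: powR_le; rewrite ?(ltW a0)//.
have [->|n0] := eqVneq n 0; first by rewrite addr0.
have := intr_ge1 n0 => /(_ R); rewrite e in hn => h1.
have := lerB_normD (s - t) (- n%:~R).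
have := lerB_normD (- n%:~R) (s - t); rewrite normrN -e [- _ + _]addrC.
by rewrite e; lra.
Qed.

Lemma holder_Hold (a C : R) (u : S1 -> R) :
  holder C a (u \o proj) -> (Hold a u <= C%:E)%E.
Proof.
move=> h; apply: ge_ereal_sup => _ [[x y] /= /andP[d0 d1] <-].
have [s sE] := proj_surj x; have [t tE] := proj_surj y.
rewrite lee_fin ler_pdivrMr ?powR_gt0//.
pose n := Num.floor (s - t + 2^-1).
have tE' : proj (t + n%:~R) = y by rewrite proj_shift.
have -> : circle_dist x y = `|s - (t + n%:~R)|.
  by rewrite -sE -tE circle_distE /int_dist opprD addrA.
by have := h s (t + n%:~R); rewrite /= sE tE'.
Qed.

Lemma Hold_lty (a : R) (u : S1 -> R) : 0 < a -> (Hold a u < +oo)%E ->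
  exists C, holder C a (u \o proj).
Proof.
move=> a0; case e : (Hold a u) => [r| |] // _.
  by exists r; apply: Hold_holder => //; rewrite e.
by exists 0; apply: Hold_holder => //; rewrite e leNye.
Qed.

Lemma c1_lift_periodic f F dF : c1_lift f F dF -> forall t, dF (t + 1) = dF t.
Proof.
move=> [hF hd _ _]; have [n hn] := is_lift_shift hF.
exact: derive_periodic hd hn.
Qed.

Lemma periodic_bounded h : continuous h -> (forall t, h (t + 1) = h t) ->
  exists2 M, forall t, h t <= M & exists t, h t = M.
Proof.
move=> ch per; have [|c _ hc] := @EVT_max R h 0 1 ler01.
  exact: continuous_subspaceT.
exists (h c); last by exists c.
move=> t; rewrite -(shiftz0 per (- Num.floor t) t); apply: hc.
by rewrite in_itv/= mulrNz; have := floor_itv t; rewrite intrD; lra.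
Qed.

Lemma derive_bilip F (dF : R -> R) (c K : R) : (forall t : R, is_derive t 1 F (dF t)) ->
  (forall t, c <= dF t <= K) -> bilip c K F.
Proof.
move=> hd hb s t st.
have [|z _ ->] := @MVT_segment R F dF s t st (fun z _ => hd z).
- apply: continuous_subspaceT => z.
  apply: differentiable_continuous; apply/derivable1_diffP.
  by have := hd z; case.
- by have /andP[h1 h2] := hb z; rewrite !ler_wpM2r ?subr_ge0.
Qed.

Lemma expanding_class_lift (lam b : R) f : 0 < b -> expanding_class lam b f ->
  exists F dF C L, [/\ c1_lift f F dF, expanding_lift lam L F,
    holder C b dF & forall t, lam < dF t <= L].
Proof.
move=> b0 [[/C1_map_lift[F [dF hF]] hH] cov [F' hF' mono] hlam].
have [lF hd hc hdv] := hF.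
have per := c1_lift_periodic hF.
have [L hL _] := periodic_bounded hc per.
have [C hC] := Hold_lty b0 hH.
have hb t : lam < dF t <= L by rewrite -hdv hlam hdv hL.
exists F, dF, C, L; split=> //.
- split; first by apply: derive_bilip hd _ => t; have := hb t; lra.
  move: (lift_degree2 cov hF' mono) => h.
  have [n hn] := is_lift_unique lF hF'.
  move=> t; have := h t; rewrite !hn; lra.
- by move=> s t; have := hC s t; rewrite /= !hdv.
Qed.

End circle_class.

(** * Perturbing a circle map by a diffeomorphism *)

Section covering_composition.
Context {X Y Z : topologicalType}.

Lemma covering_comp_homeo n (p : X -> Y) (h : Y -> Z) (h' : Z -> Y) :
  continuous h -> continuous h' -> cancel h h' -> cancel h' h ->
  covering_of_degree n p -> covering_of_degree n (h \o p).
Proof.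
move=> ch ch' hK h'K [cp cov]; split.
  by move=> x; apply: continuous_comp; [exact: cp | exact: ch].
move=> z; have [V [oV Vz] [U [oU tU fVU hU]]] := cov (h' z).
have imh (B : set Y) : h @` B = h' @^-1` B.
  apply/seteqP; split=> [_ [y By <-]|w Bw] /=; first by rewrite hK.
  by exists (h' w).
exists (h' @^-1` V); first by split=> //; exact: open_comp (fun x _ => ch' x) oV.
exists U; split=> //.
  by rewrite -fVU; apply/seteqP; split=> x /=; rewrite hK.
move=> i; have [[fun_ inj sur] opn] := hU i; split; first split.
- by move=> x Ux /=; rewrite hK; exact: fun_.
- by move=> x x' Ux Ux' /(can_inj hK); exact: inj.
- move=> w /= Vw; have [x Ux px] := sur _ Vw; exists x => //=.
  by rewrite px h'K.
- move=> W oW WU; rewrite -(image_comp p h) imh.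
  by apply: open_comp (opn _ oW WU) => x _; exact: ch'.
Qed.

End covering_composition.

Section circle_perturbation.
Context {R : realType}.
Local Open Scope quotient_scope.
Local Notation S1 := (circle R).
Local Notation proj := (\pi_S1 : R -> S1).
Implicit Types (f g : S1 -> S1) (F G h : R -> R) (s t : R).

(** The map of the circle covered by [h], when [h (t + 1) = h t + 1]. *)
Definition circle_map h (x : S1) : S1 := proj (h (repr x)).

Lemma circle_mapE h : (forall t, h (t + 1) = h t + 1) ->
  forall t, circle_map h (proj t) = proj (h t).
Proof.
move=> h1 t; rewrite /circle_map.
have /proj_eq[n ->] : proj (repr (proj t)) = proj t by rewrite reprK.
by rewrite (shiftz h1) mul1r proj_shift.
Qed.

Lemma circle_map_continuous h : (forall t, h (t + 1) = h t + 1) ->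
  continuous h -> continuous (circle_map h).
Proof.
move=> h1 ch; apply/quotient_continuous.
have -> : circle_map h \o \pi_S1 = proj \o h.
  by apply/funext => t; rewrite /= circle_mapE.
by move=> t; apply: continuous_comp; [exact: ch | exact: proj_continuous].
Qed.

Lemma circle_homeo h (c K : R) : 0 < c -> bilip c K h ->
  (forall t, h (t + 1) = h t + 1) ->
  exists h', [/\ continuous (circle_map h), continuous (circle_map h'),
    cancel (circle_map h) (circle_map h') & cancel (circle_map h') (circle_map h)].
Proof.
move=> c0 hb h1.
have /choice[h' hh'] := bilip_surj c0 hb.
have lo := bilip_abs (ltW c0) hb.
have inj s t : h s = h t -> s = t.
  move=> e; have /andP[] := lo s t; rewrite e subrr normr0 pmulr_rle0// normr_le0.
  by rewrite subr_eq0 => /eqP.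
have h'h t : h' (h t) = t by apply: inj; rewrite hh'.
have h'1 t : h' (t + 1) = h' t + 1 by apply: inj; rewrite h1 !hh'.
have ch' : continuous h'.
  apply: (@holder_continuous _ c^-1 1) => // s t; rewrite powRr1//.
  by have /andP[] := lo (h' s) (h' t); rewrite !hh' ler_pdivlMl.
exists h'; split.
- by apply: circle_map_continuous => //; exact: bilip_continuous (ltW c0) hb.
- exact: circle_map_continuous.
- by move=> x; have [t <-] := proj_surj x; rewrite !circle_mapE// h'h.
- by move=> x; have [t <-] := proj_surj x; rewrite !circle_mapE// hh'.
Qed.

Section perturb.
Context (f : S1 -> S1) (F dF k dk : R -> R) (lam : R).
Hypotheses (hF : c1_lift f F dF) (cov : covering_of_degree 2 f)
  (ori : {homo F : s t / s < t}).
Hypotheses (k1 : forall t, k (t + 1) = k t) (hk : forall t : R, is_derive t 1 k (dk t))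
  (cdk : continuous dk) (dk_small : forall t, `|dk t| <= 2^-1).

Let phi t := t + k t.
(** Post-composition with a circle diffeomorphism keeps the covering and its degree, and
multiplies the derivative at [t] by [1 + k' (F t)]. *)
Definition perturbed : S1 -> S1 := circle_map phi \o f.

Let phi1 t : phi (t + 1) = phi t + 1.
Proof. by rewrite /phi k1; lra. Qed.

Let phi_derive t : is_derive t 1 phi (1 + dk t).
Proof.
have -> : phi = (id + k) by apply/funext.
by have := hk t => ?; exact: is_deriveD.
Qed.

Let phi_bilip : bilip 2^-1 2 phi.
Proof.
apply: derive_bilip phi_derive _ => t; have := dk_small t; rewrite ler_norml => h.
by apply/andP; split; lra.
Qed.

Lemma perturbed_c1_lift :
  c1_lift perturbed (fun t => F t + k (F t)) (fun t => dF t * (1 + dk (F t))).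
Proof.
have [[cF hFf] hd hc hdv] := hF.
have cphi : continuous phi by apply: bilip_continuous phi_bilip; lra.
have lF : is_lift perturbed (fun t => F t + k (F t)).
  split; first by move=> t; apply: (@continuous_comp _ _ _ F phi); [exact: cF|exact: cphi].
  by move=> t; rewrite /perturbed /= -hFf circle_mapE.
have hd' (t : R) : is_derive t 1 (fun t => F t + k (F t)) (dF t * (1 + dk (F t))).
  rewrite mulrC; have h1 := hd t; have h2 := phi_derive (F t).
  exact: (@is_derive1_comp _ phi F t _ _ h2 h1).
split=> //.
  move=> t; apply: cvgM; first exact: hc.
  apply: cvgD; first exact: cvg_cst.
  by apply: continuous_comp; [exact: cF | exact: cdk].
exact: deriv_lift.
Qed.

Lemma perturbed_covering : covering_of_degree 2 perturbed.
Proof.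
have c0 : 0 < 2^-1 :> R by [].
have [h' [c1 c2 K1 K2]] := circle_homeo c0 phi_bilip phi1.
exact: covering_comp_homeo c1 c2 K1 K2 cov.
Qed.

Lemma perturbed_orientation : orientation_preserving perturbed.
Proof.
have [lF _ _ _] := perturbed_c1_lift; exists (fun t => F t + k (F t)) => // s t st.
have /andP[h _] := phi_bilip (ltW (ori st)).
rewrite -subr_gt0; apply: lt_le_trans h.
by rewrite mulr_gt0// subr_gt0 ori.
Qed.

Lemma perturbed_class b C : holder C b (fun t => dF t * (1 + dk (F t))) ->
  (forall t, lam < dF t * (1 + dk (F t))) -> expanding_class lam b perturbed.
Proof.
move=> hC hl; have H := perturbed_c1_lift; have [_ _ _ hdv] := H.
split.
- split; first exact: c1_lift_C1 H.
  apply: le_lt_trans (ltry C); apply: holder_Hold => s t /=.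
  by rewrite !hdv; exact: hC.
- exact: perturbed_covering.
- exact: perturbed_orientation.
- by move=> x; have [t <-] := proj_surj x; rewrite hdv.
Qed.

End perturb.

Lemma C1Holder_dist_bound (a e : R) f g F dF G dG : c1_lift f F dF -> c1_lift g G dG ->
  (forall t, `|F t - G t| <= e) -> (forall t, `|dF t - dG t| <= e) ->
  holder e a (fun t => dF t - dG t) -> (C1Holder_dist a f g <= (3 * e)%:E)%E.
Proof.
move=> [[_ hF] _ _ hdF] [[_ hG] _ _ hdG] h1 h2 h3; rewrite /C1Holder_dist.
have -> : 3 * e = e + e + e by lra.
rewrite !EFinD; apply: leeD; first apply: leeD.
- apply: ge_ereal_sup => _ [x _ <-]; have [t <-] := proj_surj x.
  by rewrite lee_fin -hF -hG; exact: le_trans (circle_dist_le _ _) (h1 t).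
- apply: ge_ereal_sup => _ [x _ <-]; have [t <-] := proj_surj x.
  by rewrite lee_fin hdF hdG.
- by apply: holder_Hold => s t /=; rewrite !hdF !hdG.
Qed.

(** The circle distance only determines the lift of [g] up to an integer: [n] is the one
that brings the two lifts close at 0, and the bound on the derivatives propagates this
to a period. *)
Lemma C1Holder_dist_lift (a e : R) f g F dF G0 dG : 0 < a ->
  c1_lift f F dF -> c1_lift g G0 dG ->
  (forall t, F (t + 1) = F t + 2) -> (forall t, G0 (t + 1) = G0 t + 2) ->
  (C1Holder_dist a f g < e%:E)%E ->
  exists n : int, let G t := G0 t + n%:~R in
  [/\ c1_lift g G dG, forall t, `|G t - F t| <= 2 * e,
     forall t, `|dG t - dF t| <= e & holder e a (fun t => dG t - dF t)].
Proof.
move=> a0 HF HG F1 G1; have [[_ hF] dF' _ hdF] := HF; have [lG dG' cG hdG] := HG.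
have [_ hG] := lG.
rewrite C1Holder_distC /C1Holder_dist.
set A := ereal_sup _; set B := ereal_sup _; set H := Hold _ _ => hlt.
have A0 : (0 <= A)%E.
  apply: (@le_trans _ _ (circle_dist (g (proj 0)) (f (proj 0)))%:E).
    by rewrite lee_fin circle_dist_ge0.
  by apply: ereal_sup_ubound; exists (proj 0).
have B0 : (0 <= B)%E.
  apply: (@le_trans _ _ (`|Defs.deriv g (proj 0) - Defs.deriv f (proj 0)|)%:E).
    by rewrite lee_fin.
  by apply: ereal_sup_ubound; exists (proj 0).
have H0 : (0 <= H)%E.
  have d : circle_dist (proj 0) (proj 2^-1) = 2^-1 :> R.
    by rewrite circle_distE int_dist_small sub0r normrN ger0_norm; lra.
  apply: le_trans (_ : (`|Defs.deriv g (proj 0) - Defs.deriv f (proj 0) -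
    (Defs.deriv g (proj 2^-1) - Defs.deriv f (proj 2^-1))| /
    circle_dist (proj 0) (proj 2^-1) `^ a)%:E <= _)%E.
    by rewrite lee_fin divr_ge0// powR_ge0.
  apply: ereal_sup_ubound; exists (proj 0, proj 2^-1) => //=.
  by rewrite d; apply/andP; split; lra.
have Ae : (A <= e%:E)%E.
  by apply/ltW/(le_lt_trans _ hlt); rewrite -addeA leeDl// adde_ge0.
have Be : (B <= e%:E)%E.
  by apply/ltW/(le_lt_trans _ hlt); rewrite addeAC leeDr// adde_ge0.
have He : (H <= e%:E)%E.
  by apply/ltW/(le_lt_trans _ hlt); rewrite leeDr// adde_ge0.
have d0 : int_dist (G0 0 - F 0) <= e.
  rewrite -circle_distE hF hG -lee_fin; apply: le_trans Ae.
  by apply: ereal_sup_ubound; exists (proj 0).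
pose n := - Num.floor (G0 0 - F 0 + 2^-1).
exists n => /=; set G := fun t => G0 t + n%:~R.
have dd t : `|dG t - dF t| <= e.
  rewrite -lee_fin -hdF -hdG; apply: le_trans Be.
  by apply: ereal_sup_ubound; exists (proj t).
have dGd (t : R) : is_derive t 1 G (dG t).
  have -> : G = (G0 + cst n%:~R) by [].
  have := is_deriveD (dG' t) (is_derive_cst (n%:~R : R) t 1).
  by rewrite addr0.
split=> //.
- split=> //; exact: is_lift_add.
- have per t : G (t + 1) - F (t + 1) = G t - F t by rewrite /G F1 G1; lra.
  have per' := @shiftz0 _ (fun t => G t - F t) per.
  move=> t; rewrite -(per' (- Num.floor t) t) mulrNz.
  have : 0 <= t - (Num.floor t)%:~R < 1 by have := floor_itv t; rewrite intrD; lra.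
  move: (t - _) => {}t /andP[t0 t1].
  have dv (s : R) : is_derive s 1 (fun t => G t - F t) (dG s - dF s).
    have h1 := dGd s; have h2 := dF' s.
    have -> : (fun t => G t - F t) = (G - F) by [].
    exact: is_deriveB.
  have b : bilip (- e) e (fun t => G t - F t).
    by apply: derive_bilip dv _ => s; rewrite -ler_norml.
  have e0 : 0 <= e := le_trans (normr_ge0 _) (dd 0).
  have := b 0 t t0; rewrite subr0 => h.
  have h0 : `|G 0 - F 0| <= e.
    move: d0; rewrite /int_dist /G /n mulrNz.
    by have -> : forall x : R, G0 0 - F 0 - x = G0 0 - x - F 0 by move=> x; lra.
  have h3 : e * t <= e by rewrite ler_piMr//; lra.
  move: h h0; rewrite mulNr !ler_norml; lra.
- have := Hold_holder a0 He; move=> hh s t; have := hh s t.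
  by rewrite /= !hdF !hdG.
Qed.

End circle_perturbation.

(** * Invariant measures and periodic orbits *)

Lemma sum_const_ereal (R : realType) (x : \bar R) n : (0 <= x)%E ->
  (\sum_(i < n) x = n%:R%:E * x)%E.
Proof.
move=> x0; elim: n => [|n IH]; first by rewrite big_ord0 mul0e.
by rewrite big_ord_recr/= IH -natr1 EFinD ge0_muleDl ?mul1e// lee_fin.
Qed.

Lemma integral_cst_probability d (T : measurableType d) (R : realType)
    (mu : probability T R) (r : R) : (\int[mu]_x r%:E = r%:E)%E.
Proof.
transitivity (\int[mu]_x (cst r%:E x))%E; first by [].
rewrite integral_cst//.
transitivity (r%:E * 1)%E; last exact: mule1.
by congr (_ * _)%E; exact: probability_setT.
Qed.

Section orbit_measure.
Context d (T : measurableType d) (R : realType) (z : nat -> T) (p : nat).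

(** The mean of the Dirac masses at the [p + 1] points [z 0, ..., z p]; shifting the
length avoids the empty mean. *)
Definition orbit_measure : set T -> \bar R :=
  mscale ((p.+1%:R : R)^-1)%:nng (msum (fun k => \d_(z k)) p.+1).

HB.instance Definition _ := Measure.on orbit_measure.

Lemma orbit_measureE A : orbit_measure A =
  ((\sum_(k < p.+1) \1_A (z k)) / p.+1%:R)%:E.
Proof.
rewrite /orbit_measure /mscale/= /msum; under eq_bigr do rewrite /dirac.
by rewrite sumEFin -EFinM mulrC.
Qed.

Lemma orbit_measure_setT : orbit_measure setT = 1%E.
Proof.
rewrite orbit_measureE; under eq_bigr do rewrite indicT.
by rewrite sumr_const card_ord divff.
Qed.

HB.instance Definition _ := Measure_isProbability.Build _ _ _ orbit_measure
  orbit_measure_setT.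

Lemma integral_orbit_measure (u : T -> R) : measurable_fun setT u ->
  (forall x, 0 <= u x) ->
  (\int[orbit_measure]_x (u x)%:E)%E = ((\sum_(k < p.+1) u (z k)) / p.+1%:R)%:E.
Proof.
move=> mu u0; rewrite /orbit_measure ge0_integral_mscale//; last 2 first.
- exact/measurable_EFinP.
- by move=> x _; rewrite lee_fin.
rewrite ge0_integral_measure_sum//; last 2 first.
- by move=> x _; rewrite lee_fin.
- exact/measurable_EFinP.
have e k : (\int[\d_(z k)]_x (u x)%:E = (u (z k))%:E)%E.
  by rewrite integral_dirac ?diracT ?mul1e//; exact/measurable_EFinP.
rewrite (eq_bigr (fun k : 'I_p.+1 => (u (z k))%:E)); last by move=> k _; exact: e.
by rewrite sumEFin -EFinM mulrC.
Qed.

End orbit_measure.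

Section locked_orbit.
Context d (T : measurableType d) (R : realType) (g : T -> T).
Hypothesis mg : measurable_fun setT g.
Implicit Types (mu : probability T R) (x : T) (A : set T).

Let invariant mu := forall A, measurable A -> mu (g @^-1` A) = mu A.

Lemma measurable_iter i : measurable_fun setT (iter i g).
Proof. by elim: i => [|i IH]; [exact: measurable_id | exact: measurableT_comp]. Qed.

Lemma measurable_preimage_iter i A : measurable A -> measurable (iter i g @^-1` A).
Proof. by move=> mA; rewrite -[X in measurable X]setTI; exact: measurable_iter. Qed.

Lemma invariant_iter mu i A : invariant mu -> measurable A ->
  mu (iter i g @^-1` A) = mu A.
Proof.
move=> inv mA; elim: i => // i IH; rewrite -IH -(inv (iter i g @^-1` A)).
  by congr (mu _); apply/seteqP; split => x /=; rewrite -iterS iterSr.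
exact: measurable_preimage_iter.
Qed.

Lemma integral_iter mu i (u : T -> R) : invariant mu -> measurable_fun setT u ->
  (forall x, 0 <= u x) ->
  (\int[mu]_x (u (iter i g x))%:E = \int[mu]_x (u x)%:E)%E.
Proof.
move=> inv mu_ u0.
have := @ge0_integral_pushforward _ _ _ _ R _ (measurable_iter i) mu setT (EFin \o u)
   measurableT.
rewrite preimage_setT /= => <-; last 2 first.
- exact/measurable_EFinP.
- by move=> x _; rewrite lee_fin.
apply: eq_measure_integral; first exact: measurable_iter.
by move=> mi A mA _; exact: invariant_iter.
Qed.

(** The integral of the sum of length [n] is [n] times that of [B]; divide by [n] and let
[n] grow. *)
Lemma integral_birkhoff_le mu (B : T -> R) (C c : R) : invariant mu ->
  measurable_fun setT B -> (forall x, 0 <= B x) ->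
  (forall n x, \sum_(i < n) B (iter i g x) <= C + c * n%:R) ->
  (\int[mu]_x (B x)%:E <= c%:E)%E.
Proof.
move=> inv mB B0 hB.
have h n : (n%:R%:E * \int[mu]_x (B x)%:E <= (C + c * n%:R)%:E)%E.
  have -> : (n%:R%:E * \int[mu]_x (B x)%:E = \int[mu]_x (\sum_(i < n) (B (iter i g x))%:E))%E.
    rewrite ge0_integral_sum//; last 2 first.
    - by move=> i; apply/measurable_EFinP/measurableT_comp => //; exact: measurable_iter.
    - by move=> i x _; rewrite lee_fin.
    under eq_bigr do rewrite integral_iter//.
    by rewrite sum_const_ereal//; apply: integral_ge0 => x _; rewrite lee_fin.
  have -> : (C + c * n%:R)%:E = (\int[mu]_x (C + c * n%:R)%:E)%E.
    by rewrite integral_cst_probability.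
  apply: ge0_le_integral => //.
  - by move=> x _; apply: sume_ge0 => i _; rewrite lee_fin.
  - apply: emeasurable_sum => i.
    by apply/measurable_EFinP/measurableT_comp => //; exact: measurable_iter.
  - by move=> x _; rewrite sumEFin lee_fin.
have J0 : (0 <= \int[mu]_x (B x)%:E)%E by apply: integral_ge0 => x _; rewrite lee_fin.
have h1 := h 1%N; rewrite mul1e in h1.
case: (\int[mu]_x (B x)%:E)%E J0 h h1 => [k| |]// _ h _.
rewrite lee_fin leNgt; apply/negP => ck.
pose n := (Num.trunc (C / (k - c))).+1.
have hn : C < n%:R * (k - c).
  by rewrite -ltr_pdivrMr ?subr_gt0//; exact: truncnS_gt.
have := h n; rewrite -EFinM lee_fin; lra.
Qed.

Context (x0 : T) (p : nat) (A : T -> R) (N : set T) (C e : R).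
Hypotheses (hx0 : iter p.+1 g x0 = x0) (mA : measurable_fun setT A)
  (A0 : forall x, 0 <= A x) (mN : measurable N) (e0 : 0 < e).
Hypothesis m1 : forall j, measurable [set iter j g x0].
Let c := (\sum_(k < p.+1) A (iter k g x0)) / p.+1%:R.
Hypothesis hbirk : forall n x,
  \sum_(i < n) (A (iter i g x) + e * \1_(~` N) (iter i g x)) <= C + c * n%:R.
Hypothesis hexp : forall x, (forall i, N (iter i g x)) -> exists j, x = iter j g x0.

Let nu : probability T R := orbit_measure R (fun k => iter k g x0) p.

Let nuE B : nu B = ((\sum_(k < p.+1) \1_B (iter k g x0)) / p.+1%:R)%:E.
Proof. exact: orbit_measureE. Qed.

Let sum_shift (u : T -> R) i :
  \sum_(k < p.+1) u (iter k g (iter i g x0)) = \sum_(k < p.+1) u (iter k g x0).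
Proof.
elim: i => // i IH; rewrite -[RHS]IH /=.
have hi : iter p.+1 g (iter i g x0) = iter i g x0.
  by rewrite -iterD addnC iterD hx0.
rewrite big_ord_recr [RHS]big_ord_recl addrC /= -iterSr hi; congr (_ + _).
by apply: eq_bigr => k _; rewrite /= -iterSr.
Qed.

Lemma orbit_measure_invariant : invariant nu.
Proof.
move=> B mB; rewrite !nuE; congr ((_ / _)%:E).
rewrite -(sum_shift \1_B 1); apply: eq_bigr => k _.
by rewrite -iterSr.
Qed.

Let orbit := [set iter k g x0 | k in setT].

Let m_orbit : measurable orbit.
Proof.
have -> : orbit = \bigcup_k [set iter k g x0].
  by apply/seteqP; split=> [_ [k _ <-]|_ [k _ ->]]; exists k.
exact: bigcupT_measurable.
Qed.

Lemma orbit_measure_orbit : nu orbit = 1%E.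
Proof.
rewrite nuE (eq_bigr (fun=> 1)); first by rewrite sumr_const card_ord divff.
by move=> k _; rewrite indicE mem_set//; exists k.
Qed.

Lemma integral_nu : (\int[nu]_x (A x)%:E = c%:E)%E.
Proof. exact: integral_orbit_measure. Qed.

(** The set [~` N] enters the integral with weight [e], by the penalized Birkhoff bound. *)
Lemma integral_gap mu : invariant mu ->
  (\int[mu]_x (A x)%:E + e%:E * mu (~` N) <= c%:E)%E.
Proof.
move=> inv; have mNC : measurable (~` N) by exact: measurableC.
have mI : measurable_fun setT (\1_(~` N) : T -> R) by exact: measurable_indic.
have -> : (\int[mu]_x (A x)%:E + e%:E * mu (~` N) =
           \int[mu]_x (A x + e * \1_(~` N) x)%:E)%E.
  rewrite -[in LHS](setIT (~` N)) -(integral_indic mu measurableT mNC).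
  rewrite -ge0_integralZl_EFin//; last 2 first.
  - exact/measurable_EFinP.
  - exact: ltW.
  rewrite -ge0_integralD//.
  - by move=> x _; rewrite lee_fin.
  - exact/measurable_EFinP.
  - by move=> x _; rewrite -EFinM lee_fin mulr_ge0// ltW.
  - by apply/measurable_EFinP; exact: measurable_funM.
apply: (integral_birkhoff_le inv) hbirk.
- by apply: measurable_funD => //; exact: measurable_funM.
- by move=> x; rewrite addr_ge0// mulr_ge0// ltW.
Qed.

Lemma integral_le_nu mu : invariant mu ->
  (\int[mu]_x (A x)%:E <= \int[nu]_x (A x)%:E)%E.
Proof.
move=> inv; rewrite integral_nu; apply: le_trans (integral_gap inv).
by rewrite leeDl// mule_ge0// lee_fin ltW.
Qed.

(** By [integral_gap] the set [~` N] is null, hence so is the set of points whose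
orbit meets it, and the periodic orbit has full measure.  There the sum of the indicator
of [B] over a period is constant, and by invariance its integral is
[p.+1] times the measure of [B]. *)
Lemma maximizing_unique mu : invariant mu ->
  (\int[nu]_x (A x)%:E <= \int[mu]_x (A x)%:E)%E ->
  forall B, measurable B -> mu B = nu B.
Proof.
move=> inv hmax B mB.
have mNC : measurable (~` N) by exact: measurableC.
have far0 : mu (~` N) = 0%E.
  have := integral_gap inv; rewrite integral_nu in hmax => h.
  have h1 : (c%:E + e%:E * mu (~` N) <= c%:E)%E.
    by apply: le_trans h; exact: leeD.
  have f : mu (~` N) \is a fin_num by exact: fin_num_measure.
  move: h1; rewrite -(fineK f) -EFinM -EFinD lee_fin gerDl pmulr_rle0//.
  move=> h2; congr (_%:E); apply/eqP; rewrite eq_le h2/= fine_ge0//.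
have out0 : mu (~` orbit) = 0%E.
  apply/eqP; rewrite -measure_le0.
  have sub : ~` orbit `<=` \bigcup_i (iter i g @^-1` (~` N)).
    move=> x xO; apply: contrapT => h; apply: xO.
    have [|j ->] := hexp (x := x); last by exists j.
    by move=> i; apply: contrapT => Ni; apply: h; exists i.
  have mF i : measurable (iter i g @^-1` (~` N)) by exact: measurable_preimage_iter.
  have h := measure_sigma_subadditive mu mF (measurableC m_orbit) sub.
  apply: (le_trans h).
  by rewrite eseries0// => i _ _ /=; rewrite invariant_iter.
have mI : measurable_fun setT (\1_B : T -> R) by exact: measurable_indic.
pose s := \sum_(k < p.+1) (\1_B (iter k g x0) : R).
have e1 : (\int[mu]_x (\sum_(k < p.+1) (\1_B (iter k g x))%:E) = p.+1%:R%:E * mu B)%E.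
  rewrite ge0_integral_sum//; last first.
    by move=> i; apply/measurable_EFinP/measurableT_comp => //; exact: measurable_iter.
  under eq_bigr do rewrite integral_iter// integral_indic// setIT.
  by rewrite sum_const_ereal.
have e2 : (\int[mu]_x (\sum_(k < p.+1) (\1_B (iter k g x))%:E) = s%:E)%E.
  have -> : s%:E = (\int[mu]_x s%:E)%E.
    by rewrite integral_cst_probability.
  apply: ge0_ae_eq_integral => //.
  - apply: emeasurable_sum => i.
    by apply/measurable_EFinP/measurableT_comp => //; exact: measurable_iter.
  - by move=> x _; apply: sume_ge0 => i _; rewrite lee_fin.
  - by move=> x _; rewrite lee_fin sumr_ge0.
  exists (~` orbit); split => //; first exact: measurableC.
  move=> x /= h xO; apply: h => _; case: xO => j _ <-.
  by rewrite sumEFin sum_shift.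
have := e1; rewrite e2 nuE -/s => e3.
have f : mu B \is a fin_num by exact: fin_num_measure.
move: e3; rewrite -(fineK f) -EFinM => -[e3].
by congr (_%:E); rewrite e3 mulrAC divff ?mul1r// pnatr_eq0.
Qed.

End locked_orbit.

(** * From Birkhoff sums of a lift to maximizing measures on the circle *)

Section circle_ergodic.
Context {R : realType}.
Local Open Scope quotient_scope.
Local Notation S1 := (circle R).
Local Notation proj := (\pi_S1 : R -> S1).
Implicit Types (f g : S1 -> S1) (F G h : R -> R) (s t : R) (x z : S1).

Lemma open_measurable_circle (B : set S1) : open B -> measurable B.
Proof. exact: sub_sigma_algebra. Qed.

Lemma circle_measurable_fun g : continuous g -> measurable_fun setT g.
Proof.
move=> /continuousP cg; apply: (measurability (@open S1)); first by [].
by move=> _ [B oB <-]; rewrite setTI; apply: open_measurable_circle; exact: cg.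
Qed.

Lemma circle_measurable_real (u : S1 -> R) : continuous u -> measurable_fun setT u.
Proof.
move=> /continuousP cu; apply: (measurability _ (RGenOpens.measurableE R)).
move=> _ [_ [a [b ->] <-]]; rewrite setTI; apply: open_measurable_circle.
by apply: cu; exact: interval_open.
Qed.

Lemma circle_dist_continuous z : continuous (fun x => circle_dist x z).
Proof.
apply/quotient_continuous; apply: (@holder_continuous _ 1 1) => // s t.
rewrite powRr1// mul1r /=.
apply: le_trans (circle_dist_le s t).
have h1 := circle_dist_triangle (proj t) (proj s) z.
have h2 := circle_dist_triangle (proj s) (proj t) z.
by rewrite (circle_distC (proj t) (proj s)) in h2; rewrite ler_norml; lra.
Qed.

Lemma measurable_circle_ball z r : measurable [set x | circle_dist x z <= r].
Proof.
have m := circle_measurable_real (@circle_dist_continuous z).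
have := m measurableT _ (measurable_itv `]-oo, r]); rewrite setTI.
by congr measurable; apply/seteqP; split => x /=; rewrite in_itv.
Qed.

Lemma circle_dist_eq0 x z : circle_dist x z <= 0 -> x = z.
Proof.
have [s <-] := proj_surj x; have [t <-] := proj_surj z.
rewrite circle_distE /int_dist normr_le0 subr_eq0 => /eqP e.
by apply/circle_piP; rewrite e intr_int.
Qed.

Lemma measurable_circle_set1 z : measurable [set z].
Proof.
have -> : [set z] = [set x | circle_dist x z <= 0].
  by apply/seteqP; split => x /= => [->|/circle_dist_eq0//]; rewrite circle_distxx.
exact: measurable_circle_ball.
Qed.

Lemma c1_lift_continuous g G dG : c1_lift g G dG -> continuous g.
Proof.
move=> [[cG hG] _ _ _]; apply/quotient_continuous.
have -> : g \o \pi_S1 = proj \o G by apply/funext => t; rewrite /= hG.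
by move=> t; apply: continuous_comp; [exact: cG | exact: proj_continuous].
Qed.

Lemma iter_lift g G : is_lift g G -> forall i t, iter i g (proj t) = proj (iter i G t).
Proof. by move=> [_ hG]; elim=> // i IH t /=; rewrite IH -hG. Qed.

Definition periodic_lyapunov_maximizer g := exists nu : probability S1 R,
  [/\ lyapunov_maximizing g nu,
      (forall mu : probability S1 R, lyapunov_maximizing g mu ->
         forall A : set S1, measurable A -> mu A = nu A) &
      supported_on_periodic_orbit g nu].

(** Transfer to the circle of the Birkhoff bound of a lift: [N] is the projection
of the neighbourhood of the lifted orbit, and [ln dG] is the lift of [ln g']. *)
Lemma circle_locked g G dG y p (q : int) (C e r : R) : c1_lift g G dG ->
  (forall t, 1 <= dG t) -> (0 < p)%N -> iter p G y = y + q%:~R -> 0 < e ->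
  (forall (n : nat) t,
    birkhoff G (fun s => ln (dG s) - birkhoff G (fun s => ln (dG s)) p y / p%:R) n t <=
    C - e * birkhoff G \1_[set s | ~ near_lift G y r s] n t) ->
  (forall t, (forall i, near_lift G y r (iter i G t)) ->
    exists j n, t = iter j G y + n%:~R) ->
  periodic_lyapunov_maximizer g.
Proof.
move=> hG dG1; case: p => // p _ hy e0 hb hexp.
have [lG _ cdG hdv] := hG.
have itg := iter_lift lG.
pose x0 := proj y; pose A x := ln (Defs.deriv g x).
have AE t : A (proj t) = ln (dG t) by rewrite /A hdv.
have mg : measurable_fun setT g by apply: circle_measurable_fun (c1_lift_continuous hG).
have hx0 : iter p.+1 g x0 = x0 by rewrite /x0 itg hy proj_shift.
have mA : measurable_fun setT A.
  apply: measurableT_comp; first exact: measurable_ln.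
  apply: circle_measurable_real; apply/quotient_continuous.
  by have -> : Defs.deriv g \o \pi_S1 = dG by apply/funext => t; rewrite /= hdv.
have A0 x : 0 <= A x.
  by have [t <-] := proj_surj x; rewrite AE ln_ge0.
pose N := \bigcup_j [set x | circle_dist x (iter j g x0) <= r].
have mN : measurable N.
  by apply: bigcupT_measurable => j; exact: measurable_circle_ball.
have NE t : N (proj t) <-> near_lift G y r t.
  split=> [[j _ /=]|[j [n h]]].
    by rewrite /x0 itg circle_distE => h; exists j; eexists; exact: h.
  by exists j => //=; rewrite /x0 itg circle_distE; exact: le_trans (int_dist_le n _) h.
have m1 j : measurable [set iter j g x0] by exact: measurable_circle_set1.
pose c := (\sum_(k < p.+1) A (iter k g x0)) / p.+1%:R.
have cE : birkhoff G (fun s => ln (dG s)) p.+1 y / p.+1%:R = c.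
  by congr (_ / _); apply: eq_bigr => k _; rewrite /x0 itg AE.
have hbirk n x : \sum_(i < n) (A (iter i g x) + e * \1_(~` N) (iter i g x)) <= C + c * n%:R.
  have [t <-] := proj_surj x; have := hb n t; rewrite cE.
  have -> : birkhoff G (fun s => ln (dG s) - c) n t = \sum_(i < n) A (iter i g (proj t)) - c * n%:R.
    rewrite /birkhoff sumrB sumr_const card_ord -(mulr_natr c); congr (_ - _).
    by apply: eq_bigr => i _; rewrite itg AE.
  rewrite [birkhoff G \1_(_) n t](_ : _ = \sum_(i < n) \1_(~` N) (iter i g (proj t))); last first.
    apply: eq_bigr => i _; rewrite itg !indicE; congr (_%:R); congr nat_of_bool.
    by apply/idP/idP; rewrite !inE/= => h /NE; exact: h.
  rewrite big_split /= -mulr_sumr.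
  by set S1' := \sum_(i < n) A _; set S2 := \sum_(i < n) _; lra.
have hexp' x : (forall i, N (iter i g x)) -> exists j, x = iter j g x0.
  have [t <-] := proj_surj x => h.
  have [|j [n ->]] := hexp t; first by move=> i; apply/NE; rewrite -itg.
  by exists j; rewrite /x0 itg proj_shift.
exists (orbit_measure R (fun k => iter k g x0) p).
split.
- split; first exact: orbit_measure_invariant.
  move=> mu hmu.
  exact: (integral_le_nu (N:=N) mg mA A0 mN e0 hbirk).
- move=> mu [hmu hmax] B mB.
  apply: (maximizing_unique (N:=N) mg hx0 mA A0 mN e0 m1 hbirk hexp' hmu) => //.
  apply: hmax; exact: orbit_measure_invariant.
- exists x0, p.+1; split=> //.
  exact: orbit_measure_orbit.
Qed.

End circle_ergodic.

(** * Density of locked maps *)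

Section holder_algebra.
Context {R : realType}.
Implicit Types (u v F : R -> R).

Lemma holder_mul (C1 C2 U W b : R) u v : 0 <= U -> holder C1 b u -> holder C2 b v ->
  (forall t, `|u t| <= U) -> (forall t, `|v t| <= W) ->
  holder (C1 * W + U * C2) b (fun t => u t * v t).
Proof.
move=> U0 hu hv bu bv s t.
have -> : u s * v s - u t * v t = (u s - u t) * v s + u t * (v s - v t) by lra.
apply: (le_trans (ler_normD _ _)); rewrite !normrM mulrDl.
apply: lerD.
  by rewrite mulrAC; apply: ler_pM.
by rewrite -mulrA; apply: ler_pM.
Qed.

Lemma holder_comp (C b L : R) u F : 0 <= C -> 0 <= b -> 0 <= L -> holder C b u ->
  (forall s t, `|F s - F t| <= L * `|s - t|) -> holder (C * L `^ b) b (u \o F).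
Proof.
move=> C0 b0 L0 hu hF s t; apply: (le_trans (hu _ _)); rewrite -mulrA ler_wpM2l//.
by rewrite -powRM//; apply: powR_le.
Qed.

Lemma holder_le (C C' b : R) u : C <= C' -> holder C b u -> holder C' b u.
Proof.
by move=> CC' h s t; apply: (le_trans (h s t)); rewrite ler_wpM2r ?powR_ge0.
Qed.

Lemma small_powR (b c : R) : 0 < b -> 0 < c ->
  exists2 e, 0 < e & forall s, 0 <= s <= e -> s `^ b <= c.
Proof.
move=> b0 c0; exists (c `^ b^-1); first exact: powR_gt0.
move=> s /andP[s0 se]; apply: (le_trans (powR_le (ltW b0) s0 se)).
by rewrite -powRrM mulVf ?gt_eqF// powRr1// ltW.
Qed.

Lemma ln1D_ge (x : R) : 0 <= x <= 1 -> x / 2 <= ln (1 + x).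
Proof.
move=> /andP[x0 x1]; have p : 0 < 1 + x by lra.
have h : -1 < - (x / (1 + x)).
  by rewrite ltrN2 ltr_pdivrMr//; lra.
have := le_ln1Dx h.
have -> : 1 + - (x / (1 + x)) = (1 + x)^-1 by field; rewrite gt_eqF.
rewrite lnV ?posrE// lerN2 => h1; apply: le_trans h1.
by rewrite ler_pdivlMr//; nra.
Qed.

(** This is where [b > a] is used: errors of order [rho^b] are small compared with the
gain [ln (1 + e1 rho^a)], which is at least [e1 rho^a / 2]. *)
Lemma choose_scale (a b B e1 : R) : 0 < a -> a < b -> 0 < B -> 0 < e1 <= 1 / 8 ->
  exists2 r0, 0 < r0 & forall rho, 0 < rho < r0 ->
    [/\ rho <= 1, 0 < e1 * rho `^ a, e1 * rho `^ a <= e1 &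
        B * rho `^ b <= ln (1 + e1 * rho `^ a) / 64].
Proof.
move=> a0 ab B0 /andP[e10 e18].
have c0 : 0 < e1 / (128 * B) by rewrite divr_gt0// mulr_gt0.
have ba0 : 0 < b - a by lra.
have [r1 r10 hr1] := small_powR ba0 c0.
exists (Num.min r1 1); first by rewrite lt_min r10/=.
move=> rho /andP[rho0]; rewrite lt_min => /andP[rhor1 rho1].
have ra0 : 0 < rho `^ a := powR_gt0 _ rho0.
have ra1 : rho `^ a <= 1.
  rewrite -[leRHS](_ : 1 `^ a = 1); last by rewrite powR1.
  by apply: powR_le; exact: ltW.
have k00 : 0 < e1 * rho `^ a by rewrite mulr_gt0.
have k0e : e1 * rho `^ a <= e1 by rewrite ler_piMr// ltW.
split=> //; first exact: ltW.
apply: (@le_trans _ _ (e1 * rho `^ a / 128)); last first.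
  have : e1 * rho `^ a / 2 <= ln (1 + e1 * rho `^ a) by apply: ln1D_ge; lra.
  lra.
have -> : rho `^ b = rho `^ (b - a) * rho `^ a.
  by rewrite -powRD ?subrK// (gt_eqF rho0) implybT.
have : rho `^ (b - a) <= e1 / (128 * B) by apply: hr1; rewrite !ltW.
rewrite ler_pdivlMr ?mulr_gt0// => h.
have : rho `^ (b - a) * (128 * B) * rho `^ a <= e1 * rho `^ a by rewrite ler_wpM2r// ltW.
lra.
Qed.

(** The size of the neighbourhood of the perturbed map is chosen last, in terms of the
period [p] and the scale [rho]. *)
Lemma choose_eta (lam a b C D gam rho L : R) (p : nat) : 1 < lam -> 0 < a -> 0 < b ->
  0 <= C -> 0 <= D -> 0 < gam -> 0 < rho -> 1 <= L -> (0 < p)%N ->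
  exists eta, [/\ 0 < eta, eta <= gam / 64,
    eta * (3 * rho) `^ a / (lam `^ a - 1) <= gam / 64,
    eta + (L + 1) * (eta / (lam - 1)) <= rho / 4 &
    p%:R * (eta + (C + 2 * D) * (eta / (lam - 1)) `^ b) <= gam / 64].
Proof.
move=> lam1 a0 b0 C0 D0 gam0 rho0 L1 p0.
have lama : 0 < lam `^ a - 1 by rewrite subr_gt0; exact: powR_gt1.
have p0' : 0 < p%:R :> R by rewrite ltr0n.
have l0 : 0 < lam - 1 by rewrite subr_gt0.
have CD0 : 0 < C + 2 * D + 1 by lra.
have [e1 e10 he1] := small_powR b0
  (divr_gt0 (divr_gt0 gam0 (ltr0n _ 128)) (mulr_gt0 p0' CD0)).
have ra : 0 < (3 * rho) `^ a by apply: powR_gt0; lra.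
have L2 : 0 < 1 + (L + 1) / (lam - 1) by rewrite ltr_wpDr// divr_ge0 ?(ltW l0)//; lra.
have t1 : 0 < gam / 64 by lra.
have t2 : 0 < gam / 64 * (lam `^ a - 1) / (3 * rho) `^ a by rewrite divr_gt0// mulr_gt0.
have t3 : 0 < rho / 4 / (1 + (L + 1) / (lam - 1)) by rewrite divr_gt0//; lra.
have t4 : 0 < gam / 128 / p%:R by rewrite divr_gt0//; lra.
have t5 : 0 < e1 * (lam - 1) by rewrite mulr_gt0.
pose eta := Num.min (gam / 64) (Num.min (gam / 64 * (lam `^ a - 1) / (3 * rho) `^ a)
  (Num.min (rho / 4 / (1 + (L + 1) / (lam - 1)))
  (Num.min (gam / 128 / p%:R) (e1 * (lam - 1))))).
have eta0 : 0 < eta by rewrite !lt_min t1 t2 t3 t4 t5.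
have : eta <= eta by [].
rewrite {2}/eta !le_min => /andP[h1 /andP[h2 /andP[h3 /andP[h4 h5]]]].
exists eta; split=> //.
- by rewrite ler_pdivrMr// -ler_pdivlMr.
- by rewrite ler_pdivlMr// mulrDr mulr1 mulrCA in h3.
rewrite mulrDr.
have h6 : (eta / (lam - 1)) `^ b <= gam / 128 / (p%:R * (C + 2 * D + 1)).
  by apply: he1; rewrite ler_pdivrMr// h5 divr_ge0// ltW.
rewrite ler_pdivlMr ?mulr_gt0// in h6; rewrite ler_pdivlMr// in h4.
set z := _ `^ b in h6 *.
have z0 : 0 <= p%:R * z by rewrite mulr_ge0 ?powR_ge0// ltW.
have : z * (p%:R * (C + 2 * D + 1)) = p%:R * ((C + 2 * D) * z) + p%:R * z by ring.
by move: z0 h4 h6; clear; lra.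
Qed.

End holder_algebra.

Section locked_perturbation.
Context {R : realType}.
Local Open Scope quotient_scope.
Local Notation S1 := (circle R).
Local Notation proj := (\pi_S1 : R -> S1).

(** The condition is put on a whole neighbourhood, so that a locked map is interior to
the set of maps with a unique, periodic maximizer. *)
Definition locked (lam a : R) (f : S1 -> S1) : Prop := exists2 e : R, 0 < e &
  forall g, expanding_class lam a g -> (C1Holder_dist a f g < e%:E)%E ->
  periodic_lyapunov_maximizer g.

Context (lam L a b C m D : R) (f : S1 -> S1) (F dF V : R -> R).
Hypotheses (lam1 : 1 < lam) (a0 : 0 < a) (ab : a < b).
Hypotheses (hf : c1_lift f F dF) (cov : covering_of_degree 2 f)
  (ori : {homo F : s t / s < t}).
Hypotheses (hF : expanding_lift lam L F) (dF_bounds : forall t, lam < dF t <= L)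
  (dF_holder : holder C b dF).
Hypotheses (V1 : forall t, V (t + 1) = V t) (V_holder : holder D b V).
Let red t := ln (dF t) - m + V t - V (F t).
Hypothesis red_le0 : forall t, red t <= 0.
Context (p : nat) (q : int) (x rho delta k0 : R).
Hypotheses (p0 : (0 < p)%N) (hx : iter p F x = x + q%:~R).
Hypotheses (rho0 : 0 < rho) (k00 : 0 < k0) (k01 : k0 <= 1 / 8).
Hypothesis x_sep : separated_orbit F x ((4 * L + 30) * rho).
Hypothesis hdelta : - delta <= birkhoff F red p x.
Let P := orbit_lift F x.
Let k := bump P rho k0.
Let dk := dbump P rho k0.
Let dF1 t := dF t * (1 + dk (F t)).
Let b0 : 0 < b. Proof. exact: lt_trans a0 ab. Qed.
Let L1 : 1 <= L. Proof. exact: le_trans (ltW lam1) (expanding_lift_le hF). Qed.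

Lemma orbit_lift_sep v w : P v -> P w -> v = w \/ (4 * L + 30) * rho <= `|v - w|.
Proof.
move=> [i [n ->]] [j [n' ->]].
have e : iter i F x + n%:~R - (iter j F x + n'%:~R) =
  iter i F x - iter j F x - (n' - n)%:~R by rewrite intrB; lra.
rewrite e; have [->|h] := x_sep i j (n' - n); last by right.
by left; rewrite intrB; lra.
Qed.

Let P_sep v w : P v -> P w -> v = w \/ 25 * rho <= `|v - w|.
Proof.
move=> Pv Pw; have [->|h] := orbit_lift_sep Pv Pw; [by left|right].
apply: le_trans h; rewrite ler_wpM2r ?(ltW rho0)//.
by lra_with L1.
Qed.

Let P1 v : P (v + 1) <-> P v.
Proof.
split=> -[j [n e]]; exists j.
  by exists (n - 1); rewrite intrB addrA -e addrK.
by exists (n + 1); rewrite intrD addrA -e.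
Qed.

Let k00' : 0 <= k0. Proof. exact: ltW. Qed.

Lemma dbump_continuous : continuous dk.
Proof.
apply: (@holder_continuous _ (k0 / rho) 1) => // s t; rewrite powRr1//.
exact: dbump_lip.
Qed.

Let k_shift t : k (t + 1) = k t.
Proof. by have [] := bump_shift k0 rho0 P_sep P1 t. Qed.

Let k_derive (t : R) : is_derive t 1 k (dk t).
Proof. exact: bump_is_derive. Qed.

Let dk_small t : `|dk t| <= 2^-1.
Proof.
by apply: le_trans (dbump_bounds P rho k00' t) _; lra_with k01.
Qed.

Lemma perturbed_lift : c1_lift (perturbed f k) (fun t => F t + k (F t)) dF1.
Proof. exact: (perturbed_c1_lift hf k_shift k_derive dbump_continuous dk_small). Qed.

Let dF_abs t : `|dF t| <= L.
Proof. by have h := dF_bounds t; have l1 := lam1; rewrite ger0_norm; lra. Qed.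

Lemma perturbed_derivative_gt tau e : (forall t, lam + tau <= dF t) -> k0 <= e ->
  L * e < tau -> forall t, lam < dF1 t.
Proof.
move=> htau k0e Le t; have := dbump_bounds P rho k00' (F t).
rewrite -/dk ler_norml => h; have hL := dF_bounds t; have l1 := lam1; have l2 := L1.
have h1 : dF t * (1 - k0) <= dF1 t by rewrite /dF1 ler_wpM2l//; lra.
have h2 : dF t * k0 <= L * e by apply: ler_pM => //; lra.
by have := htau t; lra.
Qed.

Lemma dbump_lift_holder c : 0 < c <= 1 ->
  holder (2 * k0 / rho `^ c * L `^ c) c (dk \o F).
Proof.
move=> /andP[c0 c1]; have l2 := L1; apply: holder_comp.
- by rewrite divr_ge0 ?powR_ge0// mulr_ge0.
- exact: ltW.
- lra.
- by apply: dbump_holder => //; rewrite (ltW c0).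
- have lam0 : 0 <= lam by lra_with lam1.
  by move=> s t; have /andP[] := bilip_abs lam0 hF.1 s t.
Qed.

Lemma perturbed_derivative_holder c Cc : 0 < c <= 1 -> holder Cc c dF ->
  exists Cc', holder Cc' c dF1.
Proof.
move=> c01 hc; have hv := dbump_lift_holder c01; have l2 := L1.
have hv' : holder (2 * k0 / rho `^ c * L `^ c) c (fun t => 1 + dk (F t)).
  by move=> s t; rewrite opprD addrACA subrr add0r; exact: hv.
eexists; apply: (holder_mul (U := L) (W := 2) _ hc hv' dF_abs); first lra.
move=> t; apply: (le_trans (ler_normD _ _)); rewrite normr1.
by have := dk_small (F t); lra.
Qed.

(** The Hölder constant of [k'] is of order [k0 / rho^a = e], and [k] and [k'] are themselves
at most of that order. *)
Lemma perturbed_dist Ca e : a <= 1 -> holder Ca a dF -> rho <= 1 ->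
  k0 = e * rho `^ a -> k0 <= e ->
  (C1Holder_dist a f (perturbed f k) <= (3 * ((2 + L + 2 * L * L `^ a + Ca) * e))%:E)%E.
Proof.
move=> a1 hCa rho1 k0E k0e; have l2 := L1; have k0p := k00; have r0 := rho0.
have dkb s : `|dk s| <= k0 by exact: dbump_bounds.
have Ca0 : 0 <= Ca := holder_ge0 hCa.
have e0 : 0 <= e by lra.
have La : 0 <= 2 * L * L `^ a by rewrite mulr_ge0 ?powR_ge0//; lra.
have Le0 : 0 <= L * e by rewrite mulr_ge0//; lra.
have Lae0 : 0 <= 2 * L * L `^ a * e by rewrite mulr_ge0.
have Cae0 : 0 <= Ca * e by rewrite mulr_ge0.
apply: (C1Holder_dist_bound hf perturbed_lift).
- move=> t; rewrite opprD addNKr normrN; apply: (le_trans (bump_bounds P rho0 k00' _)).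
  have h1 : k0 * rho <= e * 1 by apply: ler_pM => //; lra.
  lra.
- move=> t; rewrite /dF1 mulrDr mulr1 opprD addNKr normrN normrM.
  have : `|dF t| * `|dk (F t)| <= L * e.
    by apply: ler_pM => //; exact: le_trans (dkb _) k0e.
  lra.
have a01 : 0 < a <= 1 by rewrite a0.
have hm : holder (Ca * k0 + L * (2 * k0 / rho `^ a * L `^ a)) a (fun t => dF t * (dk \o F) t).
  by apply: (holder_mul _ hCa (dbump_lift_holder a01) dF_abs) => [|t]; [lra | exact: dkb].
apply: (@holder_le _ (Ca * k0 + L * (2 * k0 / rho `^ a * L `^ a))).
  have -> : 2 * k0 / rho `^ a = 2 * e.
    by rewrite k0E; field; rewrite gt_eqF// powR_gt0.
  have h1 : Ca * k0 <= Ca * e by rewrite ler_wpM2l.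
  lra.
move=> s t; rewrite /dF1; have := hm s t => /=.
have -> : dF s - dF s * (1 + dk (F s)) - (dF t - dF t * (1 + dk (F t))) =
  - (dF s * dk (F s) - dF t * dk (F t)) by lra.
by rewrite normrN.
Qed.

Hypothesis dF1_gt : forall t, lam < dF1 t.

Lemma perturbed_expanding (c Cc : R) : holder Cc c dF1 -> expanding_class lam c (perturbed f k).
Proof.
move=> h; exact: (perturbed_class hf cov ori k_shift k_derive
  dbump_continuous dk_small h dF1_gt).
Qed.

Let gam := ln (1 + k0).
Hypotheses (small_V : D * (3 * rho) `^ b <= gam / 64) (small_delta : delta <= gam / 64)
  (small_C : 2 * C * (3 * rho) `^ b / (lam `^ a - 1) <= gam / 64).

(** The locking estimate with the bump as [k], applied to the lift of [g] that is
close to the perturbed lift. *)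
Lemma perturbed_locked : locked lam a (perturbed f k).
Proof.
have l1 := lam1; have r0 := rho0.
have gam0 : 0 < gam by rewrite /gam ln_gt0//; lra_with k00.
have C0 : 0 <= C := holder_ge0 dF_holder.
have D0 : 0 <= D := holder_ge0 V_holder.
have [eta [eta0 h1 h2 h3 h4]] := choose_eta lam1 a0 b0 C0 D0 gam0 rho0 L1 p0.
exists (eta / 2); first lra.
move=> g hg hd.
have [G0 [dG [CG [LG [hG0 eG0 _ bG]]]]] := expanding_class_lift a0 hg.
have F1shift t : F (t + 1) + k (F (t + 1)) = F t + k (F t) + 2.
  have ks : forall s, k (s + 1) = k s by move=> s; have [] := bump_shift k0 rho0 P_sep P1 s.
  by rewrite hF.2 -[2]/(2%:~R) (shiftz0 ks); lra.
have [n [hG near_G near_dG hold_G]] :=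
  C1Holder_dist_lift a0 perturbed_lift hG0 F1shift eG0.2 hd.
set G := fun t => G0 t + n%:~R in hG near_G.
have eG : expanding_lift lam LG G.
  split=> [s t st|t]; last by rewrite /G eG0.2; lra.
  by have := eG0.1 s t st; rewrite /G; lra.
have dG1 t : 1 <= dG t by have := bG t; lra.
have [y [C' [e [hy e0 hb hexp]]]] : exists y C e, [/\ iter p G y = y + q%:~R, 0 < e,
  forall (n : nat) t,
    birkhoff G (fun s => ln (dG s) - birkhoff G (fun s => ln (dG s)) p y / p%:R) n t <=
    C - e * birkhoff G \1_[set s | ~ near_lift G y (3 * rho) s] n t &
  forall t, (forall i, near_lift G y (3 * rho) (iter i G t)) ->
    exists j n, t = iter j G y + n%:~R].
  have dF1' t : 1 <= dF t by have := dF_bounds t; lra.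
  have dF1_1 t : 1 <= dF t * (1 + dk (F t)) by have := dF1_gt t; rewrite /dF1; lra.
  have near_G' t : `|G t - (F t + k (F t))| <= eta by have := near_G t; lra.
  have near_dG' t : `|dG t - dF t * (1 + dk (F t))| <= eta.
    by have := near_dG t; rewrite /dF1; lra.
  have hold_G' : holder eta a (fun t => dG t - dF t * (1 + dk (F t))).
    by apply: holder_le hold_G; lra.
  apply: (@locking R lam L F dF lam1 hF a b C D m V a0 ab dF1' dF_holder V1 V_holder
    red_le0 p q x rho delta k0 k dk p0 hx rho0 k00 k01 orbit_lift_sep hdelta
    (bump_center k0 rho0 P_sep) (bump_bounds P rho0 k00') (dbump_bounds P rho k00')
    (dbump_center k0 rho0 P_sep) (dbump_le0 rho0 k00') dF1_1
    eta LG G dG eG dG1 (c1_lift_periodic hG) (ltW eta0) near_G' near_dG' hold_G'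
    h3 _ small_delta h4).
  - by rewrite -/gam; have := small_V; lra.
  rewrite -/gam.
  have -> : (2 * C * (3 * rho) `^ (b - a) + eta) / (lam `^ a - 1) * (3 * rho) `^ a =
     2 * C * ((3 * rho) `^ (b - a) * (3 * rho) `^ a) / (lam `^ a - 1) +
     eta * (3 * rho) `^ a / (lam `^ a - 1) by ring.
  have r3 : (3 * rho == 0) = false by rewrite gt_eqF// mulr_gt0.
  rewrite -powRD ?r3 ?implybT//.
  by rewrite subrK; have := small_C; lra.
exact: circle_locked hG dG1 p0 hy e0 hb hexp.
Qed.

End locked_perturbation.

Section dense_locked.
Context {R : realType}.
Local Notation S1 := (circle R).

(** The order of the choices matters: first the size [e1] of the perturbation, from [eps] and
the slack [tau] of the expansion; then the scale below which [rho^b] is negligible; then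
the periodic orbit, and with it [rho] and [p]; finally the neighbourhood. *)
Lemma dense_locked (lam a b eps : R) (f : S1 -> S1) : 1 < lam -> 0 < a -> a < b ->
  b <= 1 -> expanding_class lam a f -> expanding_class lam b f -> 0 < eps ->
  exists f1, [/\ expanding_class lam b f1, expanding_class lam a f1,
    (C1Holder_dist a f f1 < eps%:E)%E & locked lam a f1].
Proof.
move=> lam1 a0 ab b1 fa fb eps0; have b0 : 0 < b by exact: lt_trans ab.
have [F [dF [C [L [hf hF hC bF]]]]] := expanding_class_lift b0 fb.
have [_ cov _ _] := fb.
have [lF hd cdF hdv] := hf.
have [Ca hCa] : exists Ca, holder Ca a dF.
  have [[_ hH] _ _ _] := fa; have [Ca h] := Hold_lty a0 hH; exists Ca => s t.
  by have := h s t; rewrite /= !hdv.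
have ori : {homo F : s t / s < t}.
  move=> s t st; have /andP[h _] := hF.1 s t (ltW st).
  have : 0 < lam * (t - s) by rewrite mulr_gt0 ?subr_gt0//; lra.
  lra.
have L1 : 1 <= L := le_trans (ltW lam1) (expanding_lift_le hF).
have C0 : 0 <= C := holder_ge0 hC.
have Ca0 : 0 <= Ca := holder_ge0 hCa.
have dF1 t : 1 <= dF t by have := bF t; lra.
have perF := c1_lift_periodic hf.
pose A t := ln (dF t).
have hA : holder C b A.
  by move=> s t; apply: le_trans (hC s t); exact: ln_lip.
have A1 t : A (t + 1) = A t by rewrite /A perF.
have [tau tau0 htau] : exists2 tau, 0 < tau & forall t, lam + tau <= dF t.
  have [||M hM [t0 ht0]] := @periodic_bounded R (fun t => - dF t).
  - by move=> t; apply: cvgN; exact: cdF.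
  - by move=> t; rewrite perF.
  exists (- M - lam); first by have := bF t0; lra.
  by move=> t; have := hM t; lra.
have [z hz] := zero_orbit lam1 hF b0 hA A1.
have hred := reduced_holder lam1 hF b0 hA A1.
have M1 : 1 <= 4 * L + 30 by lra.
have [K K0 hK] := good_orbit lam1 hF b0 hred hz M1.
pose D := distortion lam C b.
have D0 : 0 <= D := distortion_ge0 lam1 b0 hA.
have lama : 0 < lam `^ a - 1 by rewrite subr_gt0; exact: powR_gt1.
(* [B * rho^b] bounds the three errors of order [rho^b] in [perturbed_locked]. *)
pose B1 := D * 3 `^ b; pose B2 := 2 * C * 3 `^ b / (lam `^ a - 1).
have B10 : 0 <= B1 by rewrite mulr_ge0 ?powR_ge0.
have B20 : 0 <= B2 by rewrite divr_ge0 ?(ltW lama)// mulr_ge0 ?powR_ge0// mulr_ge0.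
pose B := B1 + K + B2 + 1.
have [BB1 BK BB2] : [/\ B1 <= B, K <= B & B2 <= B] by rewrite /B; split; lra.
have B0 : 0 < B by rewrite /B; lra.
(* The distance to the perturbed map is at most [3 * (E * e1)], by [perturbed_dist]. *)
pose E := 2 + L + 2 * L * L `^ a + Ca.
have La0 : 0 <= 2 * L * L `^ a by rewrite mulr_ge0 ?powR_ge0//; lra.
have E0 : 0 < E by rewrite /E; lra.
have [e1 [e10 e1a e1b e1c]] : exists e1 : R,
    [/\ 0 < e1, e1 <= 1 / 8, L * e1 < tau & 3 * (E * e1) < eps].
  exists (Num.min (1 / 8) (Num.min (tau / (2 * L)) (eps / (6 * E)))).
  split.
  - by rewrite !lt_min !divr_gt0// mulr_gt0//; lra.
  - by rewrite ge_min lexx.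
  - apply: (@le_lt_trans _ _ (L * (tau / (2 * L)))).
      by rewrite ler_wpM2l ?ge_min ?lexx ?orbT//; lra.
    have -> : L * (tau / (2 * L)) = tau / 2 by field; rewrite gt_eqF//; lra.
    lra.
  - apply: (@le_lt_trans _ _ (3 * (E * (eps / (6 * E))))).
      by rewrite ler_wpM2l// ler_wpM2l ?(ltW E0)// !ge_min lexx !orbT.
    have -> : 3 * (E * (eps / (6 * E))) = eps / 2 by field; rewrite gt_eqF.
    lra.
have e18 : 0 < e1 <= 1 / 8 by rewrite e10.
have [r0 r00 hr0] := choose_scale a0 ab B0 e18.
have [rho [p [q [x [rho01 p0 hx xsep xsum]]]]] := hK _ r00.
have [rho1 k00 k0e rb] := hr0 _ rho01.
move/andP: rho01 => [rho0 _].
set k0 := e1 * rho `^ a in k00 k0e rb.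
have k01 : k0 <= 1 / 8 := le_trans k0e e1a.
have rbX X : X <= B -> X * rho `^ b <= ln (1 + k0) / 64.
  by move=> XB; apply: le_trans rb; rewrite ler_wpM2r// powR_ge0.
have r3b : (3 * rho) `^ b = 3 `^ b * rho `^ b by rewrite powRM// ltW.
have dF1_gt := perturbed_derivative_gt lam1 hF bF x rho k00 htau k0e e1b.
have hs2 : D * (3 * rho) `^ b <= ln (1 + k0) / 64.
  by rewrite r3b mulrA; exact: rbX.
have hs4 : 2 * C * (3 * rho) `^ b / (lam `^ a - 1) <= ln (1 + k0) / 64.
  by rewrite r3b mulrA mulrAC; exact: rbX.
have red0 := reduced_le0 lam1 hF b0 hA A1.
have V1 := subaction_periodic lam1 hF b0 hA A1.
have VD := subaction_holder lam1 hF b0 hA A1.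
have a1 : a <= 1 := le_trans (ltW ab) b1.
have b01 : 0 < b <= 1 by rewrite b0.
have a01 : 0 < a <= 1 by rewrite a0.
exists (perturbed f (bump (orbit_lift F x) rho k0)).
split.
- have [Cb hb] := perturbed_derivative_holder lam1 hF bF rho0 k00 k01 xsep b01 hC.
  exact: (perturbed_expanding lam1 hf cov ori hF rho0 k00 k01 xsep dF1_gt hb).
- have [Cb hb] := perturbed_derivative_holder lam1 hF bF rho0 k00 k01 xsep a01 hCa.
  exact: (perturbed_expanding lam1 hf cov ori hF rho0 k00 k01 xsep dF1_gt hb).
- have h := perturbed_dist lam1 a0 hf hF bF rho0 k00 k01 xsep a1 hCa rho1 erefl k0e.
  by apply: le_lt_trans h _; rewrite lte_fin.
- exact: (perturbed_locked lam1 a0 ab hf hF bF hC V1 VD red0 p0 hx rho0 k00 k01 xsep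
    xsum dF1_gt hs2 (rbX _ BK) hs4).
Qed.

End dense_locked.

(** * Genericity *)

Theorem theoremB1 (R : realType) (alpha lambda : R)
    (halpha : 0 < alpha <= 1) (hlambda : 1 < lambda) :
  exists2 G2 : set (F_plus lambda alpha), generic G2 &
    forall f : F_plus lambda alpha, G2 f ->
      let f0 : circle R -> circle R := sval (set_val (set_val f)) in
      exists nu : probability (circle R) R,
        [/\ lyapunov_maximizing f0 nu,
            (forall mu : probability (circle R) R, lyapunov_maximizing f0 mu ->
               forall A : set (circle R), measurable A -> mu A = nu A) &
            supported_on_periodic_orbit f0 nu].
Proof.
have a0 : 0 < alpha by case/andP: halpha.
(* A locked map belongs to the interior of a ball on which all maps have a unique,
   periodic maximizer; the interiors make [W] open by definition. *)
pose W : set (C1Holder_map alpha) := \bigcup_(fe in [set fe : C1Holder_map alpha * R |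
  forall g, expanding_class lambda alpha g ->
    (C1Holder_dist alpha (sval fe.1) g < fe.2%:E)%E -> periodic_lyapunov_maximizer g])
  (ball fe.1 fe.2)°.
pose U : set (F_plus lambda alpha) := [set f | W (set_val (set_val f))].
have oW : open W by apply: bigcup_open => fe _; exact: open_interior.
have oU : open U.
  have c1 := @initial_continuous (F_plus lambda alpha) _ set_val.
  have c2 := @initial_continuous (F_space lambda alpha) _ set_val.
  apply: (@open_comp _ _ (set_val : F_plus lambda alpha -> F_space lambda alpha)
     [set f : F_space lambda alpha | W (set_val f)]); first by move=> x _; exact: c1.
  by apply: open_comp oW => x _; exact: c2.
exists U; last first.
  move=> f [[f1 e] /= hlock hf]; apply: hlock; last exact: (interior_subset hf).
  exact: (set_valP (set_val f)).
exists (fun=> U); last by move=> f /(_ 0%N I).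
move=> _; split=> //.
move=> Q [f Qf] oQ.
have [Q1 oQ1 Q1E] := oQ; have [Q2 oQ2 Q2E] := oQ1.
have Q1f : Q1 (set_val f) by move: Qf; rewrite -Q1E.
have fcl := set_valP f.
have [h [[b /andP[ab b1] hb] Q1h]] := fcl _ (open_nbhs_nbhs (conj oQ1 Q1f)).
have Q2h : Q2 (set_val h) by move: Q1h; rewrite -Q2E.
have /nbhs_ballP[eps eps0 hball] := open_nbhs_nbhs (conj oQ2 Q2h).
have ha : expanding_class lambda alpha (sval (set_val h)) := set_valP h.
have [f1 [f1b f1a f1d [e e0 f1l]]] := dense_locked hlambda a0 ab b1 ha hb eps0.
have hC : C1Holder alpha f1 by case: f1a.
pose fM : C1Holder_map alpha := exist _ f1 hC.
have fMS : F_space lambda alpha fM by [].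
pose fS : F_space lambda alpha := exist _ fM (mem_set fMS).
have fSP : F_plus lambda alpha fS.
  by apply: subset_closure; exists b => //; rewrite ab.
pose fP : F_plus lambda alpha := exist _ fS (mem_set fSP).
exists fP; split.
  by rewrite -Q1E /= -Q2E /=; apply: hball.
exists (fM, e) => //=.
by apply: nbhsx_ballx.
Qed.
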